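(* Assume the following conditions. (1) There exists $\varepsilon\in(0,1)$ and, for each $\theta\in\Theta$, $y\in\mathcal{Y}$, there exists a measure $\mu_\theta(dx|y)$ on $\mathcal{X}$ such that $0<\mu_\theta(\mathcal{X}|y)<\infty$ and $\varepsilon\mu_\theta(B|y)\le\int_B r_\theta(y,x'|x)\mu(dx')\le\mu_\theta(B|y)/\varepsilon$ for all $x\in\mathcal{X}$, $B\in\mathcal{B}(\mathcal{X})$. (2) There exists a function $\psi:\mathcal{Y}\to[1,\infty)$ such that $|\partial_\theta^{\alpha}r_\theta(y,x'|x)|\le(\psi(y))^{|\alpha|}r_\theta(y,x'|x)$ for all $\theta\in\Theta$, $x,x'\in\mathcal{X}$, $y\in\mathcal{Y}$ and all $\alpha\in\mathbb{N}_0^d\setminus\{\mathbf{0}\}$ with $|\alpha|\le p$. (3) There exists a function $\phi:\mathcal{Y}\times\mathcal{X}\to[1,\infty)$ such that $r_\theta(y,x'|x)\le\phi(y,x')$ and $\int\phi(y,x'')\mu(dx'')<\infty$ for all $\theta\in\Theta$, $x,x'\in\mathcal{X}$, $y\in\mathcal{Y}$. (4) There exist a probability measure $\pi$ on $\mathcal{X}$ and real numbers $\delta\in(0,1)$, $K_0\in[1,\infty)$ such that $|P^n(x,B)-\pi(B)|\le K_0\delta^n$ for all $x\in\mathcal{X}$, $B\in\mathcal{B}(\mathcal{X})$, $n\ge0$. (5) There exist a function $\varphi:\mathcal{X}\times\mathcal{Y}\to[1,\infty)$ and a real number $q\in[0,\infty)$ such that $|\Phi_\theta(x,y,\Lambda)|\le\varphi(x,y)\|\Lambda\|^q$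 and $|\Phi_\theta(x,y,\Lambda)-\Phi_\theta(x,y,\Lambda')|\le\varphi(x,y)\|\Lambda-\Lambda'\|(\|\Lambda\|+\|\Lambda'\|)^q$ for all $\theta\in\Theta$, $x\in\mathcal{X}$, $y\in\mathcal{Y}$, $\Lambda,\Lambda'\in\mathcal{L}_0(\mathcal{X})$. (6) There exists $L_0\in[1,\infty)$ such that $\int\varphi(x,y)\psi^r(y)Q(x,dy)\le L_0$ for all $x\in\mathcal{X}$, where $r=p(p+q+1)$. Let $s=p(q+1)$. Then there exist functions $\phi_\theta$, $\tilde\phi_\theta$ mapping $\theta\in\Theta$ to $\mathbb{R}$ such that $$\phi_\theta=\lim_{n\to\infty}(\Pi^n\Phi)_\theta(z),\qquad\tilde\phi_\theta=\lim_{n\to\infty}(\tilde\Pi^n\Phi)_\theta(z)$$ for all $\theta\in\Theta$, $z\in\mathcal{Z}$. There also exist real numbers $\rho\in(0,1)$, $L\in[1,\infty)$ (depending only on $\varepsilon,\delta,p,q,K_0,L_0$) such that $$|(\Pi^n\Phi)_\theta(z)-\phi_\theta|\le L\rho^n\|\Lambda\|^s,\qquad|(\tilde\Pi^n\Phi)_\theta(z)-\tilde\phi_\theta|\le L\rho^n\psi^r(y)\|\Lambda\|^s$$ for all $\theta\in\Theta$, $x\in\mathcal{X}$, $y\in\mathcal{Y}$, $\Lambda\in\mathcal{L}_0(\mathcal{X})$, $n\ge1$ and $z=(x,y,\Lambda)$.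
   Context: Model. Integers $d,d_x,d_y,p\ge1$ are fixed; $\Theta\subset\mathbb{R}^d$ is a bounded open set; $\mathcal{X}\in\mathcal{B}(\mathbb{R}^{d_x})$, $\mathcal{Y}\in\mathcal{B}(\mathbb{R}^{d_y})$ ($\mathcal{B}(\cdot)$ denotes Borel sets); $\mu$, $\nu$ are measures on $\mathcal{X}$, $\mathcal{Y}$. $\mathcal{P}(\mathcal{X})$ is the set of probability measures and $\mathcal{M}_s(\mathcal{X})$ the set of finite signed measures on $\mathcal{X}$, with total variation norm $\|\cdot\|$. $p_\theta(x'|x)$ and $q_\theta(y|x)$ are $[0,\infty)$-valued functions of $\theta\in\Theta$, $x,x'\in\mathcal{X}$, $y\in\mathcal{Y}$ with $\int p_\theta(x'|x)\mu(dx')=\int q_\theta(y|x)\nu(dy)=1$, $p$-times differentiable in $\theta$; $r_\theta(y,x'|x)=q_\theta(y|x')p_\theta(x'|x)$. $P(x,dx')$ is a transition kernel on $\mathcal{X}$ ($P^n$ its $n$-step kernel) and $Q(x,dy)$ is a conditional probability measure on $\mathcal{Y}$ given $x\in\mathcal{X}$. All integrands are tacitly Borel measurable. Multi-indices. For $\alpha,\beta\in\mathbb{N}_0^d$: $|\alpha|=\alpha_1+\cdots+\alpha_d$; $\beta\le\alpha$ means $\beta_i\le\alpha_i$ for all $i$; $\binom{\alpha}{\beta}=\prod_i\binom{\alpha_i}{\beta_i}$; $\partial_\theta^\alpha=\partial^{|\alpha|}/\partial\theta_1^{\alpha_1}\cdots\partial\theta_d^{\alpha_d}$; $\mathbf{0}$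 is the zero multi-index. Vector measures. $\mathcal{L}_0(\mathcal{X})$ is the set of families $\Lambda=\{\lambda_\alpha:\alpha\in\mathbb{N}_0^d,|\alpha|\le p\}$ with $\lambda_\alpha\in\mathcal{M}_s(\mathcal{X})$ and $\lambda_{\mathbf{0}}\in\mathcal{P}(\mathcal{X})$; $\|\Lambda\|=\max_{|\alpha|\le p}\|\lambda_\alpha\|$, and $\|\Lambda-\Lambda'\|$ is defined componentwise in the same way. Derivative maps. For $\lambda\in\mathcal{M}_s(\mathcal{X})$, $\Lambda\in\mathcal{L}_0(\mathcal{X})$, $|\alpha|\le p$: $$r_{\theta,y}^\alpha(x|\lambda)=\int\partial_\theta^\alpha r_\theta(y,x|x')\lambda(dx'),\qquad s_{\theta,y}^\alpha(x|\Lambda)=\sum_{\beta\le\alpha}\binom{\alpha}{\beta}\frac{r_{\theta,y}^{\alpha-\beta}(x|\lambda_\beta)}{\int r_{\theta,y}^{\mathbf{0}}(x'|\lambda_{\mathbf{0}})\mu(dx')},$$ and recursively in $|\alpha|$: $f_{\theta,y}^{\mathbf{0}}(x|\Lambda)=s_{\theta,y}^{\mathbf{0}}(x|\Lambda)$ and $$f_{\theta,y}^\alpha(x|\Lambda)=s_{\theta,y}^\alpha(x|\Lambda)-\sum_{\beta\le\alpha,\,\beta\ne\alpha}\binom{\alpha}{\beta}f_{\theta,y}^\beta(x|\Lambda)\int s_{\theta,y}^{\alpha-\beta}(x'|\Lambda)\mu(dx').$$ $F_{\theta,y}^\alpha(B|\Lambda)=\int_B f_{\theta,y}^\alpha(x|\Lambda)\mu(dx)$,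 $F_{\theta,y}(\Lambda)=\{F_{\theta,y}^\alpha(\cdot|\Lambda):|\alpha|\le p\}\in\mathcal{L}_0(\mathcal{X})$. Kernels. $\mathcal{Z}=\mathcal{X}\times\mathcal{Y}\times\mathcal{L}_0(\mathcal{X})$. $\Phi_\theta(x,y,\Lambda)$ is a real-valued function of $\theta\in\Theta$, $x\in\mathcal{X}$, $y\in\mathcal{Y}$, $\Lambda\in\mathcal{L}_0(\mathcal{X})$; $\Phi_\theta(z)=\Phi_\theta(x,y,\Lambda)$ for $z=(x,y,\Lambda)$. For $B\in\mathcal{B}(\mathcal{Z})$ and $z=(x,y,\Lambda)$, $$\Pi_\theta(z,B)=\int\int I_B(x',y',F_{\theta,y'}(\Lambda))Q(x',dy')P(x,dx'),\quad\tilde\Pi_\theta(z,B)=\int\int I_B(x',y',F_{\theta,y}(\Lambda))Q(x',dy')P(x,dx').$$ $\Pi_\theta^n$, $\tilde\Pi_\theta^n$ are the $n$-step kernels, and $(\Pi^n\Phi)_\theta(z)=\int\Phi_\theta(z')\Pi_\theta^n(z,dz')$, $(\tilde\Pi^n\Phi)_\theta(z)=\int\Phi_\theta(z')\tilde\Pi_\theta^n(z,dz')$. *)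

(* Defs.v *)
From HB Require Import structures.
From mathcomp Require Import all_boot all_order all_algebra.
From mathcomp Require Import all_classical all_reals all_analysis.

Set Implicit Arguments.
Unset Strict Implicit.
Unset Printing Implicit Defensive.

Import Order.TTheory GRing.Theory Num.Theory.
Import numFieldNormedType.Exports.

Local Open Scope classical_set_scope.
Local Open Scope ring_scope.

Definition borelRn (R : realType) (n : nat) : Type :=
  g_sigma_algebraType (@open 'rV[R]_n).
HB.instance Definition _ (R : realType) (n : nat) :=
  Measurable.on (borelRn R n).

(* The subspace A of R^n with the trace of the Borel sigma-algebra.  The
   library's measurable types are pointed, hence the argument [A0]. *)
Definition subRn (R : realType) (n : nat) (A : set (borelRn R n))
  (A0 : A !=set0) : Type := set_type A.

Section subRn_instances.
Context (R : realType) (n : nat) (A : set (borelRn R n)) (A0 : A !=set0).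

Definition subRn_val (x : subRn A0) : borelRn R n := \val x.

HB.instance Definition _ := gen_eqMixin (subRn A0).
HB.instance Definition _ := gen_choiceMixin (subRn A0).
HB.instance Definition _ := isPointed.Build (subRn A0)
  (exist _ (projT1 (cid A0)) (mem_set (projT2 (cid A0)))).
HB.instance Definition _ := Measurable.copy (subRn A0)
  (g_sigma_algebra_preimageType subRn_val).

End subRn_instances.

(* a ranges over the multi-indices in N^d with |a| <= p *)
Definition midx_wf (d p : nat) (a : {ffun 'I_d -> 'I_p.+1}) : bool :=
  (\sum_i a i <= p)%N.

Definition midx (d p : nat) : finType :=
  {a : {ffun 'I_d -> 'I_p.+1} | midx_wf a}.

Section multi_indices.
Context (d p : nat).
Implicit Types a b : midx d p.

Definition mval a (i : 'I_d) : nat := val a i.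

Definition mabs a : nat := (\sum_i mval a i)%N.

Definition mle b a : bool := [forall i, (mval b i <= mval a i)%N].

Definition mbin a b : nat := (\prod_i 'C(mval a i, mval b i))%N.

Lemma midx0_subproof : midx_wf [ffun _ : 'I_d => ord0 : 'I_p.+1].
Proof. by rewrite /midx_wf big1// => i _; rewrite ffunE. Qed.

Definition midx0 : midx d p := Sub _ midx0_subproof.

Lemma mval_le a i : (mval a i <= p)%N.
Proof. by rewrite -ltnS; exact: ltn_ord. Qed.

Lemma msub_subproof a b :
  midx_wf [ffun i => inord (mval a i - mval b i) : 'I_p.+1].
Proof.
apply: leq_trans (valP a); apply: leq_sum => i _; rewrite ffunE inordK.
  exact: leq_subr.
by rewrite ltnS (leq_trans (leq_subr _ _))// mval_le.
Qed.

(* a - b, only meaningful when b <= a *)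
Definition msub a b : midx d p := Sub _ (msub_subproof a b).

Lemma mval_msub a b i : mval (msub a b) i = (mval a i - mval b i)%N.
Proof.
rewrite /mval/= ffunE inordK// ltnS (leq_trans (leq_subr _ _))//.
exact: mval_le.
Qed.

Lemma mabs_lt a b : mle b a -> b != a -> (mabs b < mabs a)%N.
Proof.
move=> /forallP ba; apply: contraNT; rewrite -leqNgt => ab.
apply/eqP/val_inj/ffunP => i; apply/val_inj/eqP.
rewrite -[_ == _]/(mval b i == mval a i) eqn_leq ba/=.
rewrite leqNgt; apply/negP => lt_i.
suff : (mabs b < mabs a)%N by rewrite ltnNge ab.
rewrite /mabs (bigD1 i)//= [ltnRHS](bigD1 i)//= -addSn leq_add// leq_sum//.
Qed.

End multi_indices.

Section derivatives.
Context (R : realType) (d : nat).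
Implicit Type g : 'rV[R]_d -> R.

Definition partial (i : 'I_d) g : 'rV[R]_d -> R :=
  fun th => 'D_(delta_mx 0 i) g th.

Definition mpartial (p : nat) (a : midx d p) g : 'rV[R]_d -> R :=
  foldr (fun i h => iter (mval a i) (partial i) h) g (enum 'I_d).

(* Frechet differentiability; for D open this only depends on g on D. *)
Fixpoint ntimes_differentiable (n : nat) (D : set 'rV[R]_d) g : Prop :=
  if n is m.+1 then
    (forall th, D th -> differentiable g th) /\
    (forall i, ntimes_differentiable m D (partial i g))
  else True.

End derivatives.

Section signed_measures.
Context d (T : measurableType d) (R : realType).
Implicit Type nu : {charge set T -> \bar R}.

Lemma hahn_pair_ex nu :
  exists PN : set T * set T, hahn_decomposition nu PN.1 PN.2.
Proof. by have [P [N PN]] := Hahn_decomposition nu; exists (P, N). Qed.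

Definition hahn_pairP nu := projT2 (cid (hahn_pair_ex nu)).

Definition tvnorm nu : R := fine (charge_variation (hahn_pairP nu) setT).

Definition cintegral nu (g : T -> R) : R :=
  Rintegral (jordan_pos (hahn_pairP nu)) setT g -
  Rintegral (jordan_neg (hahn_pairP nu)) setT g.

Definition csub (nu nu' : {charge set T -> \bar R}) :
  {charge set T -> \bar R} := cadd nu (copp nu').

End signed_measures.

(* Charges are functions on all subsets of T, so that elements of [vmeas] that
   agree on measurable sets need not be equal; they are at [vdist] 0. *)
Record vmeas dT (T : measurableType dT) (R : realType) (d p : nat) := VMeas {
  vcomp :> midx d p -> {charge set T -> \bar R} ;
  vcomp0_ge0 : forall B, measurable B -> (0 <= vcomp (midx0 d p) B)%E ;
  vcomp0T : vcomp (midx0 d p) setT = 1%E }.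

Section vector_measures.
Context dT (T : measurableType dT) (R : realType) (d p : nat).
Implicit Types La : vmeas T R d p.

Definition vnorm La : R := \big[Num.max/0]_(a : midx d p) tvnorm (La a).

Definition vdist La La' : R :=
  \big[Num.max/0]_(a : midx d p) tvnorm (csub (La a) (La' a)).

Definition vopen (U : set (vmeas T R d p)) : Prop :=
  forall La, U La -> exists2 e, 0 < e & forall La', vdist La La' < e -> U La'.

Let vpoint_comp (a : midx d p) : {charge set T -> \bar R} :=
  charge_of_finite_measure (@dirac _ T point R).

Let vpoint_ge0 B : measurable B -> (0 <= vpoint_comp (midx0 d p) B)%E.
Proof. by move=> _; exact: measure_ge0. Qed.

Let vpointT : vpoint_comp (midx0 d p) setT = 1%E.
Proof. by rewrite /vpoint_comp/= /charge_of_finite_measure diracT. Qed.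

HB.instance Definition _ := gen_eqMixin (vmeas T R d p).
HB.instance Definition _ := gen_choiceMixin (vmeas T R d p).
HB.instance Definition _ := isPointed.Build (vmeas T R d p)
  (VMeas vpoint_ge0 vpointT).

(* Borel sigma-algebra of the total variation distance *)
HB.instance Definition _ := Measurable.copy (vmeas T R d p)
  (g_sigma_algebraType vopen).

End vector_measures.

Section derivative_maps.
Context (R : realType) (d p : nat).
Context dX (X : measurableType dX) dY (Y : measurableType dY).
Variable mu : {measure set X -> \bar R}.
(* [ptheta th x' x] is the transition density from x to x', [qtheta th y x]
   the density of the observation y in state x *)
Variables (ptheta : 'rV[R]_d -> X -> X -> R) (qtheta : 'rV[R]_d -> Y -> X -> R).
Implicit Types (th : 'rV[R]_d) (a b : midx d p) (La : vmeas X R d p).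

Definition rtheta th (y : Y) (x' x : X) : R := qtheta th y x' * ptheta th x' x.

Definition drtheta a th (y : Y) (x' x : X) : R :=
  mpartial a (fun t => rtheta t y x' x) th.

Definition rder th y a (x : X) (la : {charge set X -> \bar R}) : R :=
  cintegral la (fun x' => drtheta a th y x x').

Definition sder th y a (x : X) La : R :=
  \sum_(b : midx d p | mle b a)
    (mbin a b)%:R * (rder th y (msub a b) x (La b) /
      Rintegral mu setT (fun x' => rder th y (midx0 d p) x' (La (midx0 d p)))).

(* The recursion on |a| is run with fuel n; see [fderE]. *)
Fixpoint fder_rec (n : nat) th y a (x : X) La : R :=
  if n is m.+1 then
    sder th y a x La -
    \sum_(b : midx d p | mle b a && (b != a))
      (mbin a b)%:R * fder_rec m th y b x La *
        Rintegral mu setT (fun x' => sder th y (msub a b) x' La)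
  else sder th y a x La.

Definition fder th y a (x : X) La : R := fder_rec (mabs a) th y a x La.

Lemma fder_rec_fuel n th y a x La :
  (mabs a <= n)%N -> fder_rec n th y a x La = fder th y a x La.
Proof.
rewrite /fder.
elim: n {-2}n (leqnn n) a => [|k IH] n nk a an.
  by move: an nk; rewrite leqn0 => + /eqP n0; rewrite n0 leqn0 => /eqP ->.
case: n nk an => [|n] nk an; first by move: an; rewrite leqn0 => /eqP ->.
case aE : (mabs a) => [|m] /=.
  rewrite big1 ?subr0// => b /andP[ba bNa].
  by have := mabs_lt ba bNa; rewrite aE.
congr (_ - _); apply: eq_bigr => b /andP[ba bNa].
have bm : (mabs b <= m)%N by rewrite -ltnS -aE mabs_lt.
have mn : (m <= n)%N by rewrite -ltnS -aE.
rewrite (IH n)//; last exact: leq_trans bm mn.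
by rewrite (IH m)//; exact: leq_trans mn nk.
Qed.

Lemma fderE th y a x La : fder th y a x La =
  sder th y a x La -
  \sum_(b : midx d p | mle b a && (b != a))
    (mbin a b)%:R * fder th y b x La *
      Rintegral mu setT (fun x' => sder th y (msub a b) x' La).
Proof.
rewrite {1}/fder; case aE : (mabs a) => [|m] /=.
  rewrite big1 ?subr0// => b /andP[ba bNa].
  by have := mabs_lt ba bNa; rewrite aE.
congr (_ - _); apply: eq_bigr => b /andP[ba bNa].
by rewrite fder_rec_fuel// -ltnS -aE mabs_lt.
Qed.

(* The vector measure with densities [fder th y a ^~ La] with respect to mu;
   La itself is a junk value used if there is no such element of [vmeas]. *)
Definition Fder th y La : vmeas X R d p :=
  xget La [set La' : vmeas X R d p | forall a B, measurable B ->
    La' a B = (\int[mu]_(x in B) (fder th y a x La)%:E)%E].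

End derivative_maps.

Fixpoint nstep dT (T : measurableType dT) (R : realType)
    (k : T -> set T -> \bar R) (n : nat) (x : T) (B : set T) : \bar R :=
  if n is m.+1 then (\int[k x]_x' nstep k m x' B)%E else \d_x B.

Section kernels.
Context (R : realType) (d p : nat).
Context dX (X : measurableType dX) dY (Y : measurableType dY).
Variables (P : R.-pker X ~> X) (Q : R.-pker X ~> Y).
Variable F : Y -> vmeas X R d p -> vmeas X R d p.

(* The product sigma-algebra on Zspace is the Borel sigma-algebra of the
   product topology, X and Y being separable metric spaces. *)
Definition Zspace : Type := (X * Y * vmeas X R d p)%type.
HB.instance Definition _ := Measurable.on Zspace.

Definition Pker (z : Zspace) (B : set Zspace) : \bar R :=
  (\int[P z.1.1]_x' \int[Q x']_y' (\1_B ((x', y', F y' z.2) : Zspace))%:E)%E.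

Definition Pker_tilde (z : Zspace) (B : set Zspace) : \bar R :=
  (\int[P z.1.1]_x' \int[Q x']_y'
     (\1_B ((x', y', F z.1.2 z.2) : Zspace))%:E)%E.

(* Extended real valued, so that a finite value for a measurable g entails that
   g is integrable. *)
Definition kiter (k : Zspace -> set Zspace -> \bar R) (n : nat)
    (g : Zspace -> R) (z : Zspace) : \bar R :=
  (\int[nstep k n z]_z' (g z')%:E)%E.

End kernels.

(* Main.v *)
Require Import Defs.
From HB Require Import structures.
From mathcomp Require Import all_boot all_order all_algebra.
From mathcomp Require Import all_classical all_reals all_analysis.
From mathcomp Require Import measurable_realfun zify ring lra.

Set Implicit Arguments.
Unset Strict Implicit.
Unset Printing Implicit Defensive.

Import Order.TTheory GRing.Theory Num.Theory.
Import numFieldNormedType.Exports.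

Local Open Scope classical_set_scope.
Local Open Scope ring_scope.

(** The statistic carried by both chains is a filter together with its
derivatives in the parameter.  The order zero component is the filter itself.
Under the two-sided mixing bound it forgets its initial law geometrically along
every sequence of observations: seen backwards from the final time, one step
maps two positive measures of equal final mass to measures that share a fixed
fraction of this mass ([props_contract]).  A component of positive order
satisfies an inhomogeneous linear recursion.  Its linear part is the tangent map
of the filter, which contracts for the same reason ([projected_contract]), and
its source involves components of lower order only ([jet_stepE]).  By induction
on the order and variation of constants, the component of order [a] stays below
a constant times M^|a| if M bounds the initial data and the weights of the
observations ([jet_growth]), and two solutions driven by the same observations
approach each other geometrically ([jet_forgets]).  Everything is homogeneous in
M, and sums of multi-binomial coefficients are powers of two, so that the
constants depend on the order and on the mixing constant only.  This part lives
in an abstract normed space with a mass functional; it applies to L1(mu), which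
contains the components after one update, and a separate first step leads there
from arbitrary vector measures ([scaled_Fders], [Fders_forget]).

The chains reduce to one operator, h(x, v) |-> E h(x', F y' v), where (x', y') is
the next signal and observation.  The (n+1)-st iterate of either kernel is the
n-th iterate of this operator, applied to the average of the observable over one
step ([integral_nstep_averaged]).  For n = m + k, the last k steps make the
statistic forget what the first m steps made of it, so that there it may be
replaced by a fixed one ([iter_near_reset]).  What remains is a function of the
signal alone, integrated against the m-step law of the signal, which is close to
its stationary law ([Rintegral_setwise_close]).  Hence the n-th iterate is close
to a number that depends on k only, and for m and k near n/2 these numbers
converge geometrically ([averages_converge]).  The bounds along an individual
sequence of observations contain a power of the largest weight; replacing it by
the sum of the powers makes it integrable and costs a factor linear in n, which
a slightly larger ratio absorbs.

All this requires the kernels to be measurable.  The total variation distance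
is not separable in general, but the updated vector measures have densities in L1(mu),
which is separable because the Borel sets of the state space are countably
generated ([L1_approx], [measurable_Fder]).  The derivatives of the transition
densities are measurable in the remaining variables as limits of difference
quotients ([measurable_mpartial]). *)

(** * Multi-indices *)

Section multi_index_theory.
Context (d p : nat).
Implicit Types a b : midx d p.

Lemma midxP a b : (forall i, mval a i = mval b i) -> a = b.
Proof. by move=> ab; apply/val_inj/ffunP => i; apply/val_inj/ab. Qed.

Lemma mval0 i : mval (midx0 d p) i = 0%N.
Proof. by rewrite /mval /= ffunE. Qed.

Lemma mle_refl a : mle a a.
Proof. by apply/forallP. Qed.

Lemma mle0 a : mle (midx0 d p) a.
Proof. by apply/forallP => i; rewrite mval0. Qed.

Lemma mle_eq0 a : mle a (midx0 d p) = (a == midx0 d p).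
Proof.
apply/idP/eqP => [/forallP a0|->]; last exact: mle_refl.
by apply: midxP => i; apply/eqP; have := a0 i; rewrite mval0 leqn0.
Qed.

Lemma mabs0 : mabs (midx0 d p) = 0%N.
Proof. by rewrite /mabs big1// => i _; rewrite mval0. Qed.

Lemma mabs_eq0 a : (mabs a == 0%N) = (a == midx0 d p).
Proof.
apply/idP/eqP => [|->]; last by rewrite mabs0.
rewrite /mabs sum_nat_eq0 => /forallP a0; apply: midxP => i.
by rewrite mval0; apply/eqP; exact: (implyP (a0 i)).
Qed.

Lemma mabs_le_p a : (mabs a <= p)%N.
Proof. exact: (valP a). Qed.

Lemma mle_mabs b a : mle b a -> (mabs b <= mabs a)%N.
Proof. by move=> /forallP ba; apply: leq_sum. Qed.

Lemma mabs_msub a b : mle b a -> (mabs (msub a b) + mabs b)%N = mabs a.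
Proof.
move=> /forallP ba; rewrite /mabs -big_split/=; apply: eq_bigr => i _.
by rewrite mval_msub subnK.
Qed.

Lemma mabs_msub_lt a b : mle b a -> b != midx0 d p ->
  (mabs (msub a b) < mabs a)%N.
Proof.
by move=> ba; rewrite -mabs_eq0 -lt0n => b0; rewrite -(mabs_msub ba) -addn1 leq_add2l.
Qed.

Lemma msub_id a : msub a a = midx0 d p.
Proof. by apply: midxP => i; rewrite mval_msub subnn mval0. Qed.

Lemma msub0r a : msub a (midx0 d p) = a.
Proof. by apply: midxP => i; rewrite mval_msub mval0 subn0. Qed.

Lemma mbin_id a : mbin a a = 1%N.
Proof. by rewrite /mbin big1// => i _; rewrite binn. Qed.

Lemma mbin0r a : mbin a (midx0 d p) = 1%N.
Proof. by rewrite /mbin big1// => i _; rewrite mval0 bin0. Qed.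

(** Expanding the product over i of the sums of the binomials C(a_i, j) over
    j <= a_i.  The value depends on the order of the multi-index only, which is
    what keeps all the constants independent of the dimension. *)
Lemma sum_mbin a : (\sum_(b : midx d p | mle b a) mbin a b = 2 ^ mabs a)%N.
Proof.
transitivity (\prod_(i : 'I_d) \sum_(j : 'I_p.+1 | (j <= mval a i)%N)
                 'C(mval a i, j))%N; last first.
  rewrite /mabs expn_sum; apply: eq_bigr => i _.
  rewrite -[RHS]/((1 + 1) ^ mval a i)%N expnDn.
  rewrite -(big_mkord (fun j => (j <= mval a i)%N)
    (fun j => 'C(mval a i, j))).
  rewrite (big_cat_nat (n := (mval a i).+1))//= ?ltnS ?mval_le//.
  rewrite [X in (_ + X)%N]big_nat_cond [X in (_ + X)%N]big1 ?addn0; last first.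
    by move=> j /andP[/andP[aj _]]; rewrite leqNgt aj.
  rewrite -[RHS](big_mkord xpredT (fun j => 'C(mval a i, j) * (1 ^ (mval a i - j) * 1 ^ j)))%N.
  rewrite big_nat_cond [RHS]big_nat_cond; apply: eq_big => j.
    by rewrite leq0n /= ltnS andbT andbb.
  by rewrite !exp1n !muln1.
rewrite bigA_distr_big_dep/=.
rewrite (reindex_omap (val : midx d p -> {ffun 'I_d -> 'I_p.+1}) insub)/=; last first.
  move=> f /familyP fa; rewrite insubT//=.
  rewrite /midx_wf; apply: leq_trans (mabs_le_p a); apply: leq_sum => i _.
  by have := fa i.
apply: eq_bigl => b; rewrite valK eqxx andbT.
apply/forallP/familyP => [h i|h i]; by have := h i.
Qed.

End multi_index_theory.

(** * Contraction of abstract filters *)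

(** What the argument uses of the space of finite signed measures: total mass,
    total variation, the cone of positive measures with a Jordan decomposition,
    and the operators lambda |-> int d^a r_y(., x) lambda(dx).  The two-sided
    comparison of the order zero operators with a fixed measure [dom y] is the
    strong mixing condition. *)
Record filterSystem (R : realType) (I : Type) (d p : nat) (eps : R)
    (psi : I -> R) := FilterSystem {
  fs_sort :> lmodType R ;
  mass : fs_sort -> R ;
  tv : fs_sort -> R ;
  pos : fs_sort -> Prop ;
  prop : I -> midx d p -> fs_sort -> fs_sort ;
  dom : I -> fs_sort ;
  massD : forall u v, mass (u + v) = mass u + mass v ;
  massZ : forall c u, mass (c *: u) = c * mass u ;
  tvD : forall u v, tv (u + v) <= tv u + tv v ;
  tvZ : forall c u, tv (c *: u) = `|c| * tv u ;
  mass_le_tv : forall u, `|mass u| <= tv u ;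
  posD : forall u v, pos u -> pos v -> pos (u + v) ;
  posZ : forall c u, 0 <= c -> pos u -> pos (c *: u) ;
  pos_tv : forall u, pos u -> tv u = mass u ;
  jordan : forall w, exists u v,
    [/\ pos u, pos v, w = u - v & tv w = mass u + mass v] ;
  propD : forall y a u v, prop y a (u + v) = prop y a u + prop y a v ;
  propZ : forall y a c u, prop y a (c *: u) = c *: prop y a u ;
  prop_pos : forall y u, pos u -> pos (prop y (midx0 d p) u) ;
  dom_pos : forall y, pos (dom y) ;
  dom_gt0 : forall y, 0 < mass (dom y) ;
  prop_low : forall y u, pos u ->
    pos (prop y (midx0 d p) u - (eps * mass u) *: dom y) ;
  prop_up : forall y u, pos u ->
    pos ((eps^-1 * mass u) *: dom y - prop y (midx0 d p) u) ;
  tv_prop : forall y a u,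
    tv (prop y a u) <= psi y ^+ mabs a * (eps^-1 * mass (dom y) * tv u) }.

Section contraction.
Context (R : realType) (I : Type) (d p : nat) (eps : R) (psi : I -> R).
Variable W : @filterSystem R I d p eps psi.
Hypothesis eps01 : 0 < eps < 1.
Implicit Types (u v w : W) (y : I) (ys : seq I).

Let eps_gt0 : 0 < eps. Proof. by case/andP: eps01. Qed.
Let eps_ge0 : 0 <= eps. Proof. exact: ltW. Qed.
Let epsV_gt0 : 0 < eps^-1. Proof. by rewrite invr_gt0. Qed.
Let epsV_ge0 : 0 <= eps^-1. Proof. exact: ltW. Qed.
Let epsV_ge1 : 1 <= eps^-1. Proof. by rewrite invf_ge1// ltW//; case/andP: eps01. Qed.

Lemma massN u : mass (- u) = - mass u.
Proof. by rewrite -scaleN1r massZ mulN1r. Qed.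

Lemma massB u v : mass (u - v) = mass u - mass v.
Proof. by rewrite massD massN. Qed.

Lemma tv_ge0 u : 0 <= tv u.
Proof. exact: le_trans (mass_le_tv u). Qed.

Lemma tv0 : tv (0 : W) = 0.
Proof. by rewrite -(scale0r (0 : W)) tvZ normr0 mul0r. Qed.

Lemma tvN u : tv (- u) = tv u.
Proof. by rewrite -scaleN1r tvZ normrN1 mul1r. Qed.

Lemma tvB u v : tv (u - v) <= tv u + tv v.
Proof. by rewrite (le_trans (tvD _ _))// tvN. Qed.

Lemma tv_sum (J : Type) (s : seq J) (P : pred J) (F : J -> W) :
  tv (\sum_(j <- s | P j) F j) <= \sum_(j <- s | P j) tv (F j).
Proof.
elim/big_rec2: _ => [|j x1 x2 _ h]; first by rewrite tv0.
by rewrite (le_trans (tvD _ _))// lerD2l.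
Qed.

Lemma pos_mass u : pos u -> 0 <= mass u.
Proof. by move=> /pos_tv <-; exact: tv_ge0. Qed.

Lemma propN y a u : prop y a (- u) = - prop y a u.
Proof. by rewrite -scaleN1r propZ scaleN1r. Qed.

Lemma propB y a u v : prop y a (u - v) = prop y a u - prop y a v.
Proof. by rewrite propD propN. Qed.

Local Notation R0 y := (prop y (midx0 d p)).

Definition props ys w := foldl (fun w y => R0 y w) w ys.

Lemma propsB ys u v : props ys (u - v) = props ys u - props ys v.
Proof. by elim: ys u v => //= y ys ih u v; rewrite propB ih. Qed.

Lemma propsD ys u v : props ys (u + v) = props ys u + props ys v.
Proof. by elim: ys u v => //= y ys ih u v; rewrite propD ih. Qed.

Lemma propsZ ys c u : props ys (c *: u) = c *: props ys u.
Proof. by elim: ys u => //= y ys ih u; rewrite propZ ih. Qed.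

Lemma props_pos ys u : pos u -> pos (props ys u).
Proof. by elim: ys u => //= y ys ih u pu; apply/ih/prop_pos. Qed.

Lemma mass_props_le ys u v : pos (u - v) ->
  mass (props ys v) <= mass (props ys u).
Proof.
by move=> /(props_pos ys)/pos_mass; rewrite propsB massB subr_ge0.
Qed.

Lemma mass_prop_low y u : pos u -> eps * mass u * mass (dom W y) <= mass (R0 y u).
Proof. by move=> /(prop_low y)/pos_mass; rewrite massB massZ subr_ge0. Qed.

Lemma mass_props_gt0 ys u : pos u -> 0 < mass u -> 0 < mass (props ys u).
Proof.
elim: ys u => //= y ys ih u pu mu; apply: ih; first exact: prop_pos.
by apply: lt_le_trans (mass_prop_low y pu); rewrite !mulr_gt0// dom_gt0.
Qed.

Lemma mass_prop_gt0 y u : pos u -> 0 < mass u -> 0 < mass (R0 y u).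
Proof. exact: (@mass_props_gt0 [:: y]). Qed.

(** After one step both measures are comparable with [dom y], each up to a
    factor eps^-1. *)
Lemma mass_props_ratio ys u v : pos u -> pos v -> mass v = 1 ->
  mass (props ys u) <= eps^-1 ^+ 2 * mass u * mass (props ys v).
Proof.
case: ys => [|y ys] pu pv mv /=.
  rewrite mv mulr1 ler_peMl ?pos_mass//.
  by rewrite expr2 mulr_ege1.
have := mass_props_le ys (prop_up y pu); rewrite propsZ massZ.
move=> /le_trans; apply.
rewrite (_ : _ ^+ 2 * _ * _ =
  eps^-1 * mass u * (eps^-1 * mass (props ys (R0 y v)))); last by ring.
rewrite ler_wpM2l ?mulr_ge0 ?pos_mass// ler_pdivlMl//.
by have := mass_props_le ys (prop_low y pv); rewrite propsZ massZ mv mulr1.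
Qed.

Definition kap := 1 - eps ^+ 2.

Lemma kap_ge0 : 0 <= kap.
Proof. by rewrite subr_ge0 exprn_ile1// ltW//; case/andP: eps01. Qed.

Lemma kap_lt1 : kap < 1.
Proof. by rewrite /kap ltrBlDr ltrDl exprn_gt0. Qed.

(** Doeblin coupling for the time-inhomogeneous chain obtained by conditioning
    on the future: two positive measures with the same final mass share, after
    one step, a multiple of [dom y] that carries a fraction eps^2 of this mass;
    removing it leaves two positive measures with the same final mass. *)
Lemma props_contract ys u v : pos u -> pos v ->
  mass (props ys u) = mass (props ys v) ->
  tv (props ys (u - v)) <= kap ^+ size ys * (2 * mass (props ys u)).
Proof.
elim: ys u v => [|y ys ih] u v pu pv /= uv.
  rewrite expr0 mul1r; apply: le_trans (tvB _ _) _.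
  by rewrite !pos_tv// -uv mulr2n mulrDl !mul1r.
set be := mass (props ys (R0 y u)) in uv *.
set bm := mass (props ys (dom W y)).
have bm0 : 0 < bm by apply: mass_props_gt0; [exact: dom_pos|exact: dom_gt0].
have be0 : 0 <= be by apply/pos_mass/props_pos/prop_pos.
(* the common part of the two measures; its final mass is eps ^+ 2 * be *)
pose w : W := (eps ^+ 2 * be / bm) *: dom W y.
have below u' : pos u' -> mass (props ys (R0 y u')) = be -> pos (R0 y u' - w).
  move=> pu' u'be.
  have -> : R0 y u' - w = (R0 y u' - (eps * mass u') *: dom W y) +
      (eps * mass u' - eps ^+ 2 * be / bm) *: dom W y.
    by rewrite scalerBl addrA subrK.
  apply: posD; first exact: prop_low.
  apply: posZ; last exact: dom_pos.
  have := mass_props_le ys (prop_up y pu').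
  rewrite propsZ massZ u'be -/bm => h.
  rewrite subr_ge0 expr2 -!mulrA ler_wpM2l// mulrA ler_pdivrMr//.
  by rewrite -(ler_pM2l epsV_gt0) !mulrA mulVf ?gt_eqF// mul1r.
have mw u' : mass (props ys (R0 y u')) = be ->
    mass (props ys (R0 y u' - w)) = kap * be.
  move=> u'be; rewrite propsB propsZ massB massZ u'be -/bm.
  by rewrite divfK ?gt_eqF// /kap mulrBl mul1r.
have := ih (R0 y u - w) (R0 y v - w) (below _ pu erefl) (below _ pv (esym uv)).
rewrite mw// mw// => /(_ erefl).
rewrite opprB addrA subrK -propB => /le_trans; apply.
by rewrite exprSr -!mulrA [kap * (2 * _)]mulrCA.
Qed.

Definition filter_path (o : nat -> I) (m : nat -> W) :=
  [/\ pos (m 0%N), mass (m 0%N) = 1 &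
    forall k, m k.+1 = (mass (R0 (o k) (m k)))^-1 *: R0 (o k) (m k)].

Lemma filter_pathP o m k : filter_path o m -> pos (m k) /\ mass (m k) = 1.
Proof.
move=> [u0 m0 uS]; elim: k => // k [pk mk].
have h : 0 < mass (R0 (o k) (m k)) by apply: mass_prop_gt0; rewrite ?mk.
rewrite uS massZ mulVf ?gt_eqF//; split => //.
by apply: posZ; [rewrite invr_ge0 ltW|exact: prop_pos].
Qed.

Lemma filter_path_shift o m : filter_path o m ->
  filter_path (o \o succn) (m \o succn).
Proof.
move=> h; have [? ?] := filter_pathP 1 h.
by case: h => _ _ hS; split => // k; exact: hS.
Qed.

(** Derivative of the normalised one-step map at [u] with value [u'], in the
    direction [w]. *)
Definition tangent y u u' w : W :=
  (mass (R0 y u))^-1 *: (R0 y w - mass (R0 y w) *: u').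

Lemma tangentB y u u' v w :
  tangent y u u' (v - w) = tangent y u u' v - tangent y u u' w.
Proof.
rewrite /tangent -scalerBr propB massB scalerBl !opprB; congr (_ *: _).
by rewrite addrACA [RHS]addrACA [- _ - _]addrC.
Qed.

Lemma tangentZ y u u' c w : tangent y u u' (c *: w) = c *: tangent y u u' w.
Proof.
by rewrite /tangent propZ massZ -scalerA -scalerBr !scalerA mulrC.
Qed.

Definition C0 := 2 * eps^-1 ^+ 2.

Lemma C0_ge1 : 1 <= C0.
Proof.
have : 1 <= eps^-1 ^+ 2 by rewrite expr2 mulr_ege1.
by rewrite /C0 => ?; lra.
Qed.

(** Propagating [w] linearly and projecting off the filter contracts, because
    the difference is the image of two positive measures of equal final mass. *)
Lemma projected_contract ys u0 un w : pos u0 -> mass u0 = 1 ->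
  props ys u0 = mass (props ys u0) *: un ->
  tv ((mass (props ys u0))^-1 *: (props ys w - mass (props ys w) *: un))
    <= C0 * (kap ^+ size ys * tv w).
Proof.
move=> p0 m0 un_def; have [w1 [w2 [pw1 pw2 -> ->]]] := jordan w.
set b := mass (props ys u0) in un_def *.
have b0 : 0 < b by apply: mass_props_gt0; rewrite ?m0.
(* adding multiples of u0 gives the two parts of w the same final mass *)
pose c1 := mass (props ys w1) / b; pose c2 := mass (props ys w2) / b.
have c1b : c1 * b = mass (props ys w1) by rewrite divfK ?gt_eqF.
have c2b : c2 * b = mass (props ys w2) by rewrite divfK ?gt_eqF.
have c1_ge0 : 0 <= c1 by rewrite divr_ge0 ?(ltW b0)//; exact/pos_mass/props_pos.
have c2_ge0 : 0 <= c2 by rewrite divr_ge0 ?(ltW b0)//; exact/pos_mass/props_pos.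
have pu : pos (w1 + c2 *: u0) by apply: posD => //; exact: posZ.
have pv : pos (w2 + c1 *: u0) by apply: posD => //; exact: posZ.
have h := @props_contract ys _ _ pu pv.
rewrite propsB !propsD !propsZ !massD !massZ -/b c1b c2b in h.
have {}h := h (addrC _ _).
rewrite tvZ ger0_norm ?invr_ge0 ?(ltW b0)//.
have -> : props ys (w1 - w2) - mass (props ys (w1 - w2)) *: un =
    (props ys w1 + c2 *: props ys u0) - (props ys w2 + c1 *: props ys u0).
  rewrite propsB massB -c1b -c2b un_def -/b !scalerA scalerBl.
  by rewrite opprB opprD addrA [RHS]addrACA -!addrA; congr (_ + _); rewrite addrC addrA.
rewrite mulrC ler_pdivrMr//; apply: le_trans h _.
rewrite (_ : _ * b = kap ^+ size ys * (C0 * (mass w1 + mass w2) * b)); last by ring.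
rewrite ler_wpM2l ?exprn_ge0 ?kap_ge0// /C0.
have := mass_props_ratio ys pw1 p0 m0; have := mass_props_ratio ys pw2 p0 m0.
rewrite -/b => ? ?; lra.
Qed.

Lemma filter_path_props o m n : filter_path o m ->
  props (mkseq o n) (m 0%N) = mass (props (mkseq o n) (m 0%N)) *: m n.
Proof.
move=> h; elim: n => [|n ih]; first by case: h => ? m0 _; rewrite /= m0 scale1r.
rewrite mkseqS /props foldl_rcons -/(props _ _) ih.
case: (h) => _ _ ->; rewrite propZ massZ scalerA.
rewrite -mulrA mulfV ?mulr1// gt_eqF//.
by have [? m1] := filter_pathP n h; apply: mass_prop_gt0; rewrite ?m1.
Qed.

Fixpoint tangent_path (o : nat -> I) (m : nat -> W) (w : W) n : W :=
  if n is k.+1 then tangent (o k) (m k) (m k.+1) (tangent_path o m w k) else w.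

Lemma tangent_pathE o m w n : filter_path o m ->
  tangent_path o m w n.+1 = (mass (props (mkseq o n.+1) (m 0%N)))^-1 *:
    (props (mkseq o n.+1) w - mass (props (mkseq o n.+1) w) *: m n.+1).
Proof.
move=> h; elim: n => [//|n ih].
set k := n.+1 in ih *.
rewrite -[LHS]/(tangent (o k) (m k) (m k.+1) (tangent_path o m w k)) ih.
rewrite [in RHS]mkseqS /props !foldl_rcons -/(props _ _) -/(props _ w).
rewrite tangentZ tangentB tangentZ.
have -> : tangent (o k) (m k) (m k.+1) (m k) = 0.
  rewrite /tangent; case: (h) => _ _ ->; rewrite scalerA mulfV ?scale1r ?subrr ?scaler0//.
  by rewrite gt_eqF//; have [? m1] := filter_pathP k h; apply: mass_prop_gt0; rewrite ?m1.
rewrite scaler0 subr0 /tangent scalerA; congr (_ *: _).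
by rewrite [in RHS](filter_path_props k h) propZ massZ invfM.
Qed.

Lemma tv_tangent_path o m w n : filter_path o m ->
  tv (tangent_path o m w n) <= C0 * (kap ^+ n * tv w).
Proof.
move=> h; case: n => [|n].
  by rewrite /= expr0 mul1r ler_peMl ?tv_ge0// C0_ge1.
rewrite (tangent_pathE _ _ h) -[X in kap ^+ X](size_mkseq o).
by case: (h) => ? ? _; apply: projected_contract => //; exact: filter_path_props.
Qed.

(** Discrete variation of constants: the error made at step [k] is damped by
    the contraction over the remaining steps. *)
Lemma perturbed_tangent n o m (w : nat -> W) (h : nat -> R) :
  filter_path o m ->
  (forall k, (k < n)%N ->
    tv (w k.+1 - tangent (o k) (m k) (m k.+1) (w k)) <= h k) ->
  tv (w n) <= C0 * (kap ^+ n * tv (w 0%N) +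
                    \sum_(k < n) kap ^+ (n - k.+1) * h k).
Proof.
elim: n o m w h => [|n ih] o m w h om wh.
  by rewrite big_ord0 addr0 expr0 mul1r ler_peMl ?tv_ge0// C0_ge1.
pose v := tangent_path o m (w 0%N).
have := ih _ _ (fun k => w k.+1 - v k.+1) (fun k => h k.+1) (filter_path_shift om).
have step k : (k < n)%N -> tv (w k.+2 - v k.+2 -
    tangent (o k.+1) (m k.+1) (m k.+2) (w k.+1 - v k.+1)) <= h k.+1.
  move=> kn.
  rewrite tangentB /= opprB addrA subrK.
  by apply: wh; rewrite ltnS.
move/(_ step) => {}step; have -> : w n.+1 = (w n.+1 - v n.+1) + v n.+1 by rewrite subrK.
rewrite (le_trans (tvD _ _))// big_ord_recl subSS subn0.
have := tv_tangent_path (w 0%N) n.+1 om; rewrite -/(v n.+1).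
have : tv (w 1%N - v 1%N) <= h 0%N by apply: wh.
move: step; under [in X in _ -> _ -> _ -> X]eq_bigr do rewrite lift0 subSS.
set S := \sum_(_ < _) _; move=> h1 h2 h3.
rewrite addrC mulrDr lerD// (le_trans h1)// ler_wpM2l ?(le_trans _ C0_ge1)//.
by rewrite lerD2r ler_wpM2l// exprn_ge0// kap_ge0.
Qed.

(** The difference is, up to normalisation, the initial law of one filter
    propagated along the other one and projected off it; the two normalising
    masses differ by a factor of at most eps^-2. *)
Lemma filter_forgets o m m' n : filter_path o m -> filter_path o m' ->
  tv (m n - m' n) <= eps^-1 ^+ 2 * (C0 * kap ^+ n).
Proof.
move=> om om'.
have [pu0 mu0 _] := om; have [pv0 mv0 _] := om'.
have := projected_contract (m' 0%N) pu0 mu0 (filter_path_props n om).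
rewrite (filter_path_props n om') size_mkseq (pos_tv pv0) mv0 mulr1.
set b := mass (props _ (m _)); set b' := mass (props _ (m' _)).
have b0 : 0 < b by apply: mass_props_gt0; rewrite ?mu0.
have b'0 : 0 < b' by apply: mass_props_gt0; rewrite ?mv0.
have [_ mvn] := filter_pathP n om'.
rewrite massZ mvn mulr1 -scalerBr scalerA tvZ => h.
have -> : tv (m n - m' n) = tv (m' n - m n) by rewrite -tvN opprB.
rewrite gtr0_norm ?mulr_gt0 ?invr_gt0// in h.
have : b <= eps^-1 ^+ 2 * b' .
  by have := mass_props_ratio (mkseq o n) pu0 pv0 mv0; rewrite mu0 mulr1.
rewrite -ler_pdivrMr// => hb.
apply: le_trans (ler_wpM2l _ h); last by rewrite exprn_ge0.
rewrite mulrA ler_peMl ?tv_ge0//.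
apply: le_trans (ler_wpM2r _ hb); last by rewrite mulr_ge0 ?invr_ge0 ?ltW.
rewrite le_eqVlt; apply/orP; left; apply/eqP; field.
by rewrite !gt_eqF.
Qed.

End contraction.

(** * Growth of the derivatives *)

Section jets.
Context (R : realType) (I : Type) (d p : nat) (eps : R) (psi : I -> R).
Variable W : @filterSystem R I d p eps psi.
Hypothesis eps01 : 0 < eps < 1.
Implicit Types (u v w : W) (y : I) (a b : midx d p) (L f : midx d p -> W).

Local Notation m0 := (midx0 d p).
Local Notation R0 y := (prop y m0).
Local Notation mix := (eps^-1 ^+ 2).
Local Notation B := (2 ^+ p : R).

Let eps_gt0 : 0 < eps. Proof. by case/andP: eps01. Qed.
Let epsV_gt0 : 0 < eps^-1. Proof. by rewrite invr_gt0. Qed.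
Let epsV_ge0 : 0 <= eps^-1. Proof. exact: ltW. Qed.
Let epsV_ge1 : 1 <= eps^-1.
Proof. by rewrite invf_ge1// ltW//; case/andP: eps01. Qed.
Let mix_ge1 : 1 <= mix.
Proof. by rewrite expr2 mulr_ege1. Qed.
Let mix_ge0 : 0 <= mix. Proof. exact: le_trans mix_ge1. Qed.
Let B_ge1 : 1 <= B. Proof. by rewrite exprn_ege1// ler1n. Qed.
Let B_ge0 : 0 <= B. Proof. exact: le_trans B_ge1. Qed.

Lemma mbin_sum_le a (P : pred (midx d p)) (F : midx d p -> R) (c : R) : 0 <= c ->
  (forall b, mle b a -> P b -> F b <= c) ->
  \sum_(b : midx d p | mle b a && P b) (mbin a b)%:R * F b <= B * c.
Proof.
move=> c0 Fc.
apply: (@le_trans _ _ (\sum_(b : midx d p | mle b a) (mbin a b)%:R * c)).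
  rewrite big_mkcondr; apply: ler_sum => b ba.
  by case: ifPn => Pb; rewrite ?mulr_ge0 ?ler0n// ler_wpM2l ?ler0n// Fc.
rewrite -mulr_suml ler_wpM2r// -natr_sum sum_mbin natrX.
by rewrite ler_weXn2l ?ler1n// mabs_le_p.
Qed.

Lemma tv_mbin_sum a (P : pred (midx d p)) (F : midx d p -> W) (c : R) : 0 <= c ->
  (forall b, mle b a -> P b -> tv (F b) <= c) ->
  tv (\sum_(b : midx d p | mle b a && P b) (mbin a b)%:R *: F b) <= B * c.
Proof.
move=> c0 Fc; apply: le_trans (tv_sum _ _ _) _.
under eq_bigr do rewrite tvZ normr_nat.
exact: mbin_sum_le.
Qed.

(** Normalised operators: their norm does not see the size of [dom y]. *)
Definition nprop y u a w : W := (mass (R0 y u))^-1 *: prop y a w.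

Lemma npropB y u a v w : nprop y u a (v - w) = nprop y u a v - nprop y u a w.
Proof. by rewrite /nprop propB scalerBr. Qed.

Lemma tv_nprop y u a w (M : R) : psi y <= M -> 0 <= psi y -> pos u -> mass u = 1 ->
  tv (nprop y u a w) <= mix * M ^+ mabs a * tv w.
Proof.
move=> yM y0 pu mu; have h := mass_prop_low y pu; rewrite mu mulr1 in h.
have c0 : 0 < mass (R0 y u) by apply: mass_prop_gt0; rewrite ?mu.
rewrite /nprop tvZ gtr0_norm ?invr_gt0// ler_pdivrMl//.
apply: le_trans (tv_prop _ _ _) _.
apply: (@le_trans _ _ (M ^+ mabs a * (eps^-1 * mass (dom W y) * tv w))).
  apply: ler_wpM2r.
    by rewrite !mulr_ge0 ?tv_ge0 ?(ltW epsV_gt0) ?(ltW (dom_gt0 _ _)).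
  by rewrite lerXn2r// nnegrE// (le_trans y0).
rewrite [leRHS](_ : _ = eps^-1 * mass (R0 y u) * eps^-1 * (M ^+ mabs a * tv w)); last by ring.
rewrite [leLHS](_ : _ = eps^-1 * mass (dom W y) * (M ^+ mabs a * tv w)); last by ring.
apply: ler_wpM2r; first by rewrite mulr_ge0 ?tv_ge0 ?exprn_ge0 ?(le_trans y0).
by rewrite -mulrA ler_pM2l// mulrC ler_pdivlMl.
Qed.

(** [sjet] are the derivatives of the unnormalised update divided by the mass
    of its order zero part; [jet_step] is the Leibniz rule for the quotient. *)
Definition sjet y L a : W :=
  \sum_(b | mle b a) (mbin a b)%:R *: nprop y (L m0) (msub a b) (L b).

Definition jet_step y L f := forall a, f a = sjet y L a -
  \sum_(b | mle b a && (b != a))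
    ((mbin a b)%:R * mass (sjet y L (msub a b))) *: f b.

Definition jet_path (o : nat -> I) (F : nat -> midx d p -> W) :=
  [/\ pos (F 0%N m0), mass (F 0%N m0) = 1 &
    forall k, jet_step (o k) (F k) (F k.+1)].

Lemma sjet0 y L : sjet y L m0 = nprop y (L m0) m0 (L m0).
Proof.
rewrite /sjet (big_pred1 m0) => [|b]; last by rewrite /= mle_eq0.
by rewrite mbin_id scale1r msub_id.
Qed.

Lemma jet_step0 y L f : jet_step y L f -> f m0 = nprop y (L m0) m0 (L m0).
Proof.
move=> /(_ m0); rewrite sjet0 big_pred0 ?subr0// => b.
by rewrite mle_eq0 andbN.
Qed.

Lemma jet_path_filter o F : jet_path o F -> filter_path o (fun k => F k m0).
Proof. by move=> [? ? FS]; split=> // k; rewrite (jet_step0 (FS k)). Qed.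

Definition sjet_low y L a : W :=
  \sum_(b | mle b a && (b != a)) (mbin a b)%:R *: nprop y (L m0) (msub a b) (L b).

Lemma sjetE y L a : sjet y L a = sjet_low y L a + nprop y (L m0) m0 (L a).
Proof.
rewrite /sjet (bigD1 a) ?mle_refl//= addrC; congr (_ + _).
by rewrite mbin_id scale1r msub_id.
Qed.

Definition jet_rest y L f a : W := sjet_low y L a - mass (sjet_low y L a) *: f m0 -
  \sum_(b | mle b a && ((b != a) && (b != m0)))
    (mbin a b)%:R *: (mass (sjet y L (msub a b)) *: f b).

(** The component of order [a] of the old jet occurs in [sjet y L a] with
    coefficient one, and in the term of index zero of the quotient rule through
    the mass of [sjet y L a]; these two occurrences form the tangent map. *)
Lemma jet_stepE y L f a : jet_step y L f -> a != m0 ->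
  f a = tangent y (L m0) (f m0) (L a) + jet_rest y L f a.
Proof.
move=> h a0; rewrite {1}h (bigD1 m0)/=; last by rewrite mle0 eq_sym.
rewrite msub0r mbin0r mul1r sjetE massD scalerDl.
rewrite /tangent scalerBr -/(nprop _ _ _ _) scalerA -massZ -/(nprop _ _ _ _).
rewrite /jet_rest.
under eq_bigl do rewrite -andbA.
under eq_bigr do rewrite -scalerA.
set S := \sum_(_ | _) _.
rewrite !opprD !addrA; congr (_ + _); rewrite addrAC; congr (_ + _).
by rewrite [RHS]addrC addrA.
Qed.

Section bounds.
Variable M : R.
Hypothesis M_ge1 : 1 <= M.
Let M_ge0 : 0 <= M. Proof. exact: le_trans M_ge1. Qed.

Definition jet_le (c : R) (j : nat) L :=
  forall b, (mabs b <= j)%N -> tv (L b) <= c * M ^+ mabs b.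

Lemma tv_sjet_sum y L a j (A : R) (P : pred (midx d p)) :
  psi y <= M -> 0 <= psi y -> pos (L m0) -> mass (L m0) = 1 -> 0 <= A ->
  jet_le A j L -> (forall b, mle b a -> P b -> (mabs b <= j)%N) ->
  tv (\sum_(b | mle b a && P b)
    (mbin a b)%:R *: nprop y (L m0) (msub a b) (L b))
  <= B * (mix * A * M ^+ mabs a).
Proof.
move=> yM y0 pL mL A0 LA Pj; apply: tv_mbin_sum => [|b ba Pb].
  by rewrite !mulr_ge0 ?exprn_ge0.
apply: le_trans (tv_nprop _ _ yM y0 pL mL) _.
rewrite -(mabs_msub ba) exprD.
rewrite [leRHS](_ : _ = mix * M ^+ mabs (msub a b) * (A * M ^+ mabs b)); last by ring.
rewrite ler_wpM2l//; first by rewrite mulr_ge0 ?exprn_ge0.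
exact: LA (Pj _ ba Pb).
Qed.

Lemma tv_sjet y L a j (A : R) :
  psi y <= M -> 0 <= psi y -> pos (L m0) -> mass (L m0) = 1 -> 0 <= A ->
  jet_le A j L -> (mabs a <= j)%N ->
  tv (sjet y L a) <= B * (mix * A * M ^+ mabs a).
Proof.
move=> yM y0 pL mL A0 LA aj; rewrite /sjet.
rewrite (eq_bigl (fun b => mle b a && true)); last by move=> b; rewrite andbT.
by apply: tv_sjet_sum LA _ => // b ba _; exact: leq_trans (mle_mabs ba) aj.
Qed.

Lemma tv_sjet_low y L a j (A : R) :
  psi y <= M -> 0 <= psi y -> pos (L m0) -> mass (L m0) = 1 -> 0 <= A ->
  jet_le A j L -> mabs a = j.+1 ->
  tv (sjet_low y L a) <= B * (mix * A * M ^+ mabs a).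
Proof.
move=> yM y0 pL mL A0 LA aj; apply: tv_sjet_sum LA _ => // b ba bNa.
by rewrite -ltnS -aj mabs_lt.
Qed.

Lemma tv_jet_rest y L f a j (A : R) :
  psi y <= M -> 0 <= psi y -> pos (L m0) -> mass (L m0) = 1 -> 1 <= A ->
  jet_le A j L -> jet_le A j f -> tv (f m0) <= 1 -> mabs a = j.+1 ->
  tv (jet_rest y L f a) <= 3 * mix * B ^+ 2 * A ^+ 2 * M ^+ mabs a.
Proof.
move=> yM y0 pL mL A1 LA fA f01 aj; have A0 : 0 <= A by exact: le_trans A1.
have low := tv_sjet_low yM y0 pL mL A0 LA aj.
have Mj : 0 <= M ^+ mabs a by rewrite exprn_ge0.
have low' : tv (mass (sjet_low y L a) *: f m0) <= B * (mix * A * M ^+ mabs a).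
  rewrite tvZ (le_trans _ low)// -[leRHS]mulr1.
  by rewrite ler_pM// ?tv_ge0// mass_le_tv.
have S : tv (\sum_(b | mle b a && ((b != a) && (b != m0)))
    (mbin a b)%:R *: (mass (sjet y L (msub a b)) *: f b)) <=
    B * (B * (mix * A * A * M ^+ mabs a)).
  apply: tv_mbin_sum => [|b ba /andP[bNa bN0]]; first by rewrite !mulr_ge0.
  rewrite tvZ.
  have ab : (mabs (msub a b) <= j)%N by rewrite -ltnS -aj mabs_msub_lt.
  have h1 := tv_sjet yM y0 pL mL A0 LA ab.
  have h2 : tv (f b) <= A * M ^+ mabs b by apply: fA; rewrite -ltnS -aj mabs_lt.
  have := ler_pM (normr_ge0 _) (tv_ge0 _) (le_trans (mass_le_tv _) h1) h2.
  move=> /le_trans; apply; rewrite -(mabs_msub ba) exprD.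
  by rewrite le_eqVlt; apply/orP; left; apply/eqP; ring.
rewrite /jet_rest; apply: le_trans (tvB _ _) _.
apply: (@le_trans _ _ (B * (mix * A * M ^+ mabs a) +
  B * (mix * A * M ^+ mabs a) + B * (B * (mix * A * A * M ^+ mabs a)))).
  by rewrite lerD// (le_trans (tvB _ _))// lerD.
set X := B * (mix * A * M ^+ mabs a).
have X0 : 0 <= X by rewrite !mulr_ge0.
have : X <= B * A * X by rewrite ler_peMl// mulr_ege1.
rewrite (_ : B * (B * _) = B * A * X); last by rewrite /X; ring.
rewrite (_ : 3 * _ * _ * _ * _ = 3 * (B * A * X)); last by rewrite /X; ring.
by move=> ?; lra.
Qed.

End bounds.

(** The factor 3 counts the terms of [jet_rest]; the powers of [B] bound the
    sums of multi-binomial coefficients in it. *)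
Fixpoint growth (j : nat) : R :=
  if j is k.+1 then C0 eps * (1 + 3 * mix ^+ 2 * B ^+ 2 * growth k ^+ 2) else 1.

Lemma growth_ge1 j : 1 <= growth j.
Proof.
elim: j => //= j ih; rewrite mulr_ege1 ?C0_ge1// lerDl.
have ? : 0 <= growth j by exact: le_trans ih.
by rewrite !mulr_ge0.
Qed.

Lemma growthS j : growth j <= growth j.+1.
Proof.
have g1 := growth_ge1 j.
have h : growth j <= growth j ^+ 2 by rewrite expr2 ler_peMl// (le_trans _ g1).
apply: le_trans h _ => /=.
have g2 : 0 <= growth j ^+ 2 by rewrite exprn_ge0// (le_trans _ g1).
apply: (@le_trans _ _ (1 + 3 * mix ^+ 2 * B ^+ 2 * growth j ^+ 2)); last first.
  by rewrite ler_peMl ?C0_ge1// addr_ge0// mulr_ge0// !mulr_ge0 ?exprn_ge0.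
rewrite (le_trans (_ : _ <= 3 * mix ^+ 2 * B ^+ 2 * growth j ^+ 2))//; last by rewrite lerDr.
by rewrite ler_peMl// !mulr_ege1// ?exprn_ege1// ?ler1n.
Qed.

Lemma growth_le i j : (i <= j)%N -> growth i <= growth j.
Proof.
move=> /subnK <-; elim: (j - i)%N => // k ih.
by rewrite addSn; exact: le_trans ih (growthS _).
Qed.

Lemma sum_kap_le n : \sum_(k < n) kap eps ^+ (n - k.+1) <= mix.
Proof.
have k0 := kap_ge0 eps01; have k1 := kap_lt1 eps01.
rewrite (reindex_inj rev_ord_inj)/=.
rewrite (eq_bigr (fun k : 'I_n => kap eps ^+ k)); last first.
  by move=> k _ /=; rewrite subnSK// subKn// ltnW.
have -> : mix = (1 - kap eps)^-1 by rewrite /kap subKr exprVn.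
rewrite -[leRHS]mul1r ler_pdivlMr ?subr_gt0//.
rewrite -opprB mulrN mulrC -subrX1 opprB lerBlDr lerDl exprn_ge0//.
Qed.

(** By induction on the order.  The contraction of the tangent maps sums the
    lower order terms over time to a bound that does not depend on the time,
    and every term of order [a] is homogeneous of degree |a| in [M]. *)
Lemma jet_growth o F M k a : 1 <= M -> (forall k, 0 <= psi (o k) <= M) ->
  jet_path o F -> jet_le M 1 p (F 0%N) ->
  tv (F k a) <= growth (mabs a) * M ^+ mabs a.
Proof.
move=> M1 oM oF F0; have M0 : 0 <= M by exact: le_trans M1.
have oF0 := jet_path_filter oF.
have mF n : pos (F n m0) /\ mass (F n m0) = 1 by exact: (filter_pathP eps01 n oF0).
have F1 n : tv (F n m0) <= 1 by have [pn mn] := mF n; rewrite (pos_tv pn) mn.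
have [j aj] := ubnP (mabs a); elim: j a aj k => // j ih a aj k.
have [a0|a0] := eqVneq a m0; first by rewrite a0 mabs0 expr0 mulr1.
have [i ai] : exists i, mabs a = i.+1.
  by exists (mabs a).-1; rewrite prednK// lt0n mabs_eq0.
have lei n : jet_le M (growth i) i (F n).
  move=> b bi; apply: le_trans (ih _ _ n) _.
    by rewrite (leq_ltn_trans bi)// -ai -ltnS.
  by rewrite ler_wpM2r ?exprn_ge0// growth_le.
have g1 := growth_ge1 i; have g0 : 0 <= growth i by exact: le_trans g1.
pose h : nat -> R := fun=> 3 * mix * B ^+ 2 * growth i ^+ 2 * M ^+ mabs a.
have step n : (n < k)%N -> tv (F n.+1 a -
    tangent (o n) (F n m0) (F n.+1 m0) (F n a)) <= h n.
  move=> _; case: (oF) => _ _ /(_ n)/jet_stepE/(_ a0) {1}->.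
  rewrite addrAC subrr add0r; have [? ?] := mF n; have /andP[? ?] := oM n.
  exact: (@tv_jet_rest _ _ (o n) (F n) (F n.+1) a i (growth i)).
apply: le_trans (perturbed_tangent eps01 (w := F^~ a) oF0 step) _.
rewrite ai [growth _]/= -[leRHS]mulrA ler_wpM2l ?(le_trans _ (C0_ge1 eps01))//.
rewrite mulrDl mul1r lerD//.
  rewrite (le_trans (ler_piMl _ _))// ?tv_ge0// ?exprn_ile1 ?kap_ge0//.
    exact/ltW/kap_lt1.
  by rewrite -ai -[leRHS]mul1r; apply: F0; exact: mabs_le_p.
rewrite /h -mulr_suml ai.
rewrite [leRHS](_ : _ = mix * (3 * mix * B ^+ 2 * growth i ^+ 2 * M ^+ i.+1)); last by ring.
by rewrite ler_wpM2r ?sum_kap_le// !mulr_ge0// exprn_ge0.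
Qed.

End jets.

(** * Forgetting of the initial derivatives *)

Section forgetting.
Context (R : realType) (I : Type) (d p : nat) (eps : R) (psi : I -> R).
Variable W : @filterSystem R I d p eps psi.
Hypothesis eps01 : 0 < eps < 1.
Implicit Types (u v w : W) (y : I) (a b : midx d p) (L f : midx d p -> W).

Local Notation m0 := (midx0 d p).
Local Notation R0 y := (prop y m0).
Local Notation mix := (eps^-1 ^+ 2).
Local Notation B := (2 ^+ p : R).

Let eps_gt0 : 0 < eps. Proof. by case/andP: eps01. Qed.
Let epsV_gt0 : 0 < eps^-1. Proof. by rewrite invr_gt0. Qed.
Let epsV_ge0 : 0 <= eps^-1. Proof. exact: ltW. Qed.
Let epsV_ge1 : 1 <= eps^-1.
Proof. by rewrite invf_ge1// ltW//; case/andP: eps01. Qed.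
Let mix_ge1 : 1 <= mix. Proof. by rewrite expr2 mulr_ege1. Qed.
Let mix_ge0 : 0 <= mix. Proof. exact: le_trans mix_ge1. Qed.
Let B_ge1 : 1 <= B. Proof. by rewrite exprn_ege1// ler1n. Qed.
Let B_ge0 : 0 <= B. Proof. exact: le_trans B_ge1. Qed.

Lemma subrACA (V : zmodType) (a b c e : V) : a - b - (c - e) = a - c - (b - e).
Proof. by rewrite !opprB addrACA [RHS]addrACA [- b - c]addrC. Qed.

Section differences.
Variable M : R.
Hypothesis M_ge1 : 1 <= M.
Let M_ge0 : 0 <= M. Proof. exact: le_trans M_ge1. Qed.

Definition is_prob u := pos u /\ mass u = 1.

(** The last term comes from the two normalising masses, whose relative
    difference is the mass of an image of [u' - u]. *)
Lemma nprop_diff y u u' a w w' : 0 <= psi y <= M -> is_prob u -> is_prob u' ->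
  tv (nprop y u a w - nprop y u' a w') <=
  mix * M ^+ mabs a * (tv (w - w') + mix * tv (u - u') * tv w').
Proof.
move=> /andP[y0 yM] [pu mu] [pu' mu'].
have -> : nprop y u a w - nprop y u' a w' =
    nprop y u a (w - w') + (nprop y u a w' - nprop y u' a w').
  by rewrite npropB addrA subrK.
rewrite mulrDr (le_trans (tvD _ _))// lerD//; first exact: tv_nprop.
have c0 : 0 < mass (R0 y u) by apply: mass_prop_gt0; rewrite ?mu.
have c'0 : 0 < mass (R0 y u') by apply: mass_prop_gt0; rewrite ?mu'.
set c := mass (R0 y u) in c0 *; set c' := mass (R0 y u') in c'0 *.
have -> : nprop y u a w' - nprop y u' a w' =
    mass (nprop y u m0 (u' - u)) *: nprop y u' a w'.
  rewrite /nprop -/c -/c' massZ propB massB -/c -/c' scalerA -scalerBl.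
  by congr (_ *: _); field; rewrite !gt_eqF.
rewrite tvZ.
have h1 : `|mass (nprop y u m0 (u' - u))| <= mix * tv (u - u').
  apply: le_trans (mass_le_tv _) _.
  have := tv_nprop eps01 m0 (u' - u) yM y0 pu mu.
  by rewrite mabs0 expr0 mulr1 -[tv (u' - u)]tvN opprB.
have h2 := tv_nprop eps01 a w' yM y0 pu' mu'.
apply: le_trans (ler_pM (normr_ge0 _) (tv_ge0 _) h1 h2) _.
by rewrite le_eqVlt; apply/orP; left; apply/eqP; ring.
Qed.

Variables (y : I) (L L' f f' : midx d p -> W) (A E : R) (j : nat).
Hypothesis yM : 0 <= psi y <= M.
Hypotheses (pL : is_prob (L m0)) (pL' : is_prob (L' m0)).
Hypotheses (A_ge1 : 1 <= A) (E_ge0 : 0 <= E).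
Hypotheses (LA : jet_le M A p L) (LA' : jet_le M A p L').
Hypothesis LE : jet_le M E j (fun b => L b - L' b).

Let A_ge0 : 0 <= A. Proof. exact: le_trans A_ge1. Qed.

Let LE0 : tv (L m0 - L' m0) <= E.
Proof. by have := @LE m0; rewrite mabs0 expr0 mulr1; apply. Qed.

Lemma tv_sjet_sum_diff a (P : pred (midx d p)) :
  (forall b, mle b a -> P b -> (mabs b <= j)%N) ->
  tv (\sum_(b | mle b a && P b)
        (mbin a b)%:R *: nprop y (L m0) (msub a b) (L b) -
      \sum_(b | mle b a && P b)
        (mbin a b)%:R *: nprop y (L' m0) (msub a b) (L' b))
  <= B * (2 * mix ^+ 2 * A * E * M ^+ mabs a).
Proof.
move=> Pj; rewrite -sumrB; under eq_bigr do rewrite -scalerBr.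
apply: tv_mbin_sum => [|b ba Pb]; first by rewrite !mulr_ge0 ?exprn_ge0.
apply: le_trans (nprop_diff _ _ _ yM pL pL') _.
rewrite -(mabs_msub ba) exprD.
rewrite [leRHS](_ : _ = mix * M ^+ mabs (msub a b) *
  (2 * mix * A * E * M ^+ mabs b)); last by ring.
have MB : 0 <= M ^+ mabs b by rewrite exprn_ge0.
rewrite ler_wpM2l//; first by rewrite mulr_ge0 ?exprn_ge0.
have h1 := LE (Pj _ ba Pb); have h2 := LA' (mabs_le_p b).
have h3 : tv (L m0 - L' m0) * tv (L' b) <= E * (A * M ^+ mabs b).
  by rewrite ler_pM ?tv_ge0.
have h4 : mix * (tv (L m0 - L' m0) * tv (L' b)) <= mix * (E * (A * M ^+ mabs b)).
  by rewrite ler_wpM2l.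
have h5 : E * M ^+ mabs b <= mix * A * (E * M ^+ mabs b).
  by rewrite ler_peMl ?mulr_ge0// mulr_ege1.
apply: le_trans (lerD h1 _) _; first by rewrite -mulrA; exact: h4.
apply: le_trans (lerD h5 (lexx _)) _.
by rewrite le_eqVlt; apply/orP; left; apply/eqP; ring.
Qed.

Lemma tv_sjet_diff a : (mabs a <= j)%N ->
  tv (sjet y L a - sjet y L' a) <= B * (2 * mix ^+ 2 * A * E * M ^+ mabs a).
Proof.
move=> aj; have e b : mle b a = mle b a && predT b by rewrite andbT.
rewrite /sjet !(eq_bigl _ _ e); apply: tv_sjet_sum_diff => b ba _.
exact: leq_trans (mle_mabs ba) aj.
Qed.

Lemma tv_sjet_low_diff a : mabs a = j.+1 ->
  tv (sjet_low y L a - sjet_low y L' a) <=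
  B * (2 * mix ^+ 2 * A * E * M ^+ mabs a).
Proof.
move=> aj; apply: tv_sjet_sum_diff => b ba bNa.
by rewrite -ltnS -aj mabs_lt.
Qed.

Lemma tv_massZ_diff u v w w' (x1 x2 x3 x4 : R) :
  tv (u - v) <= x1 -> tv w <= x2 -> tv v <= x3 -> tv (w - w') <= x4 ->
  tv (mass u *: w - mass v *: w') <= x1 * x2 + x3 * x4.
Proof.
move=> h1 h2 h3 h4.
have -> : mass u *: w - mass v *: w' =
    mass (u - v) *: w + mass v *: (w - w').
  by rewrite massB scalerBl scalerBr addrA subrK.
rewrite (le_trans (tvD _ _))// !tvZ lerD//.
  by rewrite ler_pM ?tv_ge0// (le_trans (mass_le_tv _)).
by rewrite ler_pM ?tv_ge0// (le_trans (mass_le_tv _)).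
Qed.

Hypotheses (fA : jet_le M A p f) (fA' : jet_le M A p f').
Hypotheses (f1 : tv (f m0) <= 1) (f1' : tv (f' m0) <= 1).
Hypothesis fE : jet_le M E j (fun b => f b - f' b).

Let fE0 : tv (f m0 - f' m0) <= E.
Proof. by have := @fE m0; rewrite mabs0 expr0 mulr1; apply. Qed.

Let jet_le_low c (L0 : midx d p -> W) i : (i <= p)%N ->
  jet_le M c p L0 -> jet_le M c i L0.
Proof. by move=> ip h b bi; apply: h; exact: leq_trans bi ip. Qed.

Definition diff_cst := mix ^+ 2 * A ^+ 2 * B ^+ 2.

Lemma tv_jet_rest_diff a : mabs a = j.+1 ->
  tv (jet_rest y L f a - jet_rest y L' f' a) <=
  8 * diff_cst * E * M ^+ mabs a.
Proof.
move=> aj; have jp : (j <= p)%N by rewrite ltnW// -aj mabs_le_p.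
have [pL1 mL1] := pL; have [pL1' mL1'] := pL'; have /andP[y0 yM'] := yM.
have Ma : 0 <= M ^+ mabs a by rewrite exprn_ge0.
have low := tv_sjet_low_diff aj.
have low' := tv_sjet_low eps01 M_ge1 yM' y0 pL1' mL1' A_ge0 (jet_le_low jp LA') aj.
have T2 := tv_massZ_diff low f1 low' fE0.
have T3 : tv (\sum_(b | mle b a && ((b != a) && (b != m0)))
      (mbin a b)%:R *: (mass (sjet y L (msub a b)) *: f b) -
    \sum_(b | mle b a && ((b != a) && (b != m0)))
      (mbin a b)%:R *: (mass (sjet y L' (msub a b)) *: f' b)) <=
    B * (3 * mix ^+ 2 * A ^+ 2 * B * E * M ^+ mabs a).
  rewrite -sumrB; under eq_bigr do rewrite -scalerBr.
  apply: tv_mbin_sum => [|b ba /andP[bNa bN0]]; first by rewrite !mulr_ge0.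
  have ab : (mabs (msub a b) <= j)%N by rewrite -ltnS -aj mabs_msub_lt.
  have bj : (mabs b <= j)%N by rewrite -ltnS -aj mabs_lt.
  have h1 := tv_sjet_diff ab.
  have h3 := tv_sjet eps01 M_ge1 yM' y0 pL1' mL1' A_ge0 (jet_le_low jp LA') ab.
  apply: le_trans (tv_massZ_diff h1 (fA (mabs_le_p b)) h3 (fE bj)) _.
  rewrite -(mabs_msub ba) exprD.
  set X := M ^+ _; set Y := M ^+ _.
  have : mix * A * B * E * (X * Y) <= mix * A * (mix * A * B * E * (X * Y)).
    by rewrite ler_peMl ?mulr_ege1// !mulr_ge0// exprn_ge0.
  rewrite (_ : B * (2 * mix ^+ 2 * A * E * X) * (A * Y) =
    2 * (mix * A * (mix * A * B * E * (X * Y)))); last by ring.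
  rewrite (_ : B * (mix * A * X) * (E * Y) = mix * A * B * E * (X * Y)); last by ring.
  rewrite (_ : 3 * _ * _ * _ * _ * _ = 3 * (mix * A * (mix * A * B * E * (X * Y)))); last by ring.
  by move=> ?; lra.
have -> : jet_rest y L f a - jet_rest y L' f' a =
    (sjet_low y L a - sjet_low y L' a) -
    (mass (sjet_low y L a) *: f m0 - mass (sjet_low y L' a) *: f' m0) -
    (\sum_(b | mle b a && ((b != a) && (b != m0)))
      (mbin a b)%:R *: (mass (sjet y L (msub a b)) *: f b) -
    \sum_(b | mle b a && ((b != a) && (b != m0)))
      (mbin a b)%:R *: (mass (sjet y L' (msub a b)) *: f' b)).
  by rewrite /jet_rest subrACA; congr (_ - _); rewrite subrACA.
apply: le_trans (tvB _ _) _; apply: le_trans (lerD (tvB _ _) (lexx _)) _.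
apply: le_trans (lerD (lerD low T2) T3) _.
set X := mix * A * B * E * M ^+ mabs a.
have X0 : 0 <= X by rewrite !mulr_ge0.
have h1 : X <= mix * A * B * X by rewrite ler_peMl// !mulr_ege1.
have h2 : mix * X <= mix * A * B * X.
  by rewrite ler_wpM2r// -mulrA ler_peMr// mulr_ege1.
rewrite (_ : B * (2 * mix ^+ 2 * A * E * M ^+ mabs a) = 2 * (mix * X)); last by rewrite /X; ring.
rewrite (_ : B * (mix * A * M ^+ mabs a) * E = X); last by rewrite /X; ring.
rewrite (_ : B * (3 * _ * _ * _ * _ * _) = 3 * (mix * A * B * X)); last by rewrite /X; ring.
rewrite (_ : 8 * _ * _ * _ = 8 * (mix * A * B * X)); last by rewrite /diff_cst /X; ring.
by lra.
Qed.

Lemma tv_tangent_diff a w : tv w <= A * M ^+ mabs a ->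
  tv (tangent y (L m0) (f m0) w - tangent y (L' m0) (f' m0) w) <=
  3 * diff_cst * E * M ^+ mabs a.
Proof.
move=> wA; have Ma : 0 <= M ^+ mabs a by rewrite exprn_ge0.
have tanE L1 (f0 : W) : tangent y (L1 m0) f0 w =
    nprop y (L1 m0) m0 w - mass (nprop y (L1 m0) m0 w) *: f0.
  by rewrite /tangent scalerBr scalerA -massZ.
rewrite !tanE.
have h1 : tv (nprop y (L m0) m0 w - nprop y (L' m0) m0 w) <=
    mix ^+ 2 * A * E * M ^+ mabs a.
  apply: le_trans (nprop_diff _ _ _ yM pL pL') _.
  rewrite mabs0 expr0 mulr1 subrr tv0 add0r.
  rewrite [leRHS](_ : _ = mix * (mix * (E * (A * M ^+ mabs a)))); last by ring.
  by rewrite ler_wpM2l// -mulrA ler_wpM2l// ler_pM ?tv_ge0.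
have h2 : tv (nprop y (L' m0) m0 w) <= mix * (A * M ^+ mabs a).
  have [pL1' mL1'] := pL'; have /andP[y0 yM'] := yM.
  apply: le_trans (tv_nprop eps01 m0 w yM' y0 pL1' mL1') _.
  by rewrite mabs0 expr0 mulr1 ler_wpM2l.
have T := tv_massZ_diff h1 f1 h2 fE0.
rewrite subrACA.
apply: le_trans (tvB _ _) _; apply: le_trans (lerD h1 T) _.
set X := mix * A * E * M ^+ mabs a.
have X0 : 0 <= X by rewrite !mulr_ge0.
have BA : 1 <= A * B ^+ 2 by rewrite mulr_ege1// exprn_ege1.
have h3 : mix * X <= mix * (A * B ^+ 2) * X.
  by rewrite ler_wpM2r// ler_peMr.
have h4 : X <= mix * X by rewrite ler_peMl.
rewrite (_ : mix ^+ 2 * A * E * M ^+ mabs a = mix * X); last by rewrite /X; ring.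
rewrite (_ : mix * (A * M ^+ mabs a) * E = X); last by rewrite /X; ring.
rewrite (_ : 3 * _ * _ * _ = 3 * (mix * (A * B ^+ 2) * X)); last by rewrite /diff_cst /X; ring.
by lra.
Qed.

End differences.

(** The error of order [i.+1] obtained from the errors of lower order by variation
    of constants; 11 is 8 + 3, from [tv_jet_rest_diff] and [tv_tangent_diff]. *)
Fixpoint forget (j n : nat) : R :=
  if j is i.+1 then forget i n + C0 eps * (2 * kap eps ^+ n +
    \sum_(k < n) kap eps ^+ (n - k.+1) *
      (11 * diff_cst (growth p eps p) * (forget i k + forget i k.+1)))
  else mix * (C0 eps * kap eps ^+ n).

Lemma diff_cst_ge0 (A : R) : 0 <= A -> 0 <= diff_cst A.
Proof. by move=> A0; rewrite !mulr_ge0. Qed.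

Let gp_ge0 : 0 <= growth p eps p.
Proof. by apply: le_trans (growth_ge1 p eps01 p). Qed.

Let C0_ge0 : 0 <= C0 eps. Proof. exact: le_trans (C0_ge1 eps01). Qed.

Lemma forget_ge0 j n : 0 <= forget j n.
Proof.
have k0 := kap_ge0 eps01.
elim: j n => [|j ih] n /=; first by rewrite !mulr_ge0// exprn_ge0.
rewrite addr_ge0// mulr_ge0// addr_ge0//; first by rewrite mulr_ge0 ?exprn_ge0.
apply: sumr_ge0 => k _; rewrite mulr_ge0 ?exprn_ge0//.
by rewrite !mulr_ge0 ?addr_ge0 ?diff_cst_ge0.
Qed.

Lemma forgetS j n : forget j n <= forget j.+1 n.
Proof.
have k0 := kap_ge0 eps01.
rewrite /= lerDl mulr_ge0// addr_ge0//; first by rewrite mulr_ge0 ?exprn_ge0.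
apply: sumr_ge0 => k _; rewrite mulr_ge0 ?exprn_ge0//.
by rewrite !mulr_ge0 ?addr_ge0 ?diff_cst_ge0 ?forget_ge0.
Qed.

Lemma forget_le i j n : (i <= j)%N -> forget i n <= forget j n.
Proof.
move=> /subnK <-; elim: (j - i)%N => // k ih.
by rewrite addSn; exact: le_trans ih (forgetS _ _).
Qed.

(** By induction on the order: the difference of the components of a given
    order follows the tangent maps of the first filter, up to terms that are
    bounded by differences of lower order. *)
Lemma jet_forgets o F F' M k a : 1 <= M -> (forall k, 0 <= psi (o k) <= M) ->
  jet_path o F -> jet_path o F' ->
  jet_le (W := W) M 1 p (F 0%N) -> jet_le M 1 p (F' 0%N) ->
  tv (F k a - F' k a) <= forget (mabs a) k * M ^+ mabs a.
Proof.
move=> M1 oM oF oF' F0 F'0; have M0 : 0 <= M by exact: le_trans M1.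
have oF0 := jet_path_filter oF; have oF'0 := jet_path_filter oF'.
have mF n : is_prob (F n m0) by exact: (filter_pathP eps01 n oF0).
have mF' n : is_prob (F' n m0) by exact: (filter_pathP eps01 n oF'0).
have F1 n : tv (F n m0) <= 1 by have [pn mn] := mF n; rewrite (pos_tv pn) mn.
have F'1 n : tv (F' n m0) <= 1 by have [pn mn] := mF' n; rewrite (pos_tv pn) mn.
pose A := growth p eps p.
have A1 : 1 <= A by exact: growth_ge1.
have FA n : jet_le M A p (F n).
  move=> b bp; apply: le_trans (jet_growth eps01 n b M1 oM oF F0) _.
  by rewrite ler_wpM2r ?exprn_ge0// growth_le.
have FA' n : jet_le M A p (F' n).
  move=> b bp; apply: le_trans (jet_growth eps01 n b M1 oM oF' F'0) _.
  by rewrite ler_wpM2r ?exprn_ge0// growth_le.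
have [j aj] := ubnP (mabs a); elim: j a aj k => // j ih a aj k.
have [a0|a0] := eqVneq a m0.
  by rewrite a0 mabs0 expr0 mulr1; exact: (filter_forgets eps01 k oF0 oF'0).
have [i ai] : exists i, mabs a = i.+1.
  by exists (mabs a).-1; rewrite prednK// lt0n mabs_eq0.
have lei n E : forget i n <= E -> jet_le M E i (fun b => F n b - F' n b).
  move=> nE b bi; apply: le_trans (ih _ _ n) _.
    by rewrite (leq_ltn_trans bi)// -ai -ltnS.
  by rewrite ler_wpM2r ?exprn_ge0// (le_trans _ nE)// forget_le.
pose h n := 11 * diff_cst A * (forget i n + forget i n.+1) * M ^+ mabs a.
have step n : (n < k)%N -> tv ((F n.+1 a - F' n.+1 a) -
    tangent (o n) (F n m0) (F n.+1 m0) (F n a - F' n a)) <= h n.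
  move=> _; pose E := forget i n + forget i n.+1.
  have E0 : 0 <= E by rewrite addr_ge0 ?forget_ge0.
  have E1 : jet_le M E i (fun b => F n b - F' n b).
    by apply: lei; rewrite lerDl forget_ge0.
  have E2 : jet_le M E i (fun b => F n.+1 b - F' n.+1 b).
    by apply: lei; rewrite lerDr forget_ge0.
  have h1 := tv_jet_rest_diff M1 (oM n) (mF n) (mF' n) A1 E0 (FA' n) E1
     (FA n.+1) (F1 n.+1) E2 ai.
  have h2 := tv_tangent_diff M1 (oM n) (mF n) (mF' n) A1 E0 E1
     (F1 n.+1) E2 (FA' n a (mabs_le_p a)).
  have -> : F n.+1 a - F' n.+1 a - tangent (o n) (F n m0) (F n.+1 m0) (F n a - F' n a) =
      (jet_rest (o n) (F n) (F n.+1) a - jet_rest (o n) (F' n) (F' n.+1) a) +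
      (tangent (o n) (F n m0) (F n.+1 m0) (F' n a) -
       tangent (o n) (F' n m0) (F' n.+1 m0) (F' n a)).
    have [_ _ /(_ n) hn] := oF; have [_ _ /(_ n) hn'] := oF'.
    rewrite (jet_stepE hn a0) (jet_stepE hn' a0).
    rewrite tangentB; set t := tangent _ _ _ _; set t' := tangent _ _ _ _.
    set t'' := tangent _ _ _ _; set r := jet_rest _ _ _ _; set r' := jet_rest _ _ _ _.
    rewrite addrAC [t + r]addrC -[r + t - _]addrA subKr.
    by rewrite [t' + r']addrC opprD addrACA.
  apply: le_trans (tvD _ _) _; apply: le_trans (lerD h1 h2) _.
  by rewrite /h -!mulrDl le_eqVlt; apply/orP; left; apply/eqP; rewrite -/E; ring.
apply: le_trans (perturbed_tangent eps01 (w := fun n => F n a - F' n a) oF0 step) _.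
rewrite ai [forget _ _]/= mulrDl ler_wpDl ?mulr_ge0 ?forget_ge0 ?exprn_ge0//.
rewrite -[leRHS]mulrA ler_wpM2l// mulrDl lerD//.
  rewrite [leRHS]mulrAC [leRHS]mulrC ler_wpM2l ?exprn_ge0 ?kap_ge0//.
  apply: le_trans (tvB _ _) _; rewrite mulrDl !mul1r -ai lerD//.
    by rewrite -[leRHS]mul1r; apply: F0; exact: mabs_le_p.
  by rewrite -[leRHS]mul1r; apply: F'0; exact: mabs_le_p.
by rewrite mulr_suml; apply: ler_sum => l _; rewrite /h ai mulrA.
Qed.

End forgetting.

(** Each of the [n.+1] terms is at least [t ^+ n] in the geometric series, so
    that half of the decay absorbs a linear factor. *)
Lemma expr_sqr_bound (R : realType) (t : R) n : 0 <= t < 1 ->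
  n.+1%:R * t ^+ n.*2 <= (1 - t)^-1 * t ^+ n.
Proof.
move=> /andP[t0 t1]; rewrite -addnn exprD mulrA ler_wpM2r ?exprn_ge0//.
have h : n.+1%:R * t ^+ n <= \sum_(i < n.+1) t ^+ i.
  rewrite -[X in X%:R * _]card_ord -sum1_card natr_sum mulr_suml.
  by apply: ler_sum => i _; rewrite mul1r ler_wiXn2l ?(ltW t1)// -ltnS.
apply: le_trans h _; rewrite -[leRHS]mul1r ler_pdivlMr ?subr_gt0//.
by rewrite -opprB mulrN mulrC -subrX1 opprB lerBlDr lerDl exprn_ge0.
Qed.

(** With [expr_sqr_bound] this trades part of a geometric rate for a linear
    factor. *)
Lemma sqrt_ratio (R : realType) (t : R) : 0 < t < 1 ->
  exists2 t', 0 < t' < 1 & t <= t' ^+ 2.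
Proof.
move=> /andP[t0 t1]; exists ((1 + t) / 2); first by apply/andP; split; lra.
by rewrite -subr_ge0 (_ : _ - t = ((1 - t) / 2) ^+ 2) ?sqr_ge0//; field.
Qed.

(** Convolving two geometric sequences produces a linear factor, so that the
    ratio has to be increased with every order. *)
Lemma forget_decay (R : realType) (p : nat) (eps : R) j : 0 < eps < 1 ->
  exists C t, [/\ 1 <= C, 0 < t < 1 & forall n, forget p eps j n <= C * t ^+ n].
Proof.
move=> eps01; have k0 := kap_ge0 eps01; have k1 := kap_lt1 eps01.
have kt : 0 < kap eps.
  by rewrite /kap subr_gt0 expr_lt1//; case/andP: eps01 => // /ltW.
have C1 := C0_ge1 eps01; have C00 : 0 <= C0 eps by exact: le_trans C1.
have m1 : 1 <= eps^-1 ^+ 2.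
  by case/andP: eps01 => ? ?; rewrite exprn_ege1// invf_ge1// ltW.
elim: j => [|j [C [t [C1' /andP[t0 t1] h]]]].
  exists (eps^-1 ^+ 2 * C0 eps), (kap eps); rewrite mulr_ege1//; split => //.
    by rewrite kt k1.
  by move=> n /=; rewrite mulrA.
pose m := Num.max t (kap eps).
have m01 : 0 < m < 1 by rewrite lt_max t0 /= gt_max t1 k1.
have [m0 _] := andP m01.
have [t' t'01 mt'] := sqrt_ratio m01.
have [t'0 t'1] := andP t'01.
have [D D0 DE] : exists2 D, 0 <= D & 11 * diff_cst p eps (growth p eps p) = D.
  eexists; last by [].
  by rewrite mulr_ge0// diff_cst_ge0// (le_trans _ (growth_ge1 _ eps01 _)).
pose C' := C + C0 eps * (2 + D * (2 * C) * ((1 - t')^-1 * m^-1)).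
have V0 : 0 <= (1 - t')^-1 by rewrite invr_ge0 subr_ge0 ltW.
have mV0 : 0 <= m^-1 by rewrite invr_ge0 ltW.
have C'0 : 0 <= C by exact: le_trans C1'.
exists C', t'; split => //.
  by rewrite /C' ler_wpDr// mulr_ge0// addr_ge0// !mulr_ge0.
move=> n.
have mn k : m ^+ k <= t' ^+ k.*2.
  by rewrite -mul2n exprM lerXn2r ?nnegrE ?exprn_ge0// ltW.
have mn' k : m ^+ k <= t' ^+ k.
  apply: le_trans (mn k) _.
  by rewrite ler_wiXn2l ?(ltW t'0) ?(ltW t'1)// -addnn leq_addr.
have tm k : t ^+ k <= m ^+ k.
  by rewrite lerXn2r ?nnegrE ?(ltW m0) ?(ltW t0)// le_max lexx.
have km k : kap eps ^+ k <= m ^+ k.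
  by rewrite lerXn2r ?nnegrE ?(ltW m0)// le_max lexx orbT.
rewrite /= /C' [leRHS]mulrDl lerD//.
  apply: le_trans (h n) _; rewrite ler_wpM2l//; exact: le_trans (tm n) (mn' n).
rewrite -[leRHS]mulrA ler_wpM2l// [leRHS]mulrDl lerD//.
  by rewrite ler_wpM2l// (le_trans (km n)).
apply: (@le_trans _ _ (\sum_(k < n) D * (2 * C) * m^-1 * m ^+ n)).
  apply: ler_sum => k _.
  have h1 : forget p eps j k + forget p eps j k.+1 <= 2 * C * m ^+ k.
    rewrite (_ : 2 * C * _ = C * m ^+ k + C * m ^+ k); last by ring.
    apply: lerD; apply: le_trans (h _) _; rewrite ler_wpM2l//.
    rewrite (le_trans (tm _))// exprS ler_piMl ?exprn_ge0 ?(ltW m0)//.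
    by case/andP: m01 => _ /ltW.
  rewrite DE.
  have -> : D * (2 * C) * m^-1 * m ^+ n = m ^+ (n - k.+1) * (D * (2 * C * m ^+ k)).
    have -> : m ^+ n = m * (m ^+ (n - k.+1) * m ^+ k).
      by rewrite -exprD -exprS -addnS subnK.
    by field; rewrite gt_eqF.
  rewrite ler_pM ?exprn_ge0//; last by rewrite ler_wpM2l.
  by rewrite mulr_ge0// addr_ge0 ?forget_ge0.
rewrite sumr_const card_ord -mulr_natl.
have := expr_sqr_bound n (t := t'); rewrite (ltW t'0) t'1 => /(_ isT) hn.
rewrite [leRHS](_ : _ = D * (2 * C) * m^-1 * ((1 - t')^-1 * t' ^+ n)); last by ring.
rewrite [leLHS](_ : _ = D * (2 * C) * m^-1 * (n%:R * m ^+ n)); last by ring.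
rewrite ler_wpM2l ?mulr_ge0//.
apply: le_trans hn; rewrite ler_pM ?exprn_ge0 ?(ltW m0)//.
by rewrite ler_nat.
Qed.

(** * Integration of bounded functions against signed measures *)

Section bounded_functions.
Context d (T : measurableType d) (R : realType).
Implicit Types (h g : T -> R) (m : {finite_measure set T -> \bar R}).

Definition bmeas h := measurable_fun setT h /\ exists C, forall x, `|h x| <= C.

Lemma bmeas_integrable m h : bmeas h -> m.-integrable setT (EFin \o h).
Proof.
move=> [mh [C hC]]; apply: measurable_bounded_integrable => //.
- exact: fin_num_fun_lty.
- exists C; split; first exact: num_real.
  by move=> x Cx y _; exact: le_trans (hC y) (ltW Cx).
Qed.

(** Applied to the two Jordan decompositions of the same signed measure. *)
Lemma Rintegral_measure_addC (m1 m2 m3 m4 : {finite_measure set T -> \bar R}) h :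
  bmeas h ->
  (forall B, measurable B -> (m1 B + m2 B = m3 B + m4 B)%E) ->
  \int[m1]_x h x + \int[m2]_x h x = \int[m3]_x h x + \int[m4]_x h x.
Proof.
move=> bh mm; have mh := measurable_int _ (bmeas_integrable m1 bh).
have sum_int (n1 n2 : {finite_measure set T -> \bar R}) :
    \int[n1]_x h x + \int[n2]_x h x =
    fine (\int[measure_add n1 n2]_x (h x)%:E)%E.
  rewrite integral_measure_add//; [|exact: bmeas_integrable|exact: bmeas_integrable].
  by rewrite fineD//; apply: integrable_fin_num => //; exact: bmeas_integrable.
rewrite !sum_int; congr fine; apply: eq_measure_integral => B mB _.
by rewrite /measure_add /= /msum !big_ord_recl !big_ord0 /= !adde0 mm.
Qed.

End bounded_functions.

Section density.
Context d (T : measurableType d) (R : realType).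
Variable mu : {finite_measure set T -> \bar R}.
Variable g : T -> R.
Definition mdensity of (forall x, 0 <= g x) & mu.-integrable setT (EFin \o g) :
  set T -> \bar R := fun B => (\int[mu]_(x in B) (g x)%:E)%E.

Hypothesis g_ge0 : forall x, 0 <= g x.
Hypothesis ig : mu.-integrable setT (EFin \o g).
Local Notation mg := (mdensity g_ge0 ig).

Let mdensity0 : mg set0 = 0%E.
Proof. by rewrite /mdensity integral_set0. Qed.

Let mdensity_ge0 B : (0 <= mg B)%E.
Proof. by apply: integral_ge0 => x _; rewrite lee_fin. Qed.

Let mdensity_sigma_additive : semi_sigma_additive mg.
Proof.
by apply: semi_sigma_additive_nng_induced => [|x]; [exact: measurable_int ig|rewrite lee_fin].
Qed.

HB.instance Definition _ := isMeasure.Build _ _ _ mg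
  mdensity0 mdensity_ge0 mdensity_sigma_additive.

Let mdensity_fin : fin_num_fun mg.
Proof.
move=> B mB; apply: integrable_fin_num => //.
exact: integrableS ig.
Qed.

HB.instance Definition _ := @Measure_isFinite.Build _ _ _ mg mdensity_fin.

Lemma integral_mdensity (f : T -> \bar R) : mg.-integrable setT f ->
  (\int[mg]_x f x = \int[mu]_x (f x * (g x)%:E))%E.
Proof.
move=> fi; have dom : mg `<< mu.
  apply/null_content_dominatesP => B mB B0.
  rewrite /mdensity null_set_integral//.
  by apply: (measurable_funS measurableT) => //; exact: measurable_int ig.
have dom' : charge_of_finite_measure mg `<< mu by [].
rewrite -(Radon_Nikodym_change_of_variables dom)//.
apply: ae_eq_integral => //.
- apply: emeasurable_funM; first exact: measurable_int fi.
  by apply: measurable_int (Radon_Nikodym_integrable _).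
- by apply: emeasurable_funM; [exact: measurable_int fi|exact: measurable_int ig].
- apply: ae_eqe_mul2l; apply: integral_ae_eq => //.
  + exact: Radon_Nikodym_integrable.
  + exact: measurable_int ig.
  + by move=> B _ mB; rewrite -Radon_Nikodym_integral.
Qed.

End density.

Lemma subeK_fin (R : realDomainType) (x y : \bar R) :
  x \is a fin_num -> y \is a fin_num -> y = (x - (x - y))%E.
Proof.
by case: x y => [x||] [y||]// _ _; rewrite -!EFinB; congr EFin; rewrite subKr.
Qed.

Section charges.
Context d (T : measurableType d) (R : realType).
Implicit Types (nu : {charge set T -> \bar R}).

Definition cpos nu : {finite_measure set T -> \bar R} :=
  jordan_pos (hahn_pairP nu).
Definition cneg nu : {finite_measure set T -> \bar R} :=
  jordan_neg (hahn_pairP nu).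

Lemma cintegralE nu h : cintegral nu h = \int[cpos nu]_x h x - \int[cneg nu]_x h x.
Proof. by []. Qed.

Lemma charge_decomp nu B : measurable B -> nu B = (cpos nu B - cneg nu B)%E.
Proof.
by move=> mB; rewrite (jordan_decomp (hahn_pairP nu) mB) /cadd/= cscaleN1.
Qed.

Lemma tvnormE nu : tvnorm nu = fine (cpos nu setT) + fine (cneg nu setT).
Proof. by rewrite /tvnorm /charge_variation fineD// fin_num_measure. Qed.

Lemma tvnorm_ge0 nu : 0 <= tvnorm nu.
Proof. by rewrite tvnormE addr_ge0 ?fine_ge0. Qed.

Lemma charge_le_tvnorm nu B : measurable B -> (`|nu B| <= (tvnorm nu)%:E)%E.
Proof.
move=> mB; rewrite (charge_decomp nu mB) tvnormE EFinD !fineK ?fin_num_measure//.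
rewrite (le_trans (lee_abs_sub _ _))// !gee0_abs// leeD// le_measure// ?inE//.
Qed.

(** The positive and negative parts are the values of the charge on the two
    sets of a Hahn decomposition. *)
Lemma cpos_le nu nu' B : measurable B ->
  (cpos nu' B <= cpos nu B + (tvnorm (csub nu nu'))%:E)%E.
Proof.
move=> mB; pose P := (projT1 (cid (hahn_pair_ex nu'))).1.
have mP : measurable P by have [[]] := hahn_pairP nu'.
have mBP : measurable (B `&` P) by exact: measurableI.
have -> : cpos nu' B = nu' (B `&` P).
  by rewrite /cpos/= jordan_posE cjordan_posE /crestr0 mem_set.
have -> : nu' (B `&` P) = (nu (B `&` P) - csub nu nu' (B `&` P))%E.
  by apply: subeK_fin; exact: fin_num_measure.
apply: leeD; last first.
  by apply: le_trans (charge_le_tvnorm _ mBP); rewrite -abseN; exact: lee_abs.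
rewrite (charge_decomp nu mBP).
apply: (@le_trans _ _ (cpos nu (B `&` P))); last by rewrite le_measure ?inE.
by rewrite leeBlDr ?fin_num_measure// leeDl.
Qed.

Lemma cneg_le nu nu' B : measurable B ->
  (cneg nu' B <= cneg nu B + (tvnorm (csub nu nu'))%:E)%E.
Proof.
move=> mB; pose N := (projT1 (cid (hahn_pair_ex nu'))).2.
have mN : measurable N by have [_ []] := hahn_pairP nu'.
have mBN : measurable (B `&` N) by exact: measurableI.
have -> : cneg nu' B = (- nu' (B `&` N))%E.
  by rewrite /cneg/= jordan_negE cjordan_negE /crestr0 mem_set.
have -> : (- nu' (B `&` N) = - nu (B `&` N) + csub nu nu' (B `&` N))%E.
  by rewrite /csub /cadd /copp /= addeA [(- _ + _)%E]addeC subee ?add0e// fin_num_measure.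
apply: leeD; last by apply: le_trans (charge_le_tvnorm _ mBN); exact: lee_abs.
rewrite (charge_decomp nu mBN).
apply: (@le_trans _ _ (cneg nu (B `&` N))); last by rewrite le_measure ?inE.
by rewrite fin_num_oppeB ?fin_num_measure// addeC leeBlDr ?fin_num_measure// leeDl.
Qed.

Lemma csubE nu nu' B : csub nu nu' B = (nu B - nu' B)%E.
Proof. by []. Qed.

Lemma norm_cintegral_le nu h : bmeas h ->
  `|cintegral nu h| <= \int[cpos nu]_x `|h x| + \int[cneg nu]_x `|h x|.
Proof.
move=> bh; rewrite cintegralE (le_trans (ler_normB _ _))// lerD//;
  by apply: le_normr_Rintegral => //; exact: bmeas_integrable.
Qed.

(** Both sides are integrals against signed measures that agree on all the
    measurable sets. *)
Lemma cintegral_density nu (mu : {finite_measure set T -> \bar R}) (g : T -> R) h :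
  mu.-integrable setT (EFin \o g) ->
  (forall B, measurable B -> nu B = \int[mu]_(x in B) (g x)%:E)%E ->
  bmeas h -> cintegral nu h = \int[mu]_x (h x * g x).
Proof.
move=> ig nug bh.
have ip : mu.-integrable setT (EFin \o g^\+) by apply: integrable_funrpos.
have iN : mu.-integrable setT (EFin \o g^\-) by apply: integrable_funrneg.
have int_dens f (f0 : forall x, 0 <= f x) (fi : mu.-integrable setT (EFin \o f)) :
    \int[mdensity f0 fi]_x h x = \int[mu]_x (h x * f x).
  by rewrite /Rintegral integral_mdensity//; exact: bmeas_integrable.
have hi f : mu.-integrable setT (EFin \o f) ->
    mu.-integrable setT (EFin \o (fun x => h x * f x)).
  move=> fi; have [mh [C hC]] := bh.
  apply: eq_integrable (integrableMr _ mh _ fi) => //.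
  exists C; split; first exact: num_real.
  by move=> x Cx y _; exact: le_trans (hC y) (ltW Cx).
have dec B : measurable B -> (cpos nu B + mdensity (funrneg_ge0 g) iN B =
    cneg nu B + mdensity (funrpos_ge0 g) ip B)%E.
  move=> mB; have := charge_decomp nu mB; rewrite nug// integralE.
  rewrite -[fun x => (g x)%:E]/(EFin \o g) funerpos funerneg /mdensity /=.
  have fp : (\int[mu]_(x in B) (g^\+ x)%:E)%E \is a fin_num.
    by apply: integrable_fin_num => //; exact: integrableS ip.
  have fn : (\int[mu]_(x in B) (g^\- x)%:E)%E \is a fin_num.
    by apply: integrable_fin_num => //; exact: integrableS iN.
  have f1 : cpos nu B \is a fin_num by exact: fin_num_measure.
  have f2 : cneg nu B \is a fin_num by exact: fin_num_measure.
  move: fp fn f1 f2 => /fineK <- /fineK <- /fineK <- /fineK <-.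
  by rewrite -!EFinN -!EFinD => -[?]; congr EFin; lra.
have := Rintegral_measure_addC bh dec; rewrite !int_dens cintegralE => e.
have -> : \int[mu]_x (h x * g x) = \int[mu]_x (h x * g^\+ x - h x * g^\- x).
  by apply: eq_Rintegral => x _; rewrite -mulrBr -{1}(funrposBneg g).
by rewrite RintegralB//; [lra|exact: hi|exact: hi].
Qed.

(** The total variation is attained on the sets where [g] has a constant sign,
    and on the sets of a Hahn decomposition. *)
Lemma tvnorm_density nu (mu : {finite_measure set T -> \bar R}) (g : T -> R) :
  mu.-integrable setT (EFin \o g) ->
  (forall B, measurable B -> nu B = \int[mu]_(x in B) (g x)%:E)%E ->
  tvnorm nu = \int[mu]_x `|g x|.
Proof.
move=> ig nug.
have mg : measurable_fun setT g by apply/measurable_EFinP; exact: measurable_int ig.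
have ian : mu.-integrable setT (EFin \o (fun x => `|g x|)) by exact: integrable_norm.
apply/eqP; rewrite eq_le; apply/andP; split; last first.
  pose h x := if 0 <= g x then 1 else -1 : R.
  have bh : bmeas h.
    split; last by exists 1 => x; rewrite /h; case: ifP; rewrite ?normrN1 ?normr1.
    by apply: measurable_fun_ifT => //; exact: measurable_fun_ler.
  have -> : \int[mu]_x `|g x| = cintegral nu h.
    rewrite (cintegral_density ig)//; apply: eq_Rintegral => x _; rewrite /h.
    by case: lerP => gx; rewrite ?mul1r ?mulN1r ?(ger0_norm gx) ?(ltr0_norm gx).
  apply: le_trans (ler_norm _) _; apply: le_trans (norm_cintegral_le _ bh) _.
  have h1 x : `|h x| = 1 by rewrite /h; case: ifP; rewrite ?normrN1 ?normr1.
  under eq_Rintegral do rewrite h1; under [X in _ + X]eq_Rintegral do rewrite h1.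
  by rewrite !Rintegral_cst// !mul1r tvnormE.
pose P := (projT1 (cid (hahn_pair_ex nu))).1.
pose N := (projT1 (cid (hahn_pair_ex nu))).2.
have mP : measurable P by have [[]] := hahn_pairP nu.
have mN : measurable N by have [_ []] := hahn_pairP nu.
have PNT : P `|` N = setT by have [_ _] := hahn_pairP nu.
have PN0 : P `&` N = set0 by have [_ _ _] := hahn_pairP nu.
have cP : cpos nu setT = nu P.
  by rewrite /cpos/= jordan_posE cjordan_posE /crestr0 mem_set// /crestr setTI.
have cN : cneg nu setT = (- nu N)%E.
  by rewrite /cneg/= jordan_negE cjordan_negE /crestr0 mem_set// /crestr setTI.
have iS B h : measurable B -> mu.-integrable setT (EFin \o h) ->
    mu.-integrable B (EFin \o h) by move=> mB; exact: integrableS.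
rewrite tvnormE cP cN fineN !nug// -/(Rintegral mu P g) -/(Rintegral mu N g).
rewrite -[in leRHS]PNT Rintegral_setU//; last 2 first.
  by rewrite PNT.
  by rewrite /disj_set PN0.
rewrite lerD//.
  by rewrite (le_trans (ler_norm _))// le_normr_Rintegral//; exact: iS.
by rewrite (le_trans (ler_norm _))// normrN le_normr_Rintegral//; exact: iS.
Qed.

Lemma tvnorm_csub_density nu nu' (mu : {finite_measure set T -> \bar R})
    (g g' : T -> R) :
  mu.-integrable setT (EFin \o g) -> mu.-integrable setT (EFin \o g') ->
  (forall B, measurable B -> nu B = \int[mu]_(x in B) (g x)%:E)%E ->
  (forall B, measurable B -> nu' B = \int[mu]_(x in B) (g' x)%:E)%E ->
  tvnorm (csub nu nu') = \int[mu]_x `|g x - g' x|.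
Proof.
move=> ig ig' nug nug'; apply: (tvnorm_density (g := fun x => g x - g' x)).
  rewrite [X in mu.-integrable _ X](_ : _ = (EFin \o g) \- (EFin \o g'))%E.
    exact: integrableB.
  by apply/funext => x /=; rewrite EFinB.
move=> B mB; rewrite csubE nug// nug'//.
under [RHS]eq_integral do rewrite EFinB.
by rewrite integralB_EFin//; [exact: integrableS ig|exact: integrableS ig'].
Qed.

Lemma cneg_ge0 nu : (forall B, measurable B -> (0 <= nu B)%E) ->
  forall B, measurable B -> cneg nu B = 0%E.
Proof.
move=> nu0 B mB; pose N := (projT1 (cid (hahn_pair_ex nu))).2.
have mN : measurable N by have [_ []] := hahn_pairP nu.
have -> : cneg nu B = (- nu (B `&` N))%E.
  by rewrite /cneg/= jordan_negE cjordan_negE /crestr0 mem_set.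
apply/eqP; rewrite oppe_eq0 eq_le nu0 ?andbT; last exact: measurableI.
have [_ [_ h] _ _] := hahn_pairP nu; apply: h; first exact: measurableI.
exact: subIsetr.
Qed.

Lemma cintegral_ge0 nu h : (forall B, measurable B -> (0 <= nu B)%E) ->
  cintegral nu h = \int[cpos nu]_x h x.
Proof.
move=> nu0; rewrite cintegralE -[RHS]subr0; congr (_ - _).
rewrite /Rintegral (eq_measure_integral mzero) ?integral_measure_zero//.
by move=> B mB _; exact: cneg_ge0.
Qed.

End charges.

(** * Integrable densities and integral operators *)

Section L1_facts.
Context d (T : measurableType d) (R : realType).
Variable mu : {finite_measure set T -> \bar R}.
Implicit Types (f g : T -> R).

Definition L1 f := mu.-integrable setT (EFin \o f).

Lemma L1_meas f : L1 f -> measurable_fun setT f.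
Proof. by move=> h; apply/measurable_EFinP; exact: measurable_int h. Qed.

Lemma L1D f g : L1 f -> L1 g -> L1 (fun x => f x + g x).
Proof. by move=> hf hg; apply: eq_integrable (integrableD measurableT hf hg). Qed.

Lemma L1Z c f : L1 f -> L1 (fun x => c * f x).
Proof. by move=> hf; apply: eq_integrable (integrableZl measurableT c hf). Qed.

Lemma L1B f g : L1 f -> L1 g -> L1 (fun x => f x - g x).
Proof. by move=> hf hg; apply: eq_integrable (integrableB measurableT hf hg). Qed.

Lemma L1_sum (I : Type) (s : seq I) (P : pred I) (F : I -> T -> R) :
  (forall i, P i -> L1 (F i)) -> L1 (fun x => \sum_(i <- s | P i) F i x).
Proof.
move=> h; apply: eq_integrable (integrable_sum measurableT s h) => // x _.
by rewrite /= sumEFin.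
Qed.

Lemma L1_norm f : L1 f -> L1 (fun x => `|f x|).
Proof. exact: integrable_norm. Qed.

Lemma L1_pos f : L1 f -> L1 f^\+.
Proof. exact: integrable_funrpos. Qed.

Lemma L1_neg f : L1 f -> L1 f^\-.
Proof. exact: integrable_funrneg. Qed.

Lemma L1S B f : measurable B -> L1 f -> mu.-integrable B (EFin \o f).
Proof. by move=> mB; exact: integrableS. Qed.

Lemma L1_bM h f : bmeas h -> L1 f -> L1 (fun x => h x * f x).
Proof.
move=> [mh [C hC]] hf; apply: eq_integrable (integrableMr _ mh _ hf) => //.
exists C; split; first exact: num_real.
by move=> x Cx y _; exact: le_trans (hC y) (ltW Cx).
Qed.

Lemma ge0_Rintegral_le f : (forall x, 0 <= f x) -> L1 f ->
  (\int[mu]_x (f x)%:E = (\int[mu]_x f x)%:E)%E.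
Proof.
by move=> f0 hf; rewrite fineK//; apply: integrable_fin_num.
Qed.

Lemma Rintegral_sum (I : Type) (s : seq I) (P : pred I) (F : I -> T -> R) :
  (forall i, P i -> L1 (F i)) ->
  \int[mu]_x (\sum_(i <- s | P i) F i x) = \sum_(i <- s | P i) \int[mu]_x F i x.
Proof.
move=> h; elim: s => [|i s ih].
  under eq_Rintegral do rewrite big_nil.
  by rewrite big_nil Rintegral_cst// mul0r.
rewrite big_cons; case: (boolP (P i)) => Pi; last first.
  by under eq_Rintegral do rewrite big_cons (negbTE Pi); exact: ih.
under eq_Rintegral do rewrite big_cons Pi.
by rewrite RintegralD// ?ih//; [exact: h|exact: L1_sum].
Qed.

(** Positivity up to null sets, in the form in which integration preserves it. *)
Definition posdens f := forall B, measurable B -> 0 <= \int[mu]_(x in B) f x.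

Lemma posdens_charge f (hf : L1 f) : posdens f ->
  forall B, measurable B -> (0 <= induced_charge hf B)%E.
Proof.
move=> pf B mB; have := pf B mB; rewrite /Rintegral /induced_charge => h.
rewrite -[X in (0 <= X)%E]fineK ?lee_fin//.
by apply: integrable_fin_num => //; exact: L1S.
Qed.

Lemma posdens_Rintegral f h : L1 f -> posdens f -> bmeas h ->
  (forall x, 0 <= h x) -> 0 <= \int[mu]_x (h x * f x).
Proof.
move=> hf pf bh h0.
rewrite -(@cintegral_density _ _ _ (induced_charge hf) mu f)//.
by rewrite cintegral_ge0; [exact: Rintegral_ge0|exact: posdens_charge].
Qed.

Lemma posdens_norm f : L1 f -> posdens f -> \int[mu]_x `|f x| = \int[mu]_x f x.
Proof.
move=> hf pf; have p0 := posdens_charge hf pf.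
rewrite -(@tvnorm_density _ _ _ (induced_charge hf) mu f)// tvnormE.
have := charge_decomp (induced_charge hf) measurableT.
by rewrite (cneg_ge0 p0)// sube0 => <-; rewrite addr0.
Qed.

Lemma posdens_ge0 f : (forall x, 0 <= f x) -> posdens f.
Proof. by move=> f0 B mB; exact: Rintegral_ge0. Qed.

End L1_facts.

Section integral_operator.
Context d (T : measurableType d) (R : realType).
Variables mu nu : {finite_measure set T -> \bar R}.
Variables (k : T -> T -> R) (b : T -> R) (K : R).
Hypothesis mk : measurable_fun setT (fun z : T * T => k z.1 z.2).
Hypothesis kb : forall x x', `|k x x'| <= b x.
Hypothesis kK : forall x', (\int[mu]_x `|k x x'|%:E <= K%:E)%E.
Implicit Types (w : T -> R).

Definition kop w x := \int[nu]_x' (k x x' * w x').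

Lemma mk1 x' : measurable_fun setT (k^~ x').
Proof. exact: measurableT_comp mk (measurable_pair2 x'). Qed.

Lemma mk2 x : measurable_fun setT (k x).
Proof. exact: measurableT_comp mk (measurable_pair1 x). Qed.

Lemma bmeas_k x : bmeas (k x).
Proof. by split; [exact: mk2|exists (b x)]. Qed.

Lemma L1_k x' : L1 mu (k^~ x').
Proof.
apply/integrableP; split; first by apply/measurable_EFinP; exact: mk1.
exact: le_lt_trans (kK x') (ltry _).
Qed.

Lemma L1_kw w x : L1 nu w -> L1 nu (fun x' => k x x' * w x').
Proof. by move=> hw; apply: L1_bM => //; exact: bmeas_k. Qed.

Let f w (z : T * T) : \bar R := (k z.1 z.2 * w z.2)%:E.

Let mf w : L1 nu w -> measurable_fun setT (f w).
Proof.
move=> hw; apply/measurable_EFinP; apply: measurable_funM => //.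
by apply: measurableT_comp => //; exact: L1_meas hw.
Qed.

Let K_ge0 : 0 <= K.
Proof.
have := kK point; rewrite -lee_fin; apply: le_trans.
by apply: integral_ge0 => x _; rewrite lee_fin.
Qed.

Let fle w : L1 nu w ->
  (\int[nu]_x' \int[mu]_x `|f w (x, x')| <= (K * \int[nu]_x `|w x|)%:E)%E.
Proof.
move=> hw; have hnw := L1_norm hw.
rewrite EFinM -ge0_Rintegral_le// -ge0_integralZl//; last 1 first.
  by apply/measurable_EFinP; exact: L1_meas hnw.
apply: ge0_le_integral => //.
- by move=> x' _; apply: integral_ge0.
- apply: (measurable_fun_fubini_tonelli_G (abse \o f w)) => //=.
  by apply: measurableT_comp => //; exact: mf.
- by apply: measurable_funeM; apply/measurable_EFinP; exact: L1_meas hnw.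
move=> x' _; rewrite /f/=.
under eq_integral do rewrite normrM EFinM.
rewrite ge0_integralZr//; last first.
  by apply/measurable_EFinP; apply: measurableT_comp => //; exact: mk1.
by rewrite lee_wpmul2r ?lee_fin.
Qed.

Let fint w : L1 nu w -> (mu \x nu)%E.-integrable setT (f w).
Proof.
move=> hw; apply/integrable21ltyP; first exact: mf.
exact: le_lt_trans (fle hw) (ltry _).
Qed.

Let kopE w x : L1 nu w -> ((kop w x)%:E = \int[nu]_x' f w (x, x'))%E.
Proof.
move=> hw; rewrite /kop /Rintegral fineK//.
by apply: integrable_fin_num => //; exact: L1_kw.
Qed.

Lemma L1_kop w : L1 nu w -> L1 mu (kop w).
Proof.
move=> hw; apply: eq_integrable (integrable_fubini_F (fint hw)) => //.
by move=> x _; rewrite /= kopE.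
Qed.

Lemma kop_norm w : L1 nu w ->
  \int[mu]_x `|kop w x| <= K * \int[nu]_x `|w x|.
Proof.
move=> hw; have hk := L1_kop hw.
rewrite -lee_fin -ge0_Rintegral_le//; last exact: L1_norm.
have maf : measurable_fun setT (abse \o f w) by apply: measurableT_comp => //; exact: mf.
have af0 z : (0 <= (abse \o f w) z)%E by exact: abse_ge0.
apply: le_trans (fle hw); rewrite -(fubini_tonelli (abse \o f w) maf af0).
apply: ge0_le_integral => //.
- by apply/measurable_EFinP; apply: measurableT_comp => //; exact: L1_meas hk.
- exact: measurable_fun_fubini_tonelli_F.
move=> x _; rewrite -[leLHS]/(`|(kop w x)%:E|)%E kopE//.
apply: le_abse_integral => //; apply/measurable_EFinP.
by apply: L1_meas; exact: (L1_kw x hw).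
Qed.

Lemma bmeas_int_k : bmeas (fun x' => \int[mu]_x k x x').
Proof.
split.
  have h1 : L1 nu (fun=> 1) by exact: finite_measure_integrable_cst.
  have := measurable_fubini_G (fint h1).
  move=> /(measurableT_comp (fine_measurable measurableT)).
  apply: eq_measurable_fun => x' _ /=.
  rewrite /Rintegral /fubini_G /f; congr fine.
  by apply: eq_integral => x _; rewrite /= mulr1.
exists K => x'; apply: le_trans (le_normr_Rintegral measurableT (L1_k x')) _.
by rewrite -lee_fin -ge0_Rintegral_le//; exact/L1_norm/L1_k.
Qed.

Lemma kop_fubini w : L1 nu w ->
  \int[mu]_x kop w x = \int[nu]_x' ((\int[mu]_x k x x') * w x').
Proof.
move=> hw; rewrite /Rintegral; congr fine.
under eq_integral do rewrite -/(Rintegral _ _ _) -/(kop _ _) kopE//.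
rewrite (Fubini (fint hw)); apply: eq_integral => x' _.
rewrite /f /= -[RHS]/(_ * _)%:E -RintegralZr//; last exact: L1_k.
rewrite /Rintegral fineK//; apply: integrable_fin_num => //.
by apply: eq_integrable (L1Z (w x') (L1_k x')) => // x _; rewrite /= mulrC.
Qed.

Lemma kopD u v : L1 nu u -> L1 nu v ->
  kop (fun x => u x + v x) = (fun x => kop u x + kop v x).
Proof.
move=> hu hv; apply/funext => x; rewrite /kop.
under eq_Rintegral do rewrite mulrDr.
by rewrite RintegralD//; exact: L1_kw.
Qed.

Lemma kopZ c u : L1 nu u -> kop (fun x => c * u x) = (fun x => c * kop u x).
Proof.
move=> hu; apply/funext => x; rewrite /kop.
under eq_Rintegral do rewrite mulrCA.
by rewrite RintegralZl//; exact: L1_kw.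
Qed.

End integral_operator.

(** The set version: truncate the kernel in its first argument. *)
Section integral_operator_sets.
Context d (T : measurableType d) (R : realType).
Variables mu nu : {finite_measure set T -> \bar R}.
Variables (k : T -> T -> R) (b : T -> R) (K : R).
Hypothesis mk : measurable_fun setT (fun z : T * T => k z.1 z.2).
Hypothesis kb : forall x x', `|k x x'| <= b x.
Hypothesis kK : forall x', (\int[mu]_x `|k x x'|%:E <= K%:E)%E.
Variables (B : set T) (mB : measurable B).

Let kB x x' := \1_B x * k x x'.

Let mkB : measurable_fun setT (fun z : T * T => kB z.1 z.2).
Proof.
apply: measurable_funM => //.
by apply: measurableT_comp => //; exact: measurable_indic.
Qed.

Let kB_le x x' : `|kB x x'| <= `|k x x'|.
Proof.
rewrite /kB normrM ler_piMl// indicE.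
by case: (_ \in _); rewrite ?normr1 ?normr0.
Qed.

Let kBb x x' : `|kB x x'| <= b x.
Proof. exact: le_trans (kB_le x x') (kb x x'). Qed.

Let kBK x' : (\int[mu]_x `|kB x x'|%:E <= K%:E)%E.
Proof.
apply: le_trans (kK x'); apply: ge0_le_integral => //.
- apply/measurable_EFinP; apply: measurableT_comp => //.
  exact: (@mk1 _ _ _ kB).
- by apply/measurable_EFinP; apply: measurableT_comp => //; exact: mk1.
- by move=> x _; rewrite lee_fin.
Qed.

Let int_kB g : \int[mu]_(x in B) g x = \int[mu]_x (\1_B x * g x).
Proof.
rewrite Rintegral_mkcond; apply: eq_Rintegral => x _.
by rewrite patchE indicE; case: ifP; rewrite ?mul1r ?mul0r.
Qed.

Lemma bmeas_int_k_in : bmeas (fun x' => \int[mu]_(x in B) k x x').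
Proof.
rewrite (_ : (fun _ => _) = (fun x' => \int[mu]_x kB x x')).
  exact: bmeas_int_k mkB kBK.
by apply/funext => x'; rewrite int_kB.
Qed.

Lemma kop_fubini_in w : L1 nu w ->
  \int[mu]_(x in B) kop nu k w x =
  \int[nu]_x' ((\int[mu]_(x in B) k x x') * w x').
Proof.
move=> hw; rewrite int_kB.
transitivity (\int[mu]_x kop nu kB w x).
  apply: eq_Rintegral => x _; rewrite /kop -RintegralZl//; last exact: L1_kw.
  by apply: eq_Rintegral => x' _; rewrite /kB mulrA.
rewrite (kop_fubini mkB kBb kBK hw).
by apply: eq_Rintegral => x' _; rewrite int_kB.
Qed.

End integral_operator_sets.

(** * Integrable densities as a filter system *)

Section L1_space.
Context d (T : measurableType d) (R : realType).
Variable mu : {finite_measure set T -> \bar R}.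

Definition L1space : lmodType R := LfunType mu (lexx 1%E).

Definition L1val (u : L1space) : T -> R := (u : LfunType mu (lexx 1%E)).

Lemma L1valP u : L1 mu (L1val u).
Proof. exact/Lfun1_integrable/LfunP. Qed.

Definition mkL1 f (hf : L1 mu f) : L1space :=
  @Lfun_Sub _ _ _ mu _ (lexx 1%E) f ((Lfun1_integrable mu f).2 hf).

Lemma mkL1K f (hf : L1 mu f) : L1val (mkL1 hf) = f.
Proof. by []. Qed.

Lemma L1val_inj u v : L1val u = L1val v -> u = v.
Proof. by move=> uv; apply: val_inj. Qed.

Lemma L1valD u v : L1val (u + v) = (fun x => L1val u x + L1val v x).
Proof. by []. Qed.

Lemma L1valZ c u : L1val (c *: u) = (fun x => c * L1val u x).
Proof. by []. Qed.

Lemma L1valN u : L1val (- u) = (fun x => - L1val u x).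
Proof. by []. Qed.

End L1_space.

(** The densities of the unnormalised filter and its derivatives, written
    without the parameter; [rr a y x x'] is the derivative of order [a] of the
    density of moving from [x'] to [x] and observing [y]. *)
Record filter_model (R : realType) (d p : nat) dX (X : measurableType dX)
    dY (Y : measurableType dY) (mu : {measure set X -> \bar R}) (eps : R)
    (psi : Y -> R) (phi : Y -> X -> R) (rr : midx d p -> Y -> X -> X -> R) :
    Prop := FilterModel {
  fm_eps : 0 < eps < 1 ;
  fm_meas : forall a, measurable_fun setT
    (fun z : Y * (X * X) => rr a z.1 z.2.1 z.2.2) ;
  fm_ge0 : forall y x x', 0 <= rr (midx0 d p) y x x' ;
  fm_psi : forall y, 1 <= psi y ;
  fm_le : forall a y x x',
    `|rr a y x x'| <= psi y ^+ mabs a * rr (midx0 d p) y x x' ;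
  fm_phi : forall y x x', rr (midx0 d p) y x x' <= phi y x ;
  fm_mix : forall y, exists m : {measure set X -> \bar R},
    (0 < m setT < +oo)%E /\ forall x' B, measurable B ->
      (eps%:E * m B <= \int[mu]_(x in B) (rr (midx0 d p) y x x')%:E
        <= m B * (eps^-1)%:E)%E }.

Section model.
Context (R : realType) (d p : nat) dX (X : measurableType dX)
  dY (Y : measurableType dY) (mu : {finite_measure set X -> \bar R}) (eps : R)
  (psi : Y -> R) (phi : Y -> X -> R) (rr : midx d p -> Y -> X -> X -> R).
Hypothesis fm : filter_model mu eps psi phi rr.

Local Notation m0 := (midx0 d p).
Local Notation eps2 := (eps ^+ 2).

Let eps01 := fm_eps fm.
Let eps_gt0 : 0 < eps. Proof. by case/andP: eps01. Qed.

Lemma eps2_01 : 0 < eps2 < 1.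
Proof.
by case/andP: eps01 => e0 e1; rewrite exprn_gt0//= expr_lt1// ltW.
Qed.

Lemma meas_rr a y : measurable_fun setT (fun z : X * X => rr a y z.1 z.2).
Proof. exact: measurableT_comp (fm_meas fm a) (measurable_pair1 y). Qed.

Lemma meas_rr1 a y x' : measurable_fun setT (rr a y ^~ x').
Proof. exact: mk1 (meas_rr a y) x'. Qed.

Lemma psi_ge0 y : 0 <= psi y.
Proof. exact: le_trans (fm_psi fm y). Qed.

Lemma rr_bound a y x x' : `|rr a y x x'| <= psi y ^+ mabs a * phi y x.
Proof.
apply: le_trans (fm_le fm a y x x') _.
by rewrite ler_wpM2l ?exprn_ge0 ?psi_ge0// (fm_phi fm).
Qed.

Lemma L1_rr0 y x' : L1 mu (rr m0 y ^~ x').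
Proof.
have [m [/andP[m1 m2] mm]] := fm_mix fm y.
apply/integrableP; split; first by apply/measurable_EFinP; exact: meas_rr1.
under eq_integral do rewrite /= ger0_norm ?(fm_ge0 fm)//.
have /andP[_ /le_lt_trans] := mm x' _ measurableT; apply.
by rewrite muleC lte_mul_pinfty// lee_fin invr_ge0 ltW.
Qed.

(** The reference measure of the mixing condition may be taken to be one of
    the densities themselves, at the price of squaring the constant. *)
Definition dom_dens y : X -> R := rr m0 y ^~ point.

Lemma rr_mix y x' B : measurable B ->
  eps2 * \int[mu]_(x in B) dom_dens y x <= \int[mu]_(x in B) rr m0 y x x'
  <= eps2^-1 * \int[mu]_(x in B) dom_dens y x.
Proof.
move=> mB; have [m [/andP[m1 m2] mm]] := fm_mix fm y.
have mBfin : (m B < +oo)%E.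
  by apply: le_lt_trans m2; rewrite le_measure ?inE.
have fin z : (\int[mu]_(x in B) (rr m0 y x z)%:E)%E \is a fin_num.
  by apply: integrable_fin_num => //; apply: L1S => //; exact: L1_rr0.
have bnd z : eps * fine (m B) <= \int[mu]_(x in B) rr m0 y x z <= eps^-1 * fine (m B).
  have := mm z B mB; rewrite -(@fineK _ (m B)) ?ge0_fin_numE//.
  rewrite -(fineK (fin z)) -!EFinM !lee_fin /Rintegral.
  by rewrite [fine _ * eps^-1]mulrC.
rewrite /dom_dens; have /andP[a1 a2] := bnd x'; have /andP[b1 b2] := bnd point.
apply/andP; split.
  apply: le_trans a1; rewrite expr2 -mulrA ler_wpM2l ?(ltW eps_gt0)//.
  by rewrite -ler_pdivlMl.
apply: le_trans a2 _; rewrite -exprVn expr2 -mulrA ler_wpM2l ?invr_ge0 ?(ltW eps_gt0)//.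
by rewrite ler_pdivlMl.
Qed.

Lemma dom_gt0_dens y : 0 < \int[mu]_x dom_dens y x.
Proof.
have [m [/andP[m1 m2] mm]] := fm_mix fm y.
have /andP[h _] := mm point _ measurableT.
rewrite -lte_fin /Rintegral fineK; last first.
  by apply: integrable_fin_num => //; exact: L1_rr0.
by apply: lt_le_trans h; rewrite mule_gt0// lte_fin.
Qed.

Definition rr_cst (a : midx d p) y := psi y ^+ mabs a * (eps2^-1 * \int[mu]_x dom_dens y x).

Lemma rr_L1_le a y x' : (\int[mu]_x `|rr a y x x'|%:E <= (rr_cst a y)%:E)%E.
Proof.
apply: (@le_trans _ _ (\int[mu]_x (psi y ^+ mabs a * rr m0 y x x')%:E)%E).
  apply: ge0_le_integral => //.
  - by apply/measurable_EFinP; apply: measurableT_comp => //; exact: meas_rr1.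
  - by apply/measurable_EFinP; apply: measurable_funM => //; exact: meas_rr1.
  - by move=> x _; rewrite lee_fin; exact: fm_le fm a y x x'.
have h : L1 mu (fun x => psi y ^+ mabs a * rr m0 y x x') by apply: L1Z; exact: L1_rr0.
rewrite ge0_Rintegral_le//; last first.
  by move=> x; rewrite mulr_ge0 ?exprn_ge0 ?psi_ge0 ?(fm_ge0 fm).
rewrite lee_fin RintegralZl//; last exact: L1_rr0.
rewrite ler_wpM2l ?exprn_ge0 ?psi_ge0//.
by have /andP[] := rr_mix y x' measurableT.
Qed.

Local Notation W := (L1space mu).

Definition f_mass (u : W) : R := \int[mu]_x L1val u x.
Definition f_tv (u : W) : R := \int[mu]_x `|L1val u x|.
Definition f_pos (u : W) : Prop := posdens mu (L1val u).

Lemma L1_op a y (u : W) : L1 mu (kop mu (rr a y) (L1val u)).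
Proof. exact: L1_kop (meas_rr a y) (rr_bound a y) (rr_L1_le a y) _ (L1valP u). Qed.

Definition f_prop y (a : midx d p) (u : W) : W := mkL1 (L1_op a y u).
Definition f_dom y : W := mkL1 (L1_rr0 y point).

Lemma f_massD u v : f_mass (u + v) = f_mass u + f_mass v.
Proof. by rewrite /f_mass L1valD RintegralD//; exact: L1valP. Qed.

Lemma f_massZ c u : f_mass (c *: u) = c * f_mass u.
Proof. by rewrite /f_mass L1valZ RintegralZl//; exact: L1valP. Qed.

Lemma f_tvD u v : f_tv (u + v) <= f_tv u + f_tv v.
Proof.
rewrite /f_tv L1valD -RintegralD//; try exact: L1_norm (L1valP _).
apply: le_Rintegral => //.
- by apply: (@L1_norm _ _ _ _ (fun x => L1val u x + L1val v x)); exact: L1D (L1valP _) (L1valP _).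
- by apply: L1D; exact: L1_norm (L1valP _).
- by move=> x _; exact: ler_normD.
Qed.

Lemma f_tvZ c u : f_tv (c *: u) = `|c| * f_tv u.
Proof.
rewrite /f_tv L1valZ -RintegralZl//; last exact: L1_norm (L1valP _).
by apply: eq_Rintegral => x _; rewrite normrM.
Qed.

Lemma f_mass_le_tv u : `|f_mass u| <= f_tv u.
Proof. by apply: le_normr_Rintegral => //; exact: L1valP. Qed.

Lemma f_posD u v : f_pos u -> f_pos v -> f_pos (u + v).
Proof.
move=> pu pv B mB; rewrite L1valD RintegralD//; try exact: L1S (L1valP _).
by rewrite addr_ge0// ?pu ?pv.
Qed.

Lemma f_posZ c u : 0 <= c -> f_pos u -> f_pos (c *: u).
Proof.
move=> c0 pu B mB; rewrite L1valZ RintegralZl//; last exact: L1S (L1valP _).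
by rewrite mulr_ge0// pu.
Qed.

Lemma f_pos_tv u : f_pos u -> f_tv u = f_mass u.
Proof. by move=> pu; apply: posdens_norm => //; exact: L1valP. Qed.

Lemma f_jordan w : exists u v,
  [/\ f_pos u, f_pos v, w = u - v & f_tv w = f_mass u + f_mass v].
Proof.
exists (mkL1 (L1_pos (L1valP w))), (mkL1 (L1_neg (L1valP w))); split.
- exact/posdens_ge0/funrpos_ge0.
- exact/posdens_ge0/funrneg_ge0.
- apply: L1val_inj; rewrite L1valD L1valN !mkL1K.
  by rewrite -[LHS]funrposBneg.
rewrite /f_mass !mkL1K -RintegralD//; [|exact: L1_pos (L1valP w)|exact: L1_neg (L1valP w)].
apply: eq_Rintegral => x _.
by rewrite -[RHS]/((_ \+ _) x) -[LHS]/((Num.norm \o L1val w) x) -funrposDneg.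
Qed.

Lemma f_propD y a u v : f_prop y a (u + v) = f_prop y a u + f_prop y a v.
Proof.
apply: L1val_inj; rewrite L1valD !mkL1K L1valD.
exact: kopD (meas_rr a y) (rr_bound a y) _ _ (L1valP u) (L1valP v).
Qed.

Lemma f_propZ y a c u : f_prop y a (c *: u) = c *: f_prop y a u.
Proof.
apply: L1val_inj; rewrite L1valZ !mkL1K L1valZ.
exact: kopZ (meas_rr a y) (rr_bound a y) _ _ (L1valP u).
Qed.

Lemma f_prop_in y a u B : measurable B ->
  \int[mu]_(x in B) L1val (f_prop y a u) x =
  \int[mu]_x' ((\int[mu]_(x in B) rr a y x x') * L1val u x').
Proof.
move=> mB; rewrite mkL1K.
exact: kop_fubini_in (meas_rr a y) (rr_bound a y) (rr_L1_le a y) _ mB _ (L1valP u).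
Qed.

Lemma bmeas_rr_in y a B : measurable B ->
  bmeas (fun x' => \int[mu]_(x in B) rr a y x x').
Proof. by move=> mB; apply: bmeas_int_k_in (meas_rr a y) (rr_L1_le a y) _ mB. Qed.

Lemma f_prop_pos y u : f_pos u -> f_pos (f_prop y m0 u).
Proof.
move=> pu B mB; rewrite f_prop_in//.
apply: posdens_Rintegral => //; [exact: L1valP|exact: bmeas_rr_in|].
by move=> x'; apply: Rintegral_ge0 => x _; exact: fm_ge0 fm _ _ _.
Qed.

Lemma bmeas_cst (c : R) : bmeas (fun _ : X => c).
Proof. by split => //; exists `|c|. Qed.

Lemma bmeasB (h g : X -> R) : bmeas h -> bmeas g -> bmeas (fun x => h x - g x).
Proof.
move=> [mh [C hC]] [mg [D gD]]; split; first exact: measurable_funB.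
by exists (C + D) => x; rewrite (le_trans (ler_normB _ _))// lerD.
Qed.

Let comparison (c1 c2 : R) y u : f_pos u ->
  (forall x' B, measurable B -> 0 <=
     c1 * (\int[mu]_(x in B) rr m0 y x x') - c2 * \int[mu]_(x in B) dom_dens y x) ->
  f_pos (c1 *: f_prop y m0 u - (c2 * f_mass u) *: f_dom y).
Proof.
move=> pu h B mB.
have iu := L1valP u; have ip := L1valP (f_prop y m0 u); have idm := L1valP (f_dom y).
have i1 := L1Z c1 ip; have i2 := L1Z (- (c2 * f_mass u)) idm.
have bh : bmeas (fun x' => c1 * (\int[mu]_(x in B) rr m0 y x x') -
    c2 * \int[mu]_(x in B) dom_dens y x).
  apply: bmeasB; last exact: bmeas_cst.
  have [mb [C bC]] := bmeas_rr_in y m0 mB; split; first exact: measurable_funM.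
  by exists (`|c1| * C) => x; rewrite normrM ler_wpM2l.
have := posdens_Rintegral iu pu bh (fun x' => h x' B mB).
congr (0 <= _).
under eq_Rintegral do rewrite mulrBl.
have ik : L1 mu (fun x' => (\int[mu]_(x in B) rr m0 y x x') * L1val u x').
  by apply: L1_bM => //; exact: bmeas_rr_in.
under eq_Rintegral do rewrite -mulrA.
rewrite RintegralB//; [|exact: L1Z|by apply: L1Z].
rewrite !RintegralZl// -f_prop_in//.
have -> : L1val (c1 *: f_prop y m0 u - (c2 * f_mass u) *: f_dom y) =
    (fun x => c1 * L1val (f_prop y m0 u) x + - (c2 * f_mass u) * L1val (f_dom y) x).
  by rewrite L1valD L1valN !L1valZ; apply/funext => x; rewrite mulNr.
rewrite RintegralD//; [|exact: L1S mB i1|exact: L1S mB i2].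
rewrite !RintegralZl//; [|exact: L1S mB idm|exact: L1S mB ip].
rewrite mkL1K -/(f_mass u) -/(dom_dens y) mulNr; congr (_ - _).
by rewrite mulrAC.
Qed.

Lemma f_prop_low y u : f_pos u ->
  f_pos (f_prop y m0 u - (eps2 * f_mass u) *: f_dom y).
Proof.
move=> pu; rewrite -[f_prop y m0 u]scale1r; apply: comparison => // x' B mB.
by rewrite mul1r subr_ge0; have /andP[] := rr_mix y x' mB.
Qed.

Lemma f_prop_up y u : f_pos u ->
  f_pos ((eps2^-1 * f_mass u) *: f_dom y - f_prop y m0 u).
Proof.
move=> pu.
have -> : (eps2^-1 * f_mass u) *: f_dom y - f_prop y m0 u =
    (-1) *: f_prop y m0 u - (- eps2^-1 * f_mass u) *: f_dom y.
  by rewrite scaleN1r mulNr scaleNr opprK addrC.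
apply: comparison => // x' B mB.
by rewrite mulN1r mulNr opprK addrC subr_ge0; have /andP[] := rr_mix y x' mB.
Qed.

Lemma f_tv_prop y a u :
  f_tv (f_prop y a u) <= psi y ^+ mabs a * (eps2^-1 * f_mass (f_dom y) * f_tv u).
Proof.
rewrite /f_tv mkL1K.
apply: le_trans (kop_norm (meas_rr a y) (rr_bound a y) (rr_L1_le a y) (L1valP u)) _.
by rewrite /rr_cst /f_mass mkL1K !mulrA.
Qed.

Definition L1_system : @filterSystem R Y d p eps2 psi :=
  @FilterSystem R Y d p eps2 psi W f_mass f_tv f_pos f_prop f_dom
    f_massD f_massZ f_tvD f_tvZ f_mass_le_tv f_posD f_posZ f_pos_tv f_jordan
    f_propD f_propZ f_prop_pos
    (fun y => @posdens_ge0 _ _ _ mu _ (fun x => fm_ge0 fm y x point)) dom_gt0_dens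
    f_prop_low f_prop_up f_tv_prop.

End model.

(** * Measurability of integrals with parameters *)

Section parametric_integrals.
Context dZ dX (Z : measurableType dZ) (X : measurableType dX) (R : realType).
Variable l : Z -> {measure set X -> \bar R}.
Hypothesis ml : forall U, measurable U -> measurable_fun setT (l ^~ U).
Hypothesis lfin : forall z, (l z setT < +oo)%E.

HB.instance Definition _ := isKernel.Build _ _ _ _ R l ml.

Import HBNNSimple.

Lemma measurable_integral_param (f : Z * X -> \bar R) :
  (forall z, 0 <= f z)%E -> measurable_fun setT f ->
  measurable_fun setT (fun z => \int[l z]_x f (z, x))%E.
Proof.
move=> f0 mf; pose f_ := nnsfun_approx measurableT mf.
apply: (@measurable_fun_xsection_integral _ _ _ _ _ f l f_).
- by move=> a b ab; exact/nd_nnsfun_approx.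
- by move=> z; exact/cvg_nnsfun_approx.
move=> n r.
have mA : measurable (f_ n @^-1` [set r]) by [].
have : (measurable : set (set (Z * X))) `<=` [set A | measurable A /\
    measurable_fun setT (fun z => mrestr (l z) measurableT (xsection A z))].
  apply: (@measurable_prod_subset_xsection_kernel _ _ _ _ R l) => z.
  exists (fine (l z setT) + 1) => U mU; rewrite EFinD fineK ?ge0_fin_numE//.
  rewrite /mrestr setIT; apply: le_lt_trans (_ : l z U <= l z setT)%E _.
    by rewrite le_measure ?inE.
  by rewrite lteDl ?ge0_fin_numE// lte_fin.
move=> /(_ _ mA)[_]; apply: eq_measurable_fun => z _.
by rewrite /mrestr setIT.
Qed.

Lemma measurable_Rintegral_param (f : Z -> X -> R) :
  measurable_fun setT (fun w : Z * X => f w.1 w.2) ->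
  measurable_fun setT (fun z => \int[l z]_x f z x).
Proof.
move=> mf.
have mF : measurable_fun setT (fun w : Z * X => (f w.1 w.2)%:E).
  exact/measurable_EFinP.
apply: (measurableT_comp (fine_measurable measurableT)).
rewrite (_ : (fun z => _) = (fun z =>
   \int[l z]_x ((fun w : Z * X => (f w.1 w.2)%:E)^\+ (z, x)) -
   \int[l z]_x ((fun w : Z * X => (f w.1 w.2)%:E)^\- (z, x)))%E).
  apply: emeasurable_funB; apply: measurable_integral_param => //.
    exact: measurable_funepos.
  exact: measurable_funeneg.
apply/funext => z; rewrite [LHS]integralE.
congr (_ - _)%E; apply: eq_integral => x _.
  by rewrite !funeposE.
by rewrite !funenegE.
Qed.

End parametric_integrals.

Lemma measurable_Rintegral_fixed dZ dX (Z : measurableType dZ)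
    (X : measurableType dX) (R : realType) (m : {finite_measure set X -> \bar R})
    (f : Z -> X -> R) :
  measurable_fun setT (fun w : Z * X => f w.1 w.2) ->
  measurable_fun setT (fun z => \int[m]_x f z x).
Proof.
move=> mf; apply: (measurable_Rintegral_param (l := fun=> m)) => //.
by move=> z; exact: fin_num_fun_lty.
Qed.

Section vmeas_measurability.
Context dX (X : measurableType dX) (R : realType) (d p : nat).
Local Notation V := (vmeas X R d p).
Implicit Types La : V.

Lemma vdist_ge0 La La' : 0 <= vdist La La'.
Proof.
rewrite /vdist; elim/big_rec: _ => // a x _ x0.
by rewrite le_max x0 orbT.
Qed.

Lemma tvnorm_le_vdist La La' a : tvnorm (csub (La a) (La' a)) <= vdist La La'.
Proof. exact: (le_bigmax_cond _ (fun b => tvnorm (csub (La b) (La' b)))). Qed.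

Lemma tvnorm_le_vnorm La a : tvnorm (La a) <= vnorm La.
Proof. exact: (le_bigmax_cond _ (fun b => tvnorm (La b))). Qed.

Lemma measurable_vopen (U : set V) : vopen U -> measurable U.
Proof. by move=> oU; exact: sub_sigma_algebra. Qed.

(** Such functions are Lipschitz, hence continuous, for the total variation
    distance. *)
Lemma measurable_vlip (g : V -> R) :
  (forall La La', g La' <= g La + vdist La La') -> measurable_fun setT g.
Proof.
move=> gl; apply: (@measurability _ _ _ _ setT g (@RGenInftyO.G R)).
  exact: RGenInftyO.measurableE.
move=> _ [_ [x ->] <-]; rewrite setTI; apply: measurable_vopen => La /=.
rewrite in_itv/= => gx; exists (x - g La); first by rewrite subr_gt0.
by move=> La' h; rewrite /= in_itv/= (le_lt_trans (gl La La'))// -ltrBrDl.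
Qed.

Lemma measurable_cpos a B : measurable B ->
  measurable_fun setT (fun La : V => cpos (La a) B).
Proof.
move=> mB; rewrite (_ : (fun _ => _) = (fun La : V => (fine (cpos (La a) B))%:E)).
  apply/measurable_EFinP; apply: measurable_vlip => La La'.
  rewrite -lee_fin EFinD !fineK ?fin_num_measure//.
  apply: le_trans (cpos_le (La a) (La' a) mB) _.
  by rewrite leeD2l// lee_fin tvnorm_le_vdist.
by apply/funext => La; rewrite fineK// fin_num_measure.
Qed.

Lemma measurable_cneg a B : measurable B ->
  measurable_fun setT (fun La : V => cneg (La a) B).
Proof.
move=> mB; rewrite (_ : (fun _ => _) = (fun La : V => (fine (cneg (La a) B))%:E)).
  apply/measurable_EFinP; apply: measurable_vlip => La La'.
  rewrite -lee_fin EFinD !fineK ?fin_num_measure//.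
  apply: le_trans (cneg_le (La a) (La' a) mB) _.
  by rewrite leeD2l// lee_fin tvnorm_le_vdist.
by apply/funext => La; rewrite fineK// fin_num_measure.
Qed.

(** The two parts of the Jordan decomposition depend continuously on the vector
    measure, setwise, and thus form kernels. *)
Lemma measurable_cintegral dZ (Z : measurableType dZ) (f : Z -> X -> R)
    (g : Z -> V) a :
  measurable_fun setT g ->
  measurable_fun setT (fun w : Z * X => f w.1 w.2) ->
  measurable_fun setT (fun z => cintegral (g z a) (f z)).
Proof.
move=> mg mf; apply: measurable_funB.
  apply: (measurable_Rintegral_param (l := fun z => cpos (g z a))) => //.
    move=> U mU; exact: measurableT_comp (measurable_cpos a mU) mg.
  by move=> z; exact: fin_num_fun_lty.
apply: (measurable_Rintegral_param (l := fun z => cneg (g z a))) => //.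
  move=> U mU; exact: measurableT_comp (measurable_cneg a mU) mg.
by move=> z; exact: fin_num_fun_lty.
Qed.

End vmeas_measurability.

(** * The derivative maps on vector measures *)

Section derivative_maps.
Context (R : realType) (d p : nat) dX (X : measurableType dX)
  dY (Y : measurableType dY) (mu : {finite_measure set X -> \bar R}) (eps : R)
  (psi : Y -> R) (phi : Y -> X -> R).
Variables (ptheta : 'rV[R]_d -> X -> X -> R) (qtheta : 'rV[R]_d -> Y -> X -> R)
  (th : 'rV[R]_d).
Local Notation rr := (fun (a : midx d p) y x x' => drtheta ptheta qtheta a th y x x').
Hypothesis fm : filter_model mu eps psi phi rr.

Local Notation m0 := (midx0 d p).
Local Notation eps2 := (eps ^+ 2).
Local Notation mix := (eps2^-1 ^+ 2).
Local Notation V := (vmeas X R d p).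
Local Notation W := (L1_system fm).
Local Notation rder := (rder ptheta qtheta th).
Local Notation sder := (sder mu ptheta qtheta th).
Local Notation fder := (fder mu ptheta qtheta th).
Local Notation Fder := (Fder mu ptheta qtheta th).
Implicit Types (y : Y) (a b : midx d p) (La : V) (x : X).

Let eps2_gt0 : 0 < eps2. Proof. by case/andP: (eps2_01 fm). Qed.
Let eps2V_gt0 : 0 < eps2^-1. Proof. by rewrite invr_gt0. Qed.

Let one (m : {finite_measure set X -> \bar R}) : L1 m (fun=> 1).
Proof. exact: finite_measure_integrable_cst. Qed.

Let kop1 (m : {finite_measure set X -> \bar R}) y a :=
  kop m (rr a y) (fun=> 1).

Let rderE y a x (la : {charge set X -> \bar R}) :
  rder y a x la = kop1 (cpos la) y a x - kop1 (cneg la) y a x.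
Proof.
by rewrite /kop1 /kop /rder cintegralE; congr (_ - _);
  apply: eq_Rintegral => x' _; rewrite mulr1.
Qed.

Let L1_kop1 m y a : L1 mu (kop1 m y a).
Proof. exact: L1_kop (meas_rr fm a y) (rr_bound fm a y) (rr_L1_le fm a y) _ (one m). Qed.

Lemma L1_rder y a (la : {charge set X -> \bar R}) :
  L1 mu (fun x => rder y a x la).
Proof.
under [X in L1 _ X]eq_fun do rewrite rderE.
by apply: L1B; exact: L1_kop1.
Qed.

Let norm_kop1 m y a :
  \int[mu]_x `|kop1 m y a x| <= rr_cst mu eps psi rr a y * fine (m setT).
Proof.
have := kop_norm (meas_rr fm a y) (rr_bound fm a y) (rr_L1_le fm a y) (one m).
under [X in _ <= _ * X]eq_Rintegral do rewrite normr1.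
by rewrite Rintegral_cst// mul1r.
Qed.

Lemma norm_rder y a (la : {charge set X -> \bar R}) :
  \int[mu]_x `|rder y a x la| <= rr_cst mu eps psi rr a y * tvnorm la.
Proof.
rewrite tvnormE mulrDr.
apply: le_trans (lerD (norm_kop1 (cpos la) y a) (norm_kop1 (cneg la) y a)).
rewrite -RintegralD//; [|exact/L1_norm/L1_kop1|exact/L1_norm/L1_kop1].
apply: le_Rintegral => //.
- exact/L1_norm/L1_rder.
- by apply: L1D; exact/L1_norm/L1_kop1.
by move=> x _; rewrite rderE; exact: ler_normB.
Qed.

Section normalisation.
Variables (la : {charge set X -> \bar R}).
Hypothesis la0 : forall B, measurable B -> (0 <= la B)%E.
Hypothesis laT : la setT = 1%E.

Let cneg0 B : measurable B -> cneg la B = 0%E. Proof. exact: cneg_ge0. Qed.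

Let cpos1 : fine (cpos la setT) = 1.
Proof.
by have := charge_decomp la measurableT; rewrite cneg0// sube0 laT => <-.
Qed.

Lemma tvnorm_prob : tvnorm la = 1.
Proof. by rewrite tvnormE cpos1 cneg0// addr0. Qed.

Lemma rder0_ge0 y x : 0 <= rder y m0 x la.
Proof.
rewrite /rder cintegral_ge0//; apply: Rintegral_ge0 => x' _.
exact: fm_ge0 fm _ _ _.
Qed.

(** The left-hand side bounds each of the integrals of which the right-hand side is
    the average with respect to the probability measure [la]. *)
Lemma rder0_mass y : eps2 * \int[mu]_x dom_dens rr y x <= \int[mu]_x rder y m0 x la.
Proof.
have e x : rder y m0 x la = kop1 (cpos la) y m0 x.
  by rewrite /rder cintegral_ge0//; apply: eq_Rintegral => x' _; rewrite mulr1.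
under [leRHS]eq_Rintegral do rewrite e.
rewrite (kop_fubini (meas_rr fm m0 y) (rr_bound fm m0 y) (rr_L1_le fm m0 y) (one (cpos la))).
under [leRHS]eq_Rintegral do rewrite mulr1.
rewrite -[leLHS]mulr1 -[X in _ * X <= _]cpos1 -Rintegral_cst//.
apply: le_Rintegral => //.
- exact: finite_measure_integrable_cst.
- by apply: bmeas_integrable; apply: bmeas_int_k (meas_rr fm m0 y) (rr_L1_le fm m0 y).
by move=> x _; have /andP[] := rr_mix fm y x measurableT.
Qed.

End normalisation.

Definition likelihood y La := \int[mu]_x rder y m0 x (La m0).

Lemma likelihood_ge y La : eps2 * \int[mu]_x dom_dens rr y x <= likelihood y La.
Proof. by apply: rder0_mass; [exact: vcomp0_ge0|exact: vcomp0T]. Qed.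

Lemma likelihood_gt0 y La : 0 < likelihood y La.
Proof.
by apply: lt_le_trans (likelihood_ge y La); rewrite mulr_gt0// (dom_gt0_dens fm).
Qed.

Lemma L1_sder y a La : L1 mu (fun x => sder y a x La).
Proof.
apply: L1_sum => b _; apply: L1Z.
under [X in L1 _ X]eq_fun do rewrite mulrC.
by apply: L1Z; exact: L1_rder.
Qed.

Lemma L1_fder y a La : L1 mu (fun x => fder y a x La).
Proof.
have [n] := ubnP (mabs a); elim: n a => // n ih a an.
under [X in L1 _ X]eq_fun do rewrite fderE.
apply: L1B; first exact: L1_sder.
apply: L1_sum => b /andP[ba bNa].
under [X in L1 _ X]eq_fun do rewrite mulrAC.
by apply: L1Z; apply: ih; rewrite -ltnS (leq_trans _ an)// ltnS mabs_lt.
Qed.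

Lemma sder0E y x La : sder y m0 x La = rder y m0 x (La m0) / likelihood y La.
Proof.
rewrite /sder (big_pred1 m0) => [|b]; last by rewrite /= mle_eq0.
by rewrite mbin_id mul1r msub_id.
Qed.

Lemma fder0E y x La : fder y m0 x La = rder y m0 x (La m0) / likelihood y La.
Proof.
rewrite fderE big_pred0 ?subr0 ?sder0E// => b.
by rewrite mle_eq0 andbN.
Qed.

Lemma fder0_ge0 y x La : 0 <= fder y m0 x La.
Proof.
rewrite fder0E divr_ge0 ?(ltW (likelihood_gt0 _ _))//.
by apply: rder0_ge0; exact: vcomp0_ge0.
Qed.

Lemma fder0_mass y La : \int[mu]_x fder y m0 x La = 1.
Proof.
under eq_Rintegral do rewrite fder0E.
by rewrite RintegralZr ?divff ?gt_eqF ?likelihood_gt0//; exact: L1_rder.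
Qed.

Definition fjet y La a : W := mkL1 (L1_fder y a La).

(** The junk value in the definition does not occur, because the component of
    order zero is a probability density. *)
Lemma FderE y La a B : measurable B ->
  Fder y La a B = (\int[mu]_(x in B) (fder y a x La)%:E)%E.
Proof.
pose comp a : {charge set X -> \bar R} := induced_charge (L1_fder y a La).
have c0 B' : measurable B' -> (0 <= comp m0 B')%E.
  by move=> _; apply: integral_ge0 => x _; rewrite lee_fin; exact: fder0_ge0.
have c1 : comp m0 setT = 1%E.
  have := fder0_mass y La; rewrite /comp /= /induced_charge /Rintegral => h.
  rewrite -[LHS]fineK; first by rewrite h.
  by apply: integrable_fin_num => //; exact: L1_fder.
have ex : [set La' : V | forall a B, measurable B ->
    La' a B = (\int[mu]_(x in B) (fder y a x La)%:E)%E] (VMeas c0 c1) by [].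
by move: a B; exact: (xgetPex La (ex_intro _ _ ex)).
Qed.

Lemma tvnorm_Fder y La a : tvnorm (Fder y La a) = tv (fjet y La a).
Proof. by rewrite (tvnorm_density (L1_fder y a La))// => B; exact: FderE. Qed.

Lemma tvnorm_csub_Fder y y' La La' a :
  tvnorm (csub (Fder y La a) (Fder y' La' a)) =
  tv (fjet y La a - fjet y' La' a).
Proof.
apply: (tvnorm_csub_density (L1_fder y a La) (L1_fder y' a La')) => B;
  exact: FderE.
Qed.

Lemma fjet_prob y La : pos (fjet y La m0) /\ mass (fjet y La m0) = 1.
Proof.
split; last exact: fder0_mass.
by apply: posdens_ge0 => x; exact: fder0_ge0.
Qed.

(** From the second step on, the update acts on densities, through the operators
    of the abstract theory. *)
Lemma rder_Fder y y' a b La x :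
  rder y a x (Fder y' La b) = L1val (prop y a (fjet y' La b)) x.
Proof.
rewrite /rder (cintegral_density (L1_fder y' b La))//.
- by move=> B; exact: FderE.
- exact: bmeas_k (meas_rr fm a y) (rr_bound fm a y) x.
Qed.

Lemma L1val_sum (I : Type) (s : seq I) (P : pred I) (F : I -> L1space mu) x :
  L1val (\sum_(i <- s | P i) F i) x = \sum_(i <- s | P i) L1val (F i) x.
Proof. by elim/big_rec2: _ => // i u v _ <-. Qed.

Lemma likelihood_Fder y y' La :
  likelihood y (Fder y' La) = mass (prop y m0 (fjet y' La m0)).
Proof. by apply: eq_Rintegral => x _; rewrite rder_Fder. Qed.

Lemma sder_Fder y y' a La x :
  sder y a x (Fder y' La) = L1val (sjet y (fjet y' La) a) x.
Proof.
rewrite [RHS]L1val_sum [RHS](eq_bigr (fun b => (mbin a b)%:R *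
  (rder y (msub a b) x (Fder y' La b) / likelihood y (Fder y' La))))// => b _.
by rewrite likelihood_Fder rder_Fder !L1valZ [_ / _]mulrC.
Qed.

Lemma jet_step_fjet y y' La : jet_step y (fjet y' La) (fjet y (Fder y' La)).
Proof.
move=> a; apply: L1val_inj; apply/funext => x.
rewrite L1valD L1valN mkL1K fderE sder_Fder; congr (_ - _).
rewrite [RHS]L1val_sum [RHS](eq_bigr (fun b => (mbin a b)%:R * fder y b x (Fder y' La) *
  Rintegral mu setT (fun x' => sder y (msub a b) x' (Fder y' La))))// => b _.
rewrite L1valZ mkL1K mulrAC; congr (_ * _ * _).
by apply: eq_Rintegral => x' _; rewrite sder_Fder.
Qed.

End derivative_maps.

(** * Iterated derivative maps *)

(** The constant of the first update: there [2 ^+ p] bounds sums of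
    multi-binomial coefficients, once in [norm_sder] and once in the recursion of
    [norm_fder]; the square absorbs the exponent |a| + 1 into 2|a|. *)
Definition first_cst (R : realType) (p : nat) (eps : R) : R :=
  (2 * 2 ^+ p * (2 ^+ p * eps^-1 ^+ 2)) ^+ 2.

Definition growth_cst (R : realType) (p : nat) (eps : R) : R :=
  growth p (eps ^+ 2) p * first_cst p (eps ^+ 2).

Section iterated.
Context (R : realType) (d p : nat) dX (X : measurableType dX)
  dY (Y : measurableType dY) (mu : {finite_measure set X -> \bar R}) (eps : R)
  (psi : Y -> R) (phi : Y -> X -> R).
Variables (ptheta : 'rV[R]_d -> X -> X -> R) (qtheta : 'rV[R]_d -> Y -> X -> R)
  (th : 'rV[R]_d).
Local Notation rr := (fun (a : midx d p) y x x' => drtheta ptheta qtheta a th y x x').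
Hypothesis fm : filter_model mu eps psi phi rr.

Local Notation m0 := (midx0 d p).
Local Notation eps2 := (eps ^+ 2).
Local Notation mix := (eps2^-1 ^+ 2).
Local Notation B := (2 ^+ p : R).
Local Notation V := (vmeas X R d p).
Local Notation W := (L1_system fm).
Local Notation rder := (rder ptheta qtheta th).
Local Notation sder := (sder mu ptheta qtheta th).
Local Notation fder := (fder mu ptheta qtheta th).
Local Notation Fder := (Fder mu ptheta qtheta th).
Local Notation fjet := (fjet fm).
Implicit Types (y : Y) (a b : midx d p) (La : V) (x : X) (ys : seq Y).

Let eps2_01 := eps2_01 fm.
Let eps2_gt0 : 0 < eps2. Proof. by case/andP: eps2_01. Qed.
Let eps2V_gt0 : 0 < eps2^-1. Proof. by rewrite invr_gt0. Qed.
Let eps2V_ge0 : 0 <= eps2^-1. Proof. exact: ltW. Qed.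
Let eps2V_ge1 : 1 <= eps2^-1.
Proof. by rewrite invf_ge1// ltW//; case/andP: eps2_01. Qed.
Let mix_ge1 : 1 <= mix. Proof. by rewrite expr2 mulr_ege1. Qed.
Let mix_ge0 : 0 <= mix. Proof. exact: le_trans mix_ge1. Qed.
Let B_ge1 : 1 <= B. Proof. by rewrite exprn_ege1// ler1n. Qed.
Let B_ge0 : 0 <= B. Proof. exact: le_trans B_ge1. Qed.

(** The scale on which everything is homogeneous: the component of order [a]
    is of size M^|a|. *)
Definition scaled (M : R) La := forall a, tvnorm (La a) <= M ^+ mabs a.

Lemma tvnorm_vcomp0 La : tvnorm (La m0) = 1.
Proof. by apply: tvnorm_prob; [exact: vcomp0_ge0|exact: vcomp0T]. Qed.

Lemma vnorm_ge1 La : 1 <= vnorm La.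
Proof. by rewrite -(tvnorm_vcomp0 La); exact: tvnorm_le_vnorm. Qed.

Lemma scaled_vnorm La : scaled (vnorm La) La.
Proof.
move=> a; have [->|a0] := eqVneq a m0; first by rewrite mabs0 expr0 tvnorm_vcomp0.
apply: le_trans (tvnorm_le_vnorm La a) _.
by rewrite ler_eXnr ?vnorm_ge1// lt0n mabs_eq0.
Qed.

Lemma scaled_le M M' La : 0 <= M <= M' -> scaled M La -> scaled M' La.
Proof.
move=> /andP[M0 MM'] h a; apply: le_trans (h a) _.
by rewrite lerXn2r// nnegrE// (le_trans M0).
Qed.

Section first_step.
Variables (M : R) (y : Y) (La : V).
Hypotheses (M_ge1 : 1 <= M) (yM : psi y <= M) (LaM : scaled M La).
Let M_ge0 : 0 <= M. Proof. exact: le_trans M_ge1. Qed.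

Lemma norm_sder a : \int[mu]_x `|sder y a x La| <= B * (mix * M ^+ mabs a).
Proof.
have D0 := likelihood_gt0 fm y La; have D1 := likelihood_ge fm y La.
set D := likelihood _ _ _ _ _ _ in D0 D1.
have i1 b : L1 mu (fun x => (mbin a b)%:R * `|rder y (msub a b) x (La b) / D|).
  apply: L1Z; apply: L1_norm.
  under [X in L1 _ X]eq_fun do rewrite mulrC.
  by apply: L1Z; exact: L1_rder fm _ _ _.
apply: (@le_trans _ _ (\int[mu]_x (\sum_(b | mle b a)
    (mbin a b)%:R * `|rder y (msub a b) x (La b) / D|))).
  apply: le_Rintegral => //.
  - exact: L1_norm (L1_sder fm y a La).
  - exact: L1_sum.
  move=> x _; rewrite /Defs.sder; apply: le_trans (ler_norm_sum _ _ _) _.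
  by apply: ler_sum => b _; rewrite normrM normr_nat.
rewrite Rintegral_sum; last by [].
under eq_bigl do rewrite -[mle _ _]andbT.
under eq_bigr => b _.
  rewrite RintegralZl//; last first.
    apply: (@L1_norm _ _ _ mu (fun x => rder y (msub a b) x (La b) / D)).
    under [X in L1 _ X]eq_fun do rewrite mulrC.
    by apply: L1Z; exact: L1_rder fm _ _ _.
  over.
apply: mbin_sum_le => [|b ba _]; first by rewrite mulr_ge0 ?exprn_ge0.
under eq_Rintegral do rewrite normrM (gtr0_norm (_ : 0 < D^-1)) ?invr_gt0//.
rewrite RintegralZr//; last exact: L1_norm (L1_rder fm _ _ _).
rewrite ler_pdivrMr//; apply: le_trans (norm_rder fm y (msub a b) (La b)) _.
rewrite /rr_cst.
set DM := \int[mu]_x dom_dens _ _ _ in D1 *.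
have DM0 : 0 < DM := dom_gt0_dens fm y.
rewrite -(mabs_msub ba) exprD.
have h1 : psi y ^+ mabs (msub a b) <= M ^+ mabs (msub a b).
  by rewrite lerXn2r// nnegrE ?(psi_ge0 fm).
have h2 : DM <= eps2^-1 * D by rewrite ler_pdivlMl.
have h3 : psi y ^+ mabs (msub a b) * (eps2^-1 * DM) <=
    M ^+ mabs (msub a b) * (eps2^-1 * (eps2^-1 * D)).
  rewrite ler_pM ?exprn_ge0 ?(psi_ge0 fm)//; first by rewrite mulr_ge0 ?(ltW DM0).
  by rewrite ler_wpM2l.
apply: le_trans (ler_pM _ (tvnorm_ge0 _) h3 (LaM b)) _.
  by rewrite mulr_ge0 ?exprn_ge0 ?(psi_ge0 fm)// mulr_ge0 ?(ltW DM0).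
by rewrite le_eqVlt; apply/orP; left; apply/eqP; ring.
Qed.

Lemma norm_fder a : \int[mu]_x `|fder y a x La| <=
  (2 * B * (B * mix)) ^+ (mabs a).+1 * M ^+ mabs a.
Proof.
set K := B * mix; have K1 : 1 <= K by rewrite mulr_ege1.
have K0 : 0 <= K by exact: le_trans K1.
set H := 2 * B * K.
have H1 : 1 <= H by rewrite !mulr_ege1// ler1n.
have H0 : 0 <= H by exact: le_trans H1.
have [n] := ubnP (mabs a); elim: n a => // n ih a an.
have iF b : L1 mu (fun x => fder y b x La) := L1_fder fm y b La.
have i1 b : L1 mu (fun x => (mbin a b)%:R * (`|fder y b x La| *
    `|\int[mu]_x' sder y (msub a b) x' La|)).
  apply: L1Z; under [X in L1 _ X]eq_fun do rewrite mulrC.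
  by apply: L1Z; exact: L1_norm.
apply: (@le_trans _ _ (\int[mu]_x (`|sder y a x La| +
  \sum_(b | mle b a && (b != a)) (mbin a b)%:R * (`|fder y b x La| *
    `|\int[mu]_x' sder y (msub a b) x' La|)))).
  apply: le_Rintegral => //.
  - exact: L1_norm (iF a).
  - apply: L1D; first exact: L1_norm (L1_sder fm y a La).
    exact: L1_sum.
  move=> x _; rewrite fderE; apply: le_trans (ler_normB _ _) _; rewrite lerD2l.
  apply: le_trans (ler_norm_sum _ _ _) _.
  by apply: ler_sum => b _; rewrite !normrM normr_nat mulrA.
rewrite RintegralD//; [|exact: L1_norm (L1_sder fm y a La)|exact: L1_sum].
rewrite Rintegral_sum; last by [].
under eq_bigr => b _.
  rewrite RintegralZl//; last first.
    under [X in _.-integrable _ X]eq_fun do rewrite /= mulrC.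
    by apply: (@L1Z _ _ _ mu); exact: L1_norm.
  rewrite RintegralZr//; last exact: L1_norm.
  over.
have Sa := norm_sder a; rewrite mulrA -/K in Sa.
apply: (@le_trans _ _ (K * M ^+ mabs a + B * (H ^+ mabs a * K * M ^+ mabs a))).
  rewrite lerD//; apply: mbin_sum_le => [|b ba bNa].
    by rewrite !mulr_ge0 ?exprn_ge0.
  have b1 : (mabs b < mabs a)%N by exact: mabs_lt.
  have Nb : \int[mu]_x `|fder y b x La| <= H ^+ mabs a * M ^+ mabs b.
    apply: le_trans (ih b _) _; first by rewrite -ltnS (leq_trans _ an).
    by rewrite ler_wpM2r ?exprn_ge0// ler_weXn2l.
  have Sb : `|\int[mu]_x' sder y (msub a b) x' La| <= K * M ^+ mabs (msub a b).
    apply: le_trans (le_normr_Rintegral measurableT (L1_sder fm y _ La)) _.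
    by apply: le_trans (norm_sder _) _; rewrite mulrA.
  apply: le_trans (ler_pM _ (normr_ge0 _) Nb Sb) _.
    by apply: Rintegral_ge0.
  have -> : M ^+ mabs a = M ^+ mabs (msub a b) * M ^+ mabs b.
    by rewrite -exprD mabs_msub.
  by rewrite le_eqVlt; apply/orP; left; apply/eqP; ring.
set X1 := B * K * M ^+ mabs a.
have X1_ge0 : 0 <= X1 by rewrite !mulr_ge0 ?exprn_ge0.
have h1 : X1 <= H ^+ mabs a * X1 by rewrite ler_peMl// exprn_ege1.
have h2 : K * M ^+ mabs a <= X1.
  by rewrite /X1 -mulrA ler_peMl// mulr_ge0 ?exprn_ge0.
rewrite (_ : B * (_ * K * _) = H ^+ mabs a * X1); last by rewrite /X1; ring.
rewrite (_ : H ^+ (mabs a).+1 * _ = 2 * (H ^+ mabs a * X1)); last first.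
  by rewrite exprS /X1 /H; ring.
by lra.
Qed.

(** After one update the components are densities, of the same homogeneity. *)
Lemma jet_le_first : jet_le (first_cst p eps2 * M) 1 p (fjet y La).
Proof.
move=> a _; rewrite mul1r.
have [->|a0] := eqVneq a m0.
  have [p0 q0] := fjet_prob fm y La.
  by rewrite mabs0 expr0 (pos_tv p0) q0.
apply: le_trans (norm_fder a) _.
rewrite [leRHS]exprMn ler_wpM2r ?exprn_ge0// /first_cst -exprM ler_weXn2l//.
  by rewrite !mulr_ege1// ler1n.
by rewrite mul2n -addnn -addn1 leq_add2l lt0n mabs_eq0.
Qed.

End first_step.

Definition Fders ys La : V := foldl (fun L y => Fder y L) La ys.

(** The state and the observation from which the jet of time [k] is made. *)
Fixpoint jet_data y (o : nat -> Y) La k : V * Y :=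
  if k is n.+1 then
    (Fder (jet_data y o La n).2 (jet_data y o La n).1, o n)
  else (La, y).

Definition jets y (o : nat -> Y) La k : midx d p -> W :=
  fjet (jet_data y o La k).2 (jet_data y o La k).1.

Lemma jets_path y o La : jet_path o (jets y o La).
Proof.
have [p0 q0] := fjet_prob fm y La; split => // k.
exact: jet_step_fjet.
Qed.

Lemma jet_dataE y o La k :
  Fder (jet_data y o La k).2 (jet_data y o La k).1 = Fders (y :: mkseq o k) La.
Proof.
elim: k => // k ih.
by rewrite [LHS]/= ih -[RHS]/(foldl _ _ (mkseq o k.+1)) mkseqS foldl_rcons.
Qed.

Lemma jets_size y ys La :
  Fder (jet_data y (nth y ys) La (size ys)).2 (jet_data y (nth y ys) La (size ys)).1 =
  Fders (y :: ys) La.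
Proof. by rewrite jet_dataE mkseq_nth. Qed.

Lemma first_cst_ge1 : 1 <= first_cst p eps2.
Proof. by rewrite exprn_ege1// !mulr_ege1// ler1n. Qed.

Lemma growth_cst_ge1 : 1 <= growth_cst p eps.
Proof. by rewrite mulr_ege1// ?growth_ge1 ?first_cst_ge1. Qed.

Let nth_le y ys M : all (fun y => psi y <= M) (y :: ys) ->
  forall k, 0 <= psi (nth y ys k) <= M.
Proof.
move=> /= /andP[yM /allP ysM] k; rewrite (psi_ge0 fm)/=.
by case: (ltnP k (size ys)) => h; [apply/ysM/mem_nth|rewrite nth_default].
Qed.

Let le_first M : 1 <= M -> M <= first_cst p eps2 * M.
Proof. by move=> M1; rewrite ler_peMl ?first_cst_ge1// (le_trans _ M1). Qed.

Lemma scaled_Fders ys La M : 1 <= M -> scaled M La ->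
  all (fun y => psi y <= M) ys -> scaled (growth_cst p eps * M) (Fders ys La).
Proof.
move=> M1 LaM; have M0 : 0 <= M by exact: le_trans M1.
case: ys => [_|y ys ysM].
  by apply: scaled_le LaM; rewrite M0 ler_peMl// growth_cst_ge1.
move=> a; have [->|a0] := eqVneq a m0; first by rewrite mabs0 expr0 tvnorm_vcomp0.
rewrite -jets_size (tvnorm_Fder fm).
have yM : psi y <= M by case/andP: ysM.
have H1 : 1 <= first_cst p eps2 * M by rewrite mulr_ege1// first_cst_ge1.
have oM k : 0 <= psi (nth y ys k) <= first_cst p eps2 * M.
  by have /andP[-> h] := nth_le ysM k; exact: le_trans h (le_first M1).
apply: le_trans (jet_growth eps2_01 (size ys) a H1 oM (jets_path y (nth y ys) La) _) _.
  exact: jet_le_first.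
have g1 : 1 <= growth p eps2 p by exact: growth_ge1.
have g0 : 0 <= growth p eps2 p by exact: le_trans g1.
rewrite /growth_cst -mulrA [leRHS]exprMn ler_wpM2r ?exprn_ge0 ?(le_trans _ H1)//.
apply: le_trans (growth_le p eps2_01 (mabs_le_p a)) _.
by rewrite ler_eXnr// lt0n mabs_eq0.
Qed.

Lemma Fders_forget y ys La La' M a : 1 <= M -> scaled M La -> scaled M La' ->
  all (fun y => psi y <= M) (y :: ys) ->
  tvnorm (csub (Fders (y :: ys) La a) (Fders (y :: ys) La' a)) <=
  forget p eps2 p (size ys) * (first_cst p eps2 * M) ^+ mabs a.
Proof.
move=> M1 LaM La'M ysM; rewrite -!jets_size (tvnorm_csub_Fder fm).
have yM : psi y <= M by case/andP: ysM.
have H1 : 1 <= first_cst p eps2 * M by rewrite mulr_ege1// first_cst_ge1.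
have oM k : 0 <= psi (nth y ys k) <= first_cst p eps2 * M.
  by have /andP[-> h] := nth_le ysM k; exact: le_trans h (le_first M1).
apply: le_trans (jet_forgets eps2_01 (size ys) a H1 oM (jets_path y _ La)
  (jets_path y _ La') _ _) _.
- exact: jet_le_first.
- exact: jet_le_first.
rewrite ler_wpM2r ?exprn_ge0 ?(le_trans _ H1)//.
by apply: forget_le => //; exact: mabs_le_p.
Qed.

End iterated.

(** * Separability of L1 over a countably generated sigma-algebra *)

Section separability.
Context dX (X : measurableType dX) (R : realType).
Variable mu : {finite_measure set X -> \bar R}.
Variable G : nat -> set X.
Hypothesis XG : (measurable : set (set X)) = <<s range G >>.

Definition Gcap (s : seq nat) : set X := \big[setI/setT]_(n <- s) G n.

(** Rational combinations of indicators of the finite intersections of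
    generators: a countable family of functions. *)
Definition stepf (L : seq (seq nat * rat)) (x : X) : R :=
  \sum_(i <- L) ratr i.2 * \1_(Gcap i.1) x.

Let mG n : measurable (G n).
Proof. by rewrite XG; apply: sub_sigma_algebra; exists n. Qed.

Let mGcap s : measurable (Gcap s).
Proof.
by rewrite /Gcap; elim/big_rec: _ => // n A _ mA; exact: measurableI.
Qed.

Lemma L1_indic E : measurable E -> L1 mu (\1_E : X -> R).
Proof. by move=> mE; exact: integrable_indic. Qed.

Lemma L1_stepf L : L1 mu (stepf L).
Proof. by apply: L1_sum => i _; apply: L1Z; exact/L1_indic. Qed.

(** The functions in the closure of the countable family. *)
Definition approx (f : X -> R) := L1 mu f /\
  forall e, 0 < e -> exists L, \int[mu]_x `|f x - stepf L x| < e.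

Lemma L1_dist f g : L1 mu f -> L1 mu g -> L1 mu (fun x => `|f x - g x|).
Proof. by move=> hf hg; apply: L1_norm; exact: L1B. Qed.

Lemma L1_dist_tri f g h : L1 mu f -> L1 mu g -> L1 mu h ->
  \int[mu]_x `|f x - h x| <= \int[mu]_x `|f x - g x| + \int[mu]_x `|g x - h x|.
Proof.
move=> hf hg hh; rewrite -RintegralD//; [|exact: L1_dist..].
apply: le_Rintegral => //; [exact: L1_dist|by apply: L1D; exact: L1_dist|].
by move=> x _; exact: ler_distD.
Qed.

Lemma approx_lim f : L1 mu f ->
  (forall e, 0 < e -> exists2 g, approx g & \int[mu]_x `|f x - g x| < e) ->
  approx f.
Proof.
move=> hf h; split => // e e0; have e20 : 0 < e / 2 by rewrite divr_gt0.
have [g [hg hgL] fg] := h _ e20; have [L gL] := hgL _ e20; exists L.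
apply: le_lt_trans (L1_dist_tri hf hg (L1_stepf L)) _.
by rewrite [ltRHS](splitr e) ltrD.
Qed.

Lemma approx_ext f g : f =1 g -> approx f -> approx g.
Proof. by move=> /funext ->. Qed.

Lemma approxD f g : approx f -> approx g -> approx (fun x => f x + g x).
Proof.
move=> [hf hfL] [hg hgL]; split; first exact: L1D.
move=> e e0; have e20 : 0 < e / 2 by rewrite divr_gt0.
have [L fL] := hfL _ e20; have [L' gL'] := hgL _ e20; exists (L ++ L').
rewrite [ltRHS](splitr e).
apply: le_lt_trans (ltrD fL gL').
have hL := L1_stepf L; have hL' := L1_stepf L'.
rewrite -RintegralD//; [|exact: L1_dist..].
apply: le_Rintegral => //.
- by apply: L1_dist; [exact: L1D|exact: L1_stepf].
- by apply: L1D; exact: L1_dist.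
move=> x _; rewrite /stepf big_cat/= opprD addrACA; exact: ler_normD.
Qed.

Lemma stepfZ (q : rat) L x :
  stepf [seq (i.1, q * i.2) | i <- L] x = ratr q * stepf L x.
Proof.
rewrite /stepf big_map mulr_sumr; apply: eq_bigr => i _ /=.
by rewrite rmorphM mulrA.
Qed.

Lemma approxZ c f : approx f -> approx (fun x => c * f x).
Proof.
move=> [hf hfL]; split; first exact: L1Z.
move=> e e0; have e20 : 0 < e / 2 by rewrite divr_gt0.
set S := \int[mu]_x `|f x|.
have S0 : 0 <= S by apply: Rintegral_ge0.
have S1 : 0 < S + 1 by rewrite ltr_wpDl.
pose eta := e / 2 / (S + 1); have eta0 : 0 < eta by rewrite divr_gt0.
have [q] : exists q : rat, ratr q \in `](c - eta), c[%R.
  by apply: rat_in_itvoo; rewrite ltrBlDr ltrDl.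
rewrite in_itv/= => /andP[q1 q2].
have Q1 : 0 < `|ratr q : R| + 1 by rewrite ltr_wpDl.
have [L fL] := hfL _ (divr_gt0 e20 Q1).
exists [seq (i.1, q * i.2) | i <- L].
under eq_Rintegral do rewrite stepfZ.
have hL := L1_stepf L; have hd := L1_dist hf hL; have hn := L1_norm hf.
apply: (@le_lt_trans _ _ (\int[mu]_x (eta * `|f x| + `|ratr q| * `|f x - stepf L x|))).
  apply: le_Rintegral => //.
  - by apply: (L1_dist (f := fun x => c * f x) (g := fun x => ratr q * stepf L x)); exact: L1Z.
  - by apply: L1D; exact: L1Z.
  move=> x _.
  have -> : c * f x - ratr q * stepf L x =
      (c - ratr q) * f x + ratr q * (f x - stepf L x) by ring.
  rewrite (le_trans (ler_normD _ _))// !normrM lerD// ler_wpM2r//.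
  rewrite ger0_norm; last by rewrite subr_ge0 ltW.
  by rewrite lerBlDr -lerBlDl ltW.
rewrite RintegralD//; [|exact: L1Z..].
rewrite !RintegralZl// [ltRHS](splitr e).
apply: ler_ltD.
  rewrite -/S /eta mulrAC ler_pdivrMr//.
  by rewrite ler_wpM2l ?(ltW e20)// lerDl.
apply: (@le_lt_trans _ _ ((`|ratr q| + 1) * \int[mu]_x `|f x - stepf L x|)).
  by rewrite ler_wpM2r ?lerDl//; apply: Rintegral_ge0.
by rewrite mulrC -ltr_pdivlMr.
Qed.

Lemma approxB f g : approx f -> approx g -> approx (fun x => f x - g x).
Proof.
move=> hf hg; apply: (approx_ext _ (approxD hf (approxZ (-1) hg))) => x.
by rewrite mulN1r.
Qed.

Lemma approx_step L : approx (stepf L).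
Proof.
split; first exact: L1_stepf.
move=> e e0; exists L; under eq_Rintegral do rewrite subrr normr0.
by rewrite Rintegral_cst// mul0r.
Qed.

Lemma approx_sum (I : Type) (s : seq I) (F : I -> X -> R) :
  (forall i, approx (F i)) -> approx (fun x => \sum_(i <- s) F i x).
Proof.
move=> h; elim: s => [|i s ih].
  by apply: approx_ext (approx_step [::]) => x; rewrite /stepf !big_nil.
by apply: approx_ext (approxD (h i) ih) => x; rewrite big_cons.
Qed.

Lemma approx_Gcap s : approx \1_(Gcap s).
Proof.
apply: approx_ext (approx_step [:: (s, 1)]) => x.
by rewrite /stepf big_seq1 rmorph1 mul1r.
Qed.

(** The finite intersections of generators form a pi-system, and the sets whose
    indicator can be approximated a Dynkin system. *)
Lemma approx_indic E : measurable E -> approx \1_E.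
Proof.
have XG' : (measurable : set (set X)) = <<s range Gcap >>.
  apply/seteqP; split.
    rewrite XG; apply: smallest_sub; first exact: smallest_sigma_algebra.
    move=> _ [n _ <-]; apply: sub_sigma_algebra; exists [:: n] => //.
    by rewrite /Gcap big_seq1.
  apply: smallest_sub; first exact: sigma_algebra_measurable.
  by move=> _ [s _ <-]; exact: mGcap.
have GI : setI_closed (range Gcap).
  move=> _ _ [s _ <-] [s' _ <-]; exists (s ++ s') => //.
  by rewrite /Gcap big_cat.
have aT : approx \1_(setT : set X).
  by have := approx_Gcap [::]; rewrite /Gcap big_nil.
have disj (F : nat -> set X) n x : trivIset setT F ->
    \sum_(k < n) \1_(F k) x <= \1_(\bigcup_k F k) x :> R.
  move=> tF; rewrite [leRHS]indicE; case: (boolP (x \in _)) => xU; last first.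
    rewrite big1// => k _; rewrite indicE memNset// => xF.
    by move/negP: xU; apply; apply/mem_set; exists k.
  have [j _ Fj] := set_mem xU.
  have F0 k : k != j -> \1_(F k) x = 0 :> R.
    move=> kj; rewrite indicE memNset// => Fk; move/eqP: kj; apply.
    by apply: tF => //; exists x.
  case: (ltnP j n) => jn; last first.
    by rewrite big1// => k _; rewrite F0// ltn_eqF// (leq_trans _ jn).
  rewrite (bigD1 (Ordinal jn))//= big1 ?addr0 ?indicE ?mem_set// => k kj.
  by rewrite F0//; apply: contra kj => /eqP kj; apply/eqP/val_inj.
have int_indic A : measurable A -> \int[mu]_x \1_A x = fine (mu A).
  by move=> mA; rewrite /Rintegral integral_indic// setIT.
move=> mE; have EG : <<s range Gcap >> E by rewrite -XG'.
apply: (@dynkin_induction _ _ (range Gcap) (fun E => approx \1_E) XG' GI aT _ _ _ E EG).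
- by move=> _ [s _ <-]; exact: approx_Gcap.
- move=> S mS aS; apply: approx_ext (approxB aT aS) => x.
  by rewrite !indicE in_setT in_setC; case: (x \in S); rewrite /= ?subrr ?subr0.
move=> F mF tF aF; have mU : measurable (\bigcup_k F k) by exact: bigcupT_measurable.
apply: approx_lim; first exact: L1_indic.
move=> e e0.
have hs n : approx (fun x => \sum_(k < n) \1_(F k) x) by exact: approx_sum.
have fU := fin_num_measure mu _ mU.
have : (fun n => \sum_(0 <= i < n) mu (F i))%E @ \oo --> (fine (mu (\bigcup_k F k)))%:E.
  by rewrite fineK//; exact: measure_semi_sigma_additive.
move=> /fine_cvg/cvgrPdist_lt/(_ _ e0)[n _ hn].
exists (fun x => \sum_(k < n) \1_(F k) x) => //.
apply: le_lt_trans (hn n (leqnn n)); rewrite /=.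
rewrite big_mkord.
have -> : fine (\sum_(k < n) mu (F k)) = \int[mu]_x (\sum_(k < n) \1_(F k) x).
  rewrite Rintegral_sum; last by move=> k _; exact: L1_indic.
  rewrite -sum_fine; first by apply: eq_bigr => k _; rewrite int_indic.
  by move=> k _; exact: fin_num_measure.
rewrite -int_indic// -RintegralB//; [|exact: L1_indic|by case: (hs n)].
rewrite ger0_norm; last by apply: Rintegral_ge0 => x _; rewrite subr_ge0 disj.
apply: le_Rintegral => //.
- by apply: L1_dist; [exact: L1_indic|case: (hs n)].
- by apply: L1B; [exact: L1_indic|case: (hs n)].
by move=> x _; rewrite ger0_norm// subr_ge0 disj.
Qed.

Import HBSimple.

Lemma L1_approx f : L1 mu f -> approx f.
Proof.
move=> hf; apply: approx_lim => // e e0.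
have [g [gi _ gf]] := approximation_sfun_integrable measurableT hf.
have ag n : approx (g n).
  have fr : finite_set (range (g n)) by [].
  have -> : (g n : X -> R) = (fun x => \sum_(y <- finmap.enum_fset (fset_set (range (g n))))
      y * \1_(g n @^-1` [set y]) x).
    by apply/funext => x; rewrite [LHS]fimfunE fsbig_finite.
  by apply: approx_sum => y; apply: approxZ; exact: approx_indic.
have gd n : L1 mu (fun x => `|f x - g n x|) by apply: L1_dist => //; exact: gi.
have : (fun n => fine (\int[mu]_x `|(f x)%:E - (g n x)%:E|)%E) @ \oo --> (0 : R).
  by apply: fine_cvg; exact: gf.
move=> /cvgrPdist_lt/(_ _ e0)[n _ /(_ n (leqnn n))] /=.
rewrite sub0r normrN ger0_norm; last by rewrite fine_ge0// integral_ge0.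
by exists (g n).
Qed.

End separability.

(** * Measurability of the derivative maps *)

Section measurability_helpers.
Context d (T : measurableType d) (R : realType).

Lemma measurable_bigsum (I : Type) (s : seq I) (P : pred I) (h : I -> T -> R) :
  (forall i, P i -> measurable_fun setT (h i)) ->
  measurable_fun setT (fun x => \sum_(i <- s | P i) h i x).
Proof.
move=> mh; elim: s => [|i s ih].
  by under eq_fun do rewrite big_nil; exact: measurable_cst.
under eq_fun do rewrite big_cons.
by case: (boolP (P i)) => // Pi; apply: measurable_funD => //; exact: mh.
Qed.

Lemma measurable_lt_cst (f : T -> R) (c : R) : measurable_fun setT f ->
  measurable [set x | f x < c].
Proof.
move=> mf; rewrite (_ : [set _ | _] = setT `&` f @^-1` `]-oo, c[%classic).
  by apply: mf => //; exact: measurable_itv.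
by rewrite setTI; apply/seteqP; split => x /=; rewrite in_itv.
Qed.

End measurability_helpers.

Section measurable_Fder.
Context (R : realType) (d p : nat) dX (X : measurableType dX)
  dY (Y : measurableType dY) (mu : {finite_measure set X -> \bar R}) (eps : R)
  (psi : Y -> R) (phi : Y -> X -> R).
Variables (ptheta : 'rV[R]_d -> X -> X -> R) (qtheta : 'rV[R]_d -> Y -> X -> R)
  (th : 'rV[R]_d).
Local Notation rr := (fun (a : midx d p) y x x' => drtheta ptheta qtheta a th y x x').
Hypothesis fm : filter_model mu eps psi phi rr.

Local Notation m0 := (midx0 d p).
Local Notation V := (vmeas X R d p).
Local Notation rder := (rder ptheta qtheta th).
Local Notation sder := (sder mu ptheta qtheta th).
Local Notation fder := (fder mu ptheta qtheta th).
Local Notation Fder := (Fder mu ptheta qtheta th).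
Implicit Types (a b : midx d p).

Lemma measurable_rder a b : measurable_fun setT
  (fun w : (Y * V) * X => rder w.1.1 a w.2 (w.1.2 b)).
Proof.
apply: (@measurable_cintegral _ X R d p _ ((Y * V) * X)%type
  (fun w x' => rr a w.1.1 w.2 x') (fun w => w.1.2) b).
  exact: measurableT_comp measurable_snd measurable_fst.
apply: (measurableT_comp (fm_meas fm a)
  (g := fun w : ((Y * V) * X) * X => (w.1.1.1, (w.1.2, w.2)))).
apply: measurable_fun_pair.
  exact: measurableT_comp measurable_fst (measurableT_comp measurable_fst measurable_fst).
apply: measurable_fun_pair => //.
exact: measurableT_comp measurable_snd measurable_fst.
Qed.

Lemma measurable_likelihood : measurable_fun setT
  (fun w : Y * V => (likelihood mu ptheta qtheta th w.1 w.2)^-1).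
Proof.
have m : measurable_fun setT (fun w : Y * V => likelihood mu ptheta qtheta th w.1 w.2).
  exact: (measurable_Rintegral_fixed mu
    (f := fun (w : Y * V) x => rder w.1 m0 x (w.2 m0)) (measurable_rder m0 m0)).
have := measurableT_comp (@measurable_powR R (-1)) m.
apply: eq_measurable_fun => w _ /=.
by rewrite powR_inv1// ltW// (likelihood_gt0 fm).
Qed.

Lemma measurable_sder a : measurable_fun setT
  (fun w : (Y * V) * X => sder w.1.1 a w.2 w.1.2).
Proof.
rewrite /Defs.sder.
apply: measurable_bigsum => b _.
apply: measurable_funM => //; apply: measurable_funM.
  exact: measurable_rder.
exact: (measurableT_comp measurable_likelihood measurable_fst).
Qed.

Lemma measurable_fder a : measurable_fun setT
  (fun w : (Y * V) * X => fder w.1.1 a w.2 w.1.2).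
Proof.
have [n] := ubnP (mabs a); elim: n a => // n ih a an.
under eq_fun do rewrite fderE.
apply: measurable_funB; first exact: measurable_sder.
apply: measurable_bigsum => b /andP[ba bNa].
apply: measurable_funM.
  apply: measurable_funM => //; apply: ih.
  by rewrite -ltnS (leq_trans _ an)// ltnS mabs_lt.
have m := measurable_Rintegral_fixed mu
  (f := fun (w : Y * V) x => sder w.1 (msub a b) x w.2) (measurable_sder (msub a b)).
exact: (measurableT_comp m measurable_fst).
Qed.

Variable G : nat -> set X.
Hypothesis XG : (measurable : set (set X)) = <<s range G >>.

(** The image of the map consists of vector measures with densities, a
    separable set, so that the preimage of an open set is a countable union of
    sets defined by inequalities between integrals with parameters. *)
Lemma measurable_Fder : measurable_fun setT (fun w : Y * V => Fder w.1 w.2).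
Proof.
apply: (@measurability _ _ _ _ setT _ (@vopen _ X R d p)) => //.
move=> _ [U oU <-]; rewrite setTI.
pose F w a x := fder (w : Y * V).1 a x w.2.
have LF w a : L1 mu (F w a) := L1_fder fm w.1 a w.2.
(* the index of an approximation: one step function for each component *)
pose I := {ffun midx d p -> seq (seq nat * rat)}.
pose near (c : I) (k : nat) (w : Y * V) :=
  forall a, \int[mu]_x `|F w a x - stepf R G (c a) x| < k.+1%:R^-1.
pose good (c : I) (k : nat) := forall w, near c k w -> U (Fder w.1 w.2).
have mnear c k : measurable [set w | near c k w].
  rewrite (_ : [set w | near c k w] = \bigcap_(a in [set: midx d p])
      [set w | \int[mu]_x `|F w a x - stepf R G (c a) x| < k.+1%:R^-1]); last first.
    by apply/seteqP; split => w /= h a => [_|]; [exact: h|apply: h].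
  apply: fin_bigcap_measurable => // a _.
  have mi : measurable_fun setT (fun w => \int[mu]_x `|F w a x - stepf R G (c a) x|).
    apply: (measurable_Rintegral_fixed mu
      (f := fun w x => `|F w a x - stepf R G (c a) x|)).
    apply: measurableT_comp => //; apply: measurable_funB.
      exact: measurable_fder.
    by apply: measurableT_comp => //; exact: L1_meas (L1_stepf mu XG (c a)).
  exact: measurable_lt_cst.
rewrite (_ : _ @^-1` U = \bigcup_(c in [set: I]) \bigcup_(k in [set k | good c k])
    [set w | near c k w]).
  apply: countable_bigcupT_measurable => [|c]; first exact: countableP.
  by apply: bigcup_measurable => k _; exact: mnear.
apply/seteqP; split=> [w /= Uw|w [c _ [k ck nw]]]; last exact: ck.
have [e e0 eU] := oU _ Uw.
pose k := Num.truncn (2 / e).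
have ke : k.+1%:R^-1 + k.+1%:R^-1 < e.
  have : 2 / e < k.+1%:R by rewrite truncnS_gt.
  rewrite ltr_pdivrMr// mulrC -ltr_pdivrMr// => h.
  by rewrite -[X in X + _]mul1r -[X in _ + X]mul1r -mulrDl.
have [c cP] : exists c : I, near c k w.
  have h a : exists L, \int[mu]_x `|F w a x - stepf R G L x| < k.+1%:R^-1.
    by have [_] := L1_approx XG (LF w a); apply; rewrite invr_gt0.
  exists [ffun a => sval (cid (h a))] => a.
  by rewrite ffunE; exact: (svalP (cid (h a))).
exists c => //; exists k => // w' w'P; apply: eU.
rewrite /vdist; apply: bigmax_lt => // a _.
rewrite (tvnorm_csub_density (LF w a) (LF w' a)); last 2 first.
- by move=> B mB; exact: FderE fm _ _ _ _ mB.
- by move=> B mB; exact: FderE fm _ _ _ _ mB.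
have iS := L1_stepf mu XG (c a).
apply: le_lt_trans (L1_dist_tri (LF w a) iS (LF w' a)) _.
apply: lt_trans ke; apply: ltrD; first exact: cP.
by under eq_Rintegral do rewrite distrC; exact: w'P.
Qed.

End measurable_Fder.

(** * Countable generation of the Borel sets of the state space *)

Section countable_generation.
Context (R : realType) (n : nat).

Definition rational_box (m : nat) : set 'rV[R]_n :=
  if unpickle m is Some (q, k) then
    ball (map_mx ratr (q : 'rV[rat]_n) : 'rV[R]_n) ((k : nat).+1%:R^-1) else set0.

Lemma open_rational_box m : open (rational_box m).
Proof.
rewrite /rational_box; case: (unpickle m) => [[q k]|]; last exact: open0.
by apply: ball_open; rewrite invr_gt0.
Qed.

Lemma rational_box_base (U : set 'rV[R]_n) x : open U -> U x ->
  exists2 m, rational_box m x & rational_box m `<=` U.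
Proof.
move=> oU Ux.
have /nbhs_ballP[e /= e0 eU] : nbhs x U by exact: open_nbhs_nbhs.
pose k := Num.truncn (2 / e); pose c : R := k.+1%:R^-1.
have c0 : 0 < c by rewrite invr_gt0.
have ce : c + c < e.
  have : 2 / e < k.+1%:R by rewrite truncnS_gt.
  rewrite ltr_pdivrMr// mulrC -ltr_pdivrMr// => h.
  by rewrite /c -[X in X + _]mul1r -[X in _ + X]mul1r -mulrDl.
have qx j : exists q : rat, `|ratr q - x 0 j| < c.
  have /rat_in_itvoo[q] : x 0 j - c < x 0 j + c by rewrite ltrD2l gtrN.
  by rewrite in_itv/= => /andP[h1 h2]; exists q; rewrite ltr_distl h1.
pose q : 'rV[rat]_n := \row_j sval (cid (qx j)).
have qP i j : ball ((map_mx ratr q : 'rV[R]_n) i j) c (x i j).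
  by rewrite /ball/= !mxE ord1; exact: (svalP (cid (qx j))).
exists (pickle (q, k)).
  by rewrite /rational_box pickleK; split.
rewrite /rational_box pickleK => y qy; apply: eU.
apply: le_ball (ltW ce) _ _; apply: ball_triangle qy.
by apply: ball_sym; split.
Qed.

Lemma open_generated : <<s @open 'rV[R]_n >> = <<s range rational_box >>.
Proof.
apply/seteqP; split.
  apply: smallest_sub; first exact: smallest_sigma_algebra.
  move=> U oU.
  rewrite (_ : U = \bigcup_m (if `[< rational_box m `<=` U >]
      then rational_box m else set0)).
    apply: sigma_algebra_bigcup => m; case: ifP => _.
      by apply: sub_sigma_algebra; exists m.
    exact: sigma_algebra0.
  apply/seteqP; split=> [x Ux|x [m _]].
    have [m mx mU] := rational_box_base oU Ux.
    by exists m => //; rewrite asboolT.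
  by case: ifPn => // /asboolP; apply.
apply: sub_sigma_algebra2 => _ [m _ <-]; exact: open_rational_box.
Qed.

(** The sigma-algebra of a subspace consists of the traces of Borel sets, and
    traces of generators generate it. *)
Lemma subRn_generated (A : set (borelRn R n)) (A0 : A !=set0) :
  exists G : nat -> set (subRn A0),
    (measurable : set (set (subRn A0))) = <<s range G >>.
Proof.
exists (fun m => @subRn_val R n A A0 @^-1` rational_box m).
transitivity (preimage_set_system setT (@subRn_val R n A A0) <<s @open 'rV[R]_n >>).
  by [].
rewrite open_generated.
rewrite -[in LHS](@g_sigma_preimageE _ (borelRn R n)).
congr (<<s _ >>); apply/seteqP; split.
  by move=> _ [_ [m _ <-] <-]; exists m => //; rewrite setTI.
by move=> _ [m _ <-]; exists (rational_box m); rewrite ?setTI//; exists m.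
Qed.

End countable_generation.

(** * Measurability of derivatives with respect to a parameter *)

Section parameter_derivatives.
Context (R : realType) (d : nat) dW (W : measurableType dW).
Variables (D : set 'rV[R]_d).
Hypothesis oD : open D.
Implicit Types g h : 'rV[R]_d -> W -> R.

Definition pder (i : 'I_d) g : 'rV[R]_d -> W -> R :=
  fun th w => partial i (g ^~ w) th.

(** Only directional derivatives are recorded, because unlike differentiability
    these can be compared for functions that agree on [D]. *)
Fixpoint smooth_meas (n : nat) g : Prop :=
  (forall th, D th -> measurable_fun setT (g th)) /\
  if n is m.+1 then
    forall i, (forall th w, D th -> derivable (g ^~ w) th (delta_mx 0 i)) /\
      smooth_meas m (pder i g)
  else True.

Lemma smooth_meas0 n g : smooth_meas n g ->
  forall th, D th -> measurable_fun setT (g th).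
Proof. by case: n => [|n] []. Qed.

Lemma near_D th : D th -> \forall t \near th, D t.
Proof. by move=> Dth; apply: open_nbhs_nbhs; split. Qed.

Lemma smooth_meas_ext n g h : (forall th w, D th -> g th w = h th w) ->
  smooth_meas n g -> smooth_meas n h.
Proof.
elim: n g h => [|n ih] g h gh [mg gn]; split => //.
- by move=> th Dth; apply: eq_measurable_fun (mg th Dth) => w _; exact: gh.
- by move=> th Dth; apply: eq_measurable_fun (mg th Dth) => w _; exact: gh.
move=> i; have [dg sg] := gn i.
have nE th w : D th -> \near th, g th w = h th w.
  by move=> /near_D; apply: filterS => t; exact: gh.
split=> [th w Dth|]; first exact: near_eq_derivable (nE _ _ Dth) (dg _ _ Dth).
by apply: ih sg => th w Dth; exact: near_eq_derive (nE _ _ Dth).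
Qed.

Lemma smooth_measS n g : smooth_meas n.+1 g -> smooth_meas n g.
Proof.
elim: n g => [|n ih] g [mg gn]; first by split.
split => // i; have [dg sg] := gn i; split => //; exact: ih.
Qed.

Lemma smooth_measD n g h : smooth_meas n g -> smooth_meas n h ->
  smooth_meas n (fun th w => g th w + h th w).
Proof.
elim: n g h => [|n ih] g h [mg gn] [mh hn]; split => //.
- by move=> th Dth; apply: measurable_funD; [exact: mg|exact: mh].
- by move=> th Dth; apply: measurable_funD; [exact: mg|exact: mh].
move=> i; have [dg sg] := gn i; have [dh sh] := hn i; split.
  by move=> th w Dth; apply: derivableD; [exact: dg|exact: dh].
apply: smooth_meas_ext (ih _ _ sg sh) => th w Dth.
by rewrite /pder /partial [RHS]deriveD//; [exact: dg|exact: dh].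
Qed.

Lemma smooth_measM n g h : smooth_meas n g -> smooth_meas n h ->
  smooth_meas n (fun th w => g th w * h th w).
Proof.
elim: n g h => [|n ih] g h Sg Sh.
  split=> // th Dth; apply: measurable_funM; first exact: smooth_meas0 Sg _ Dth.
  exact: smooth_meas0 Sh _ Dth.
have [mg gn] := Sg; have [mh hn] := Sh; split.
  by move=> th Dth; apply: measurable_funM; [exact: mg|exact: mh].
move=> i; have [dg sg] := gn i; have [dh sh] := hn i; split.
  by move=> th w Dth; apply: derivableM; [exact: dg|exact: dh].
have S1 := ih _ _ (smooth_measS Sg) sh; have S2 := ih _ _ sg (smooth_measS Sh).
apply: smooth_meas_ext (smooth_measD S1 S2) => th w Dth.
rewrite /pder /partial [RHS]deriveM; last 2 first.
- exact: dg.
- exact: dh.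
by congr (_ + _); rewrite mulrC.
Qed.

(** A derivative is a limit of difference quotients, and for points of the
    open set [D] the increments eventually stay in [D]. *)
Lemma measurable_pder i g th :
  (forall t, D t -> measurable_fun setT (g t)) ->
  D th -> (forall w, derivable (g ^~ w) th (delta_mx 0 i)) ->
  measurable_fun setT (pder i g th).
Proof.
move=> mg Dth dg.
pose e : 'rV[R]_d := delta_mx 0 i.
pose u (k : nat) : R := harmonic k.
pose t k : 'rV[R]_d := u k *: e + th.
pose h k w := if `[< D (t k) >] then (u k)^-1 * (g (t k) w - g th w) else 0.
apply: (@measurable_fun_cvg _ _ _ _ h) => [k|w _].
  rewrite /h; case: asboolP => Dt //.
  by apply: measurable_funM => //; apply: measurable_funB; exact: mg.
have u0 : u k @[k --> \oo] --> 0 := cvg_harmonic.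
have uN0 k : u k != 0 by rewrite /u/= invr_eq0 pnatr_eq0.
have cu := (cvgr_dnbhsP _ _ _).1 (dg w) u (conj uN0 u0).
apply: cvg_trans cu; apply: near_eq_cvg.
have tth : t k @[k --> \oo] --> th.
  have c : u k *: e + th @[k --> \oo] --> (0 : R) *: e + th.
    by apply: cvgD; [apply: cvgZr_tmp|exact: cvg_cst].
  by rewrite scale0r add0r in c.
have nD : \forall k \near \oo, D (t k) by exact: tth _ (near_D Dth).
near=> k; rewrite /h asboolT; last by near: k.
by rewrite /t /=.
Unshelve. all: by end_near. Qed.

Lemma ntimes_differentiable_smooth n g :
  (forall th, D th -> measurable_fun setT (g th)) ->
  (forall w, ntimes_differentiable n D (g ^~ w)) -> smooth_meas n g.
Proof.
elim: n g => [|n ih] g mg dg //=; split => // i.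
have di th w : D th -> derivable (g ^~ w) th (delta_mx 0 i).
  by move=> Dth; apply: diff_derivable; have [dgw _] := dg w; exact: dgw.
split => //; apply: ih => [th Dth|w]; last by have [_ h] := dg w; exact: h.
by apply: measurable_pder => // w; exact: di.
Qed.

Lemma smooth_meas_iter i k n g : smooth_meas (k + n) g ->
  smooth_meas n (fun th w => iter k (partial i) (g ^~ w) th).
Proof.
elim: k g => [|k ih] g //= Sg; have [_ /(_ i)[_ /ih]] := Sg.
by apply: smooth_meas_ext => th w _; rewrite -iterS iterSr.
Qed.

(** Every partial derivative that occurs uses up one order of smoothness. *)
Lemma measurable_mpartial p (a : midx d p) g th : D th -> smooth_meas p g ->
  measurable_fun setT (fun w => mpartial a (g ^~ w) th).
Proof.
move=> Dth Sg; rewrite /mpartial.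
have : (\sum_(i <- enum 'I_d) mval a i <= p)%N.
  by rewrite big_enum; exact: mabs_le_p.
move=> /subnKC; move: (p - _)%N => n; rewrite addnC => ap.
have {Sg} : smooth_meas (n + \sum_(i <- enum 'I_d) mval a i) g by rewrite ap.
move=> Sg.
suff S : smooth_meas n (fun th w =>
    foldr (fun i f => iter (mval a i) (partial i) f) (g ^~ w) (enum 'I_d) th).
  exact: smooth_meas0 S _ Dth.
move: Sg; elim: (enum 'I_d) n {ap} => [|i l ih] n.
  by rewrite big_nil addn0.
rewrite big_cons addnA => /ih Sg /=; apply: smooth_meas_iter.
by rewrite addnC.
Qed.

End parameter_derivatives.

Lemma mpartial0 (R : realType) (d p : nat) (g : 'rV[R]_d -> R) :
  mpartial (midx0 d p) g = g.
Proof.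
rewrite /mpartial; elim: (enum 'I_d) => //= i l ->.
by rewrite mval0.
Qed.

(** * Derivatives of the transition densities *)

Section model_of_conditions.
Context (R : realType) (d p : nat) dX (X : measurableType dX)
  dY (Y : measurableType dY) (mu : {finite_measure set X -> \bar R}) (eps : R)
  (psi : Y -> R) (phi : Y -> X -> R) (Theta : set 'rV[R]_d).
Variables (ptheta : 'rV[R]_d -> X -> X -> R) (qtheta : 'rV[R]_d -> Y -> X -> R).
Hypotheses (oT : open Theta)
  (ptheta_ge0 : forall th x' x, Theta th -> 0 <= ptheta th x' x)
  (qtheta_ge0 : forall th y x, Theta th -> 0 <= qtheta th y x)
  (mptheta : forall th, Theta th ->
      measurable_fun [set: X * X] (fun w : X * X => ptheta th w.1 w.2))
  (mqtheta : forall th, Theta th ->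
      measurable_fun [set: Y * X] (fun w : Y * X => qtheta th w.1 w.2))
  (dptheta : forall x' x,
      ntimes_differentiable p Theta (fun th => ptheta th x' x))
  (dqtheta : forall y x,
      ntimes_differentiable p Theta (fun th => qtheta th y x)).

Lemma measurable_drtheta th (a : midx d p) : Theta th -> measurable_fun setT
  (fun z : Y * (X * X) => drtheta ptheta qtheta a th z.1 z.2.1 z.2.2).
Proof.
move=> Tth.
apply: (@measurable_mpartial _ _ _ (Y * (X * X))%type Theta oT p a
  (fun t z => rtheta ptheta qtheta t z.1 z.2.1 z.2.2)) => //.
have mq t : Theta t -> measurable_fun setT
    (fun z : Y * (X * X) => qtheta t z.1 z.2.1).
  move=> Tt; apply: (measurableT_comp (mqtheta Tt)
    (g := fun z : Y * (X * X) => (z.1, z.2.1))).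
  apply: measurable_fun_pair => //.
  exact: measurableT_comp measurable_fst measurable_snd.
have mp t : Theta t -> measurable_fun setT
    (fun z : Y * (X * X) => ptheta t z.2.1 z.2.2).
  move=> Tt; apply: (measurableT_comp (mptheta Tt)
    (g := fun z : Y * (X * X) => (z.2.1, z.2.2))).
  apply: measurable_fun_pair.
    exact: measurableT_comp measurable_fst measurable_snd.
  exact: measurableT_comp measurable_snd measurable_snd.
have Sq : smooth_meas Theta p (fun t (z : Y * (X * X)) => qtheta t z.1 z.2.1).
  by apply: ntimes_differentiable_smooth => // w; exact: dqtheta.
have Sp : smooth_meas Theta p (fun t (z : Y * (X * X)) => ptheta t z.2.1 z.2.2).
  by apply: ntimes_differentiable_smooth => // w; exact: dptheta.
exact: smooth_measM Sq Sp.
Qed.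

Lemma filter_model_of_conditions th : Theta th -> 0 < eps < 1 ->
  (forall y, exists m : {measure set X -> \bar R},
    (0 < m setT < +oo)%E /\ forall x B, measurable B ->
    (eps%:E * m B <= \int[mu]_(x' in B) (rtheta ptheta qtheta th y x' x)%:E
      <= m B * (eps^-1)%:E)%E) ->
  (forall y, 1 <= psi y) ->
  (forall x x' y (a : midx d p), a != midx0 d p ->
      `|drtheta ptheta qtheta a th y x' x| <=
      psi y ^+ mabs a * rtheta ptheta qtheta th y x' x) ->
  (forall x x' y, rtheta ptheta qtheta th y x' x <= phi y x') ->
  filter_model mu eps psi phi
    (fun (a : midx d p) y x x' => drtheta ptheta qtheta a th y x x').
Proof.
move=> Tth e01 c1 psi1 c2 c3.
have r0 y x x' : drtheta ptheta qtheta (midx0 d p) th y x x' =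
    rtheta ptheta qtheta th y x x' by rewrite /drtheta mpartial0.
split => //.
- by move=> a; exact: measurable_drtheta.
- by move=> y x x'; rewrite r0 mulr_ge0// ?qtheta_ge0 ?ptheta_ge0.
- move=> a y x x'; have [->|a0] := eqVneq a (midx0 d p).
    by rewrite mabs0 expr0 mul1r r0 ger0_norm// mulr_ge0// ?qtheta_ge0 ?ptheta_ge0.
  by rewrite r0; exact: c2.
- by move=> y x x'; rewrite r0.
move=> y; have [m [m0 mP]] := c1 y; exists m; split => // x B mB.
by under eq_integral do rewrite r0; exact: mP.
Qed.

End model_of_conditions.

Section as_finite_measure.
Context d (T : measurableType d) (R : realType).

Definition as_finite (m : {measure set T -> \bar R})
  of (m setT < +oo)%E : set T -> \bar R := m.

Variables (m : {measure set T -> \bar R}) (mfin : (m setT < +oo)%E).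

HB.instance Definition _ := isMeasure.Build _ _ _ (as_finite mfin)
  (measure0 m) (measure_ge0 m) (@measure_semi_sigma_additive _ _ _ m).

Let fin : fin_num_fun (as_finite mfin).
Proof. exact: lty_fin_num_fun. Qed.

HB.instance Definition _ := Measure_isFinite.Build _ _ _ (as_finite mfin) fin.

Lemma finite_measure_of : exists m' : {finite_measure set T -> \bar R},
  (m' : {measure set T -> \bar R}) = m.
Proof. by exists (as_finite mfin); exact: eq_measure. Qed.

End as_finite_measure.

(** * The joint kernel of signal and observation *)

Section kernel_composition.
Context d1 d2 d3 (X : measurableType d1) (Y : measurableType d2)
  (Z : measurableType d3) (R : realType).

Definition kernel_pre (k : R.-pker Y ~> Z) (f : X -> Y)
    (mf : measurable_fun setT f) : X -> {measure set Z -> \bar R} :=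
  fun x => k (f x).

Section pre.
Variables (k : R.-pker Y ~> Z) (f : X -> Y) (mf : measurable_fun setT f).

Let mpre U : measurable U -> measurable_fun setT (kernel_pre k mf ^~ U).
Proof. by move=> mU; exact: measurableT_comp (measurable_kernel k U mU) mf. Qed.

HB.instance Definition _ := isKernel.Build _ _ X Z R (kernel_pre k mf) mpre.

Let pre1 x : kernel_pre k mf x setT = 1%E.
Proof. exact: prob_kernel. Qed.

HB.instance Definition _ :=
  Kernel_isProbability.Build _ _ X Z R (kernel_pre k mf) pre1.

End pre.

Definition kernel_comp (l : R.-pker X ~> Y) (k : R.-pker (X * Y) ~> Z) :
  X -> {measure set Z -> \bar R} := (l \; k)%E.

Section comp.
Variables (l : R.-pker X ~> Y) (k : R.-pker (X * Y) ~> Z).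

Let mcomp U : measurable U -> measurable_fun setT (kernel_comp l k ^~ U).
Proof. by move=> mU; exact: measurable_fun_mkcomp_sfinite. Qed.

HB.instance Definition _ := isKernel.Build _ _ X Z R (kernel_comp l k) mcomp.

Let comp1 x : kernel_comp l k x setT = 1%E.
Proof.
rewrite /kernel_comp /= /kcomp.
under eq_integral do rewrite prob_kernel.
by rewrite integral_cst// mul1e prob_kernel.
Qed.

HB.instance Definition _ :=
  Kernel_isProbability.Build _ _ X Z R (kernel_comp l k) comp1.

End comp.
End kernel_composition.

Section signal_kernel.
Context dX (X : measurableType dX) dY (Y : measurableType dY) (R : realType).
Variables (P : R.-pker X ~> X) (Q : R.-pker X ~> Y).

Let mkpair : measurable_fun setT (fun w : (X * X) * Y => (w.1.2, w.2)).
Proof.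
apply: measurable_fun_pair => //.
exact: measurableT_comp measurable_snd measurable_fst.
Qed.

(** The law of the next state and the next observation. *)
Definition signal : R.-pker X ~> (X * Y)%type :=
  kernel_comp P (kernel_comp (kernel_pre Q (@measurable_snd _ _ X X))
    (kdirac mkpair)).

Lemma ge0_integral_signal x (f : X * Y -> \bar R) : (forall t, 0 <= f t)%E ->
  measurable_fun setT f ->
  (\int[signal x]_t f t = \int[P x]_x' \int[Q x']_y' f (x', y'))%E.
Proof.
move=> f0 mf; rewrite /signal /kernel_comp /= integral_kcomp//.
apply: eq_integral => x' _; rewrite integral_kcomp//.
apply: eq_integral => y' _.
rewrite /kdirac integral_dirac// diracT mul1e//.
Qed.

End signal_kernel.

Section kernel_powers.
Context d (T : measurableType d) (R : realType) (K : R.-pker T ~> T).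

Fixpoint kernel_pow (n : nat) : R.-pker T ~> T :=
  if n is m.+1 then
    kernel_comp K (kernel_pre (kernel_pow m) (@measurable_snd _ _ T T))
  else kdirac (@measurable_id _ T setT).

Local Notation k := (fun x => K x : set T -> \bar R).

Lemma kernel_powE n x : nstep k n x = kernel_pow n x.
Proof.
elim: n x => [|n ih] x; apply/funext => B //=.
by apply: eq_integral => x' _; rewrite ih.
Qed.

Lemma integral_nstep0 x (f : T -> \bar R) : measurable_fun setT f ->
  (\int[nstep k 0 x]_x' f x' = f x)%E.
Proof. by move=> mf; rewrite integral_dirac// diracT mul1e. Qed.

Lemma ge0_integral_nstepS n x (f : T -> \bar R) : (forall t, 0 <= f t)%E ->
  measurable_fun setT f ->
  (\int[nstep k n.+1 x]_x' f x' = \int[K x]_x' \int[nstep k n x']_x'' f x'')%E.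
Proof.
move=> f0 mf; rewrite kernel_powE /= integral_kcomp//.
by apply: eq_integral => x' _; rewrite kernel_powE.
Qed.

End kernel_powers.

Section signal_image.
Context dX (X : measurableType dX) dY (Y : measurableType dY)
  dZ (Z : measurableType dZ) (R : realType).
Variables (P : R.-pker X ~> X) (Q : R.-pker X ~> Y) (e : Z -> X)
  (g : Z -> X -> Y -> Z).
Hypotheses (me : measurable_fun setT e)
  (mg : measurable_fun setT (fun w : (Z * X) * Y => g w.1.1 w.1.2 w.2)).

(** The kernel that moves [z] to the image under [g z] of the next signal from
    the state [e z]. *)
Definition signal_image : R.-pker Z ~> Z :=
  kernel_comp (kernel_pre P me) (kernel_comp
    (kernel_pre Q (@measurable_snd _ _ Z X)) (kdirac mg)).

Lemma ge0_integral_signal_image z (f : Z -> \bar R) : (forall z, 0 <= f z)%E ->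
  measurable_fun setT f ->
  (\int[signal_image z]_z' f z' = \int[signal P Q (e z)]_t f (g z t.1 t.2))%E.
Proof.
move=> f0 mf; rewrite ge0_integral_signal//=; last first.
  apply: (measurableT_comp mf (g := fun t => g z t.1 t.2)).
  apply: (measurableT_comp mg (g := fun t : X * Y => ((z, t.1), t.2))).
  by do 2?[apply: measurable_fun_pair => //]; exact: measurable_cst.
rewrite integral_kcomp//; apply: eq_integral => x' _; rewrite integral_kcomp//.
by apply: eq_integral => y' _; rewrite /kdirac integral_dirac// diracT mul1e.
Qed.

End signal_image.

(** * Iterates of the averaging operator *)

Lemma Rintegral_bound d (T : measurableType d) (R : realType)
    (m : {measure set T -> \bar R}) (f : T -> R) (c : R) :
  measurable_fun setT f -> (\int[m]_t `|(f t)%:E| <= c%:E)%E ->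
  m.-integrable setT (EFin \o f) /\ `|\int[m]_t f t| <= c.
Proof.
move=> mf fc.
have if_ : m.-integrable setT (EFin \o f).
  apply/integrableP; split; first exact/measurable_EFinP.
  by apply: le_lt_trans fc _; rewrite ltry.
split => //; apply: le_trans (le_normr_Rintegral measurableT if_) _.
rewrite -lee_fin /Rintegral fineK//.
rewrite ge0_fin_numE; last exact: integral_ge0.
by apply: le_lt_trans fc _; rewrite ltry.
Qed.

Section averaging.
Context dX (X : measurableType dX) dY (Y : measurableType dY)
  dV (V : measurableType dV) (R : realType).
Variables (S : R.-pker X ~> (X * Y)%type) (F : Y -> V -> V).
Variables (psi : Y -> R) (s L0 g : R) (sc : R -> V -> Prop).
Hypotheses (mF : measurable_fun setT (fun w : Y * V => F w.1 w.2))
  (psi_ge1 : forall y, 1 <= psi y) (mpsi : measurable_fun setT psi)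
  (s_ge0 : 0 <= s) (L0_ge0 : 0 <= L0)
  (psiL0 : forall x, (\int[S x]_t (psi t.2 `^ s)%:E <= L0%:E)%E)
  (g_ge1 : 1 <= g) (sc_ex : forall v, exists2 M, 1 <= M & sc M v)
  (sc_F : forall M v ys, 1 <= M -> sc M v -> all (fun y => psi y <= M) ys ->
     sc (g * M) (foldl (fun v y => F y v) v ys))
  (sc_le : forall M M' v, 1 <= M <= M' -> sc M v -> sc M' v).

Local Notation Fs := (foldl (fun v y => F y v)).
Local Notation w y := (psi y `^ s).
Implicit Types (h : X * V -> R) (f : X * Y -> R).

Let mw : measurable_fun setT (fun t : X * Y => w t.2).
Proof.
exact: (measurableT_comp (measurable_powR s) (measurableT_comp mpsi measurable_snd)).
Qed.

Lemma signal_bound x f (a b : R) : measurable_fun setT f -> 0 <= a -> 0 <= b ->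
  (forall t, `|f t| <= a + b * w t.2) ->
  (S x).-integrable setT (EFin \o f) /\ `|\int[S x]_t f t| <= a + b * L0.
Proof.
move=> mf a0 b0 fab.
apply: Rintegral_bound => //.
have mEw : measurable_fun setT (fun t : X * Y => b%:E * (w t.2)%:E)%E.
  by apply: emeasurable_funM => //; exact/measurable_EFinP.
apply: (@le_trans _ _ (\int[S x]_t (a%:E + b%:E * (w t.2)%:E))%E).
  apply: ge0_le_integral => //.
  - by apply: measurableT_comp => //; exact/measurable_EFinP.
  - exact: emeasurable_funD.
  - by move=> t _; rewrite -EFinM -EFinD lee_fin.
rewrite ge0_integralD//.
- rewrite integral_cst// prob_kernel mule1 ge0_integralZl//.
  + by rewrite EFinD EFinM leeD2l// lee_wpmul2l.
  + exact/measurable_EFinP.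
  + by move=> t _; rewrite lee_fin powR_ge0.
- by move=> t _; rewrite mule_ge0// lee_fin ?powR_ge0.
Qed.

Lemma weight_ge1 M : 1 <= M -> 1 <= M `^ s.
Proof. by move=> M1; rewrite -(powRr0 M) ler_powR. Qed.

Definition averaged h : X * V -> R :=
  fun u => \int[S u.1]_t h (t.1, F t.2 u.2).

(** The growth class that averaging preserves, and for which the averages are
    finite. *)
Definition tame h := measurable_fun setT h /\
  exists2 C, 0 <= C & forall x v M, 1 <= M -> sc M v -> `|h (x, v)| <= C * M `^ s.

Lemma measurable_signal_image h v : measurable_fun setT h ->
  measurable_fun setT (fun t : X * Y => h (t.1, F t.2 v)).
Proof.
move=> mh; apply: (measurableT_comp mh (g := fun t : X * Y => (t.1, F t.2 v))).
apply: measurable_fun_pair => //.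
apply: (measurableT_comp mF (g := fun t : X * Y => (t.2, v))).
by apply: measurable_fun_pair => //; exact: measurable_cst.
Qed.

Lemma powR_max M y : 1 <= M -> (Num.max M (psi y)) `^ s <= M `^ s + w y.
Proof.
by move=> M1; rewrite /Num.max; case: ifP => _; rewrite ?lerDl ?lerDr powR_ge0.
Qed.

Lemma sc_image v M y : 1 <= M -> sc M v -> sc (g * Num.max M (psi y)) (F y v).
Proof.
move=> M1 Mv; have m1 : 1 <= Num.max M (psi y) by rewrite le_max M1.
apply: (sc_F (ys := [:: y]) m1) => /=; last by rewrite andbT le_max lexx orbT.
by apply: sc_le Mv; rewrite M1 le_max lexx.
Qed.

Lemma growth_image (C : R) h v M (t : X * Y) : 0 <= C ->
  (forall x v M, 1 <= M -> sc M v -> `|h (x, v)| <= C * M `^ s) ->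
  1 <= M -> sc M v ->
  `|h (t.1, F t.2 v)| <= C * g `^ s * M `^ s + C * g `^ s * w t.2.
Proof.
move=> C0 hC M1 Mv; have m1 : 1 <= Num.max M (psi t.2) by rewrite le_max M1.
have g0 : 0 <= g by exact: le_trans g_ge1.
apply: le_trans (hC _ _ (g * Num.max M (psi t.2)) _ (sc_image _ _ _)) _ => //.
  by rewrite mulr_ege1.
rewrite powRM// ?(le_trans _ m1)// mulrA -mulrDr ler_wpM2l//.
  by rewrite mulr_ge0 ?powR_ge0.
exact: powR_max.
Qed.

Lemma tame_integrable h x v : tame h ->
  (S x).-integrable setT (EFin \o fun t => h (t.1, F t.2 v)).
Proof.
move=> th; have [M M1 Mv] := sc_ex v; have [mh [C C0 hC]] := th.
have [] // := @signal_bound x (fun t => h (t.1, F t.2 v))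
  (C * g `^ s * M `^ s) (C * g `^ s) => //.
- exact: measurable_signal_image.
- by rewrite !mulr_ge0 ?powR_ge0.
- by rewrite !mulr_ge0 ?powR_ge0.
- by move=> t; exact: growth_image.
Qed.

Lemma tame_averaged h : tame h -> tame (averaged h).
Proof.
move=> th; have [mh [C C0 hC]] := th; split.
  apply: (@measurable_Rintegral_param _ _ _ _ _ (fun u : X * V => S u.1) _ _
    (fun u t => h (t.1, F t.2 u.2))).
  - by move=> B mB; exact: measurableT_comp (measurable_kernel S B mB) measurable_fst.
  - by move=> u; rewrite prob_kernel ltry.
  apply: (measurableT_comp mh
    (g := fun w : (X * V) * (X * Y) => (w.2.1, F w.2.2 w.1.2))).
  apply: measurable_fun_pair; first exact: measurableT_comp measurable_fst measurable_snd.
  apply: (measurableT_comp mF (g := fun w : (X * V) * (X * Y) => (w.2.2, w.1.2))).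
  apply: measurable_fun_pair; first exact: measurableT_comp measurable_snd measurable_snd.
  exact: measurableT_comp measurable_snd measurable_fst.
exists (C * g `^ s * (1 + L0)); first by rewrite !mulr_ge0 ?powR_ge0 ?addr_ge0.
move=> x v M M1 Mv.
have [||||_ le] := @signal_bound x (fun t => h (t.1, F t.2 v))
  (C * g `^ s * M `^ s) (C * g `^ s).
- exact: measurable_signal_image.
- by rewrite !mulr_ge0 ?powR_ge0.
- by rewrite !mulr_ge0 ?powR_ge0.
- by move=> t; exact: growth_image.
apply: le_trans le _; rewrite -mulrDr -mulrA ler_wpM2l ?mulr_ge0 ?powR_ge0//.
by rewrite mulrDl mul1r lerD2l ler_peMr// weight_ge1.
Qed.

Lemma tame_iter m h : tame h -> tame (iter m averaged h).
Proof. by move=> th; elim: m => //= m ih; exact: tame_averaged. Qed.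

(** Two chains driven by the same observations are compared along every
    sequence of observations, and the weights of these are averaged. *)
Lemma iter_averaged_diff m h h' v v' (c A : R) : tame h -> tame h' -> 0 <= c -> 0 <= A ->
  (forall x ys, size ys = m ->
    `|h (x, Fs v ys) - h' (x, Fs v' ys)| <= c * (A + \sum_(y <- ys) w y)) ->
  forall x, `|iter m averaged h (x, v) - iter m averaged h' (x, v')| <=
    c * (A + m%:R * L0).
Proof.
move=> th th' c0; elim: m v v' A => [|m ih] v v' A A0 H x.
  by have := H x [::] erefl; rewrite big_nil mul0r.
have I := tame_integrable x v (tame_iter m th).
have I' := tame_integrable x v' (tame_iter m th').
rewrite /= {1 3}/averaged -RintegralB//.
have [||||_ le] := @signal_bound x (fun t => iter m averaged h (t.1, F t.2 v) -
  iter m averaged h' (t.1, F t.2 v')) (c * (A + m%:R * L0)) c => //.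
- by apply: measurable_funB; apply: measurable_signal_image;
    [case: (tame_iter m th)|case: (tame_iter m th')].
- by rewrite mulr_ge0// addr_ge0// mulr_ge0.
- move=> t; rewrite -mulrDr addrAC; apply: ih => [|x' ys ysm].
    by rewrite addr_ge0 ?powR_ge0.
  have := H x' (t.2 :: ys); rewrite /= ysm big_cons addrA; exact.
by apply: le_trans le _; rewrite -mulrDr -[m.+1]addn1 natrD mulrDl mul1r addrA.
Qed.

End averaging.

(** * Integrals of bounded functions *)

(** If two measures are uniformly close on sets, the two parts of the Jordan
    decomposition of their difference have small mass. *)
Lemma Rintegral_setwise_close d (T : measurableType d) (R : realType)
    (m m' : {finite_measure set T -> \bar R}) (f : T -> R) (C k : R) :
  (forall B, measurable B -> (`|m B - m' B| <= k%:E)%E) ->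
  measurable_fun setT f -> (forall x, `|f x| <= C) ->
  `|\int[m]_x f x - \int[m']_x f x| <= k * C + k * C.
Proof.
move=> mk mf fC.
pose nu : {charge set T -> \bar R} := csub (charge_of_finite_measure m)
  (charge_of_finite_measure m').
have nuE B : nu B = (m B - m' B)%E by [].
have bf : bmeas f by split => //; exists C.
pose Pn := (projT1 (cid (hahn_pair_ex nu))).1.
pose Nn := (projT1 (cid (hahn_pair_ex nu))).2.
have mPn : measurable Pn by have [[]] := hahn_pairP nu.
have mNn : measurable Nn by have [_ []] := hahn_pairP nu.
have cP : (cpos nu setT <= k%:E)%E.
  have -> : cpos nu setT = nu (setT `&` Pn).
    by rewrite /cpos/= jordan_posE cjordan_posE /crestr0 mem_set.
  apply: le_trans (lee_abs _) _; by apply: mk; rewrite setTI.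
have cN : (cneg nu setT <= k%:E)%E.
  have -> : cneg nu setT = (- nu (setT `&` Nn))%E.
    by rewrite /cneg/= jordan_negE cjordan_negE /crestr0 mem_set.
  apply: le_trans (lee_abs _) _; rewrite abseN; by apply: mk; rewrite setTI.
have bound (n : {finite_measure set T -> \bar R}) : (n setT <= k%:E)%E ->
    `|\int[n]_x f x| <= k * C.
  move=> nk; have C0 : 0 <= C by apply: le_trans (fC point).
  have [] // := @Rintegral_bound _ _ _ n f (k * C) mf _.
  apply: (@le_trans _ _ (\int[n]_x C%:E)%E).
    apply: ge0_le_integral => //.
    - by apply: measurableT_comp => //; exact/measurable_EFinP.
    - by move=> x _; rewrite lee_fin.
  by rewrite integral_cst// muleC EFinM lee_wpmul2r.
have -> : \int[m]_x f x - \int[m']_x f x = \int[cpos nu]_x f x - \int[cneg nu]_x f x.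
  apply/eqP; rewrite subr_eq addrAC eq_sym subr_eq eq_sym; apply/eqP.
  rewrite [RHS]addrC; apply: Rintegral_measure_addC => // B mB.
  have := charge_decomp nu mB; rewrite nuE.
  have F (n : {finite_measure set T -> \bar R}) : (fine (n B))%:E = n B.
    by rewrite fineK// fin_num_measure.
  rewrite -(F m) -(F m') -(F (cpos nu)) -(F (cneg nu)) -!EFinB -!EFinD => -[h].
  by congr EFin; lra.
by apply: le_trans (ler_normB _ _) _; apply: lerD; exact: bound.
Qed.

Section probability_mixtures.
Context d (T : measurableType d) (R : realType).

Lemma bounded_prob_integrable (m : {measure set T -> \bar R}) (f : T -> R) (C : R) :
  m setT = 1%E -> measurable_fun setT f -> (forall x, `|f x| <= C) ->
  m.-integrable setT (EFin \o f) /\ `|\int[m]_x f x| <= C.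
Proof.
move=> m1 mf fC; apply: Rintegral_bound => //.
have C0 : 0 <= C by apply: le_trans (fC point).
apply: (@le_trans _ _ (\int[m]_x C%:E)%E); last by rewrite integral_cst// m1 mule1.
apply: ge0_le_integral => //.
- by apply: measurableT_comp => //; exact/measurable_EFinP.
- by move=> x _; rewrite lee_fin.
Qed.

Lemma Rintegral_shift (m : {measure set T -> \bar R}) (f : T -> R) (C : R) :
  m setT = 1%E -> measurable_fun setT f -> (forall x, `|f x| <= C) ->
  (\int[m]_x (f x + C)%:E = (\int[m]_x f x + C)%:E)%E.
Proof.
move=> m1 mf fC; have [if_ _] := bounded_prob_integrable m1 mf fC.
have iC : m.-integrable setT (EFin \o cst C).
  by have [] // := @bounded_prob_integrable m (cst C) `|C| m1.
under eq_integral do rewrite EFinD.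
rewrite integralD// EFinD /Rintegral fineK ?integrable_fin_num//.
by rewrite integral_cst// m1 mule1.
Qed.

End probability_mixtures.

(** Adding a constant reduces this to nonnegative functions. *)
Lemma Rintegral_mixture d (T : measurableType d) d' (Z : measurableType d')
    (R : realType) (m : {measure set Z -> \bar R}) (m' : {measure set T -> \bar R})
    (k : T -> {measure set Z -> \bar R}) (f : Z -> R) (C : R) :
  m setT = 1%E -> m' setT = 1%E -> (forall t, k t setT = 1%E) ->
  (forall h : Z -> \bar R, (forall z, 0 <= h z)%E -> measurable_fun setT h ->
    \int[m]_z h z = \int[m']_t \int[k t]_z h z)%E ->
  measurable_fun setT f -> (forall x, `|f x| <= C) ->
  measurable_fun setT (fun t => \int[k t]_z f z) ->
  \int[m]_z f z = \int[m']_t \int[k t]_z f z.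
Proof.
move=> m1 m'1 k1 mk mf fC mkf; apply: (addIr C); apply: EFin_inj.
rewrite -Rintegral_shift// mk; last 2 first.
- by move=> z; rewrite lee_fin -lerBlDr sub0r; have := fC z; rewrite ler_norml => /andP[].
- by apply/measurable_EFinP; exact: measurable_funD.
under eq_integral => t _ do rewrite (Rintegral_shift (k1 t) mf fC).
rewrite Rintegral_shift// => t.
by have [] := bounded_prob_integrable (k1 t) mf fC.
Qed.

Section marginal.
Context dX (X : measurableType dX) dY (Y : measurableType dY)
  dV (V : measurableType dV) (R : realType).
Variables (P : R.-pker X ~> X) (Q : R.-pker X ~> Y) (F : Y -> V -> V).

Lemma Rintegral_signal_fst x (f : X -> R) : measurable_fun setT f ->
  \int[signal P Q x]_t f t.1 = \int[P x]_x' f x'.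
Proof.
move=> mf; congr fine.
have H (h : X -> \bar R) : (forall x, 0 <= h x)%E -> measurable_fun setT h ->
    (\int[signal P Q x]_t h t.1 = \int[P x]_x' h x')%E.
  move=> h0 mh; rewrite ge0_integral_signal//; last exact: measurableT_comp.
  apply: eq_integral => x' _; rewrite /= integral_cst// -[RHS]mule1.
  by congr (_ * _)%E; exact: prob_kernel.
have mE : measurable_fun setT (EFin \o f) by exact/measurable_EFinP.
rewrite integralE [RHS]integralE; congr (_ - _)%E.
  rewrite -H//; last exact: measurable_funepos.
  by apply: eq_integral => t _; rewrite !funeposE.
rewrite -H//; last exact: measurable_funeneg.
by apply: eq_integral => t _; rewrite !funenegE.
Qed.

Lemma averaged_cst_iter m (f : X -> R) (C : R) x v : measurable_fun setT f ->
  (forall x, `|f x| <= C) ->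
  iter m (averaged (signal P Q) F) (f \o fst) (x, v) = \int[kernel_pow P m x]_z f z.
Proof.
move=> mf fC; have k1 n t : kernel_pow P n t setT = 1%E by exact: prob_kernel.
elim: m x v => [|m ih] x v.
  by rewrite /= /kdirac /Rintegral integral_dirac// ?diracT ?mul1e//; exact/measurable_EFinP.
have mk : measurable_fun setT (fun t => \int[kernel_pow P m t]_z f z).
  apply: (@measurable_Rintegral_param _ _ _ _ _ (kernel_pow P m) _ _ (fun _ z => f z)).
  - by move=> U mU; exact: measurable_kernel.
  - by move=> z; rewrite k1 ltry.
  - exact: measurableT_comp.
rewrite [LHS]/= {1}/averaged.
under eq_Rintegral do rewrite ih.
rewrite (@Rintegral_signal_fst x (fun t => \int[kernel_pow P m t]_z f z))//.
have P1 : P x setT = 1%E by exact: prob_kernel.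
apply/esym; apply: (Rintegral_mixture (k1 m.+1 x) P1 (k1 m) _ mf fC mk).
by move=> h h0 mh /=; rewrite integral_kcomp.
Qed.

End marginal.

(** * Convergence of the averages *)

Section geometric_limits.
Context (R : realType).

(** The limit is the supremum of the lower bounds that the increments give. *)
Lemma geometric_limit (a : nat -> R) (C t : R) : 0 <= C -> 0 < t < 1 ->
  (forall k, `|a k.+1 - a k| <= C * t ^+ k) ->
  exists l, forall k, `|a k - l| <= C * (1 - t)^-1 * t ^+ k.
Proof.
move=> C0 /andP[t0 t1] ha.
have u0 : 0 < 1 - t by rewrite subr_gt0.
pose e k := C * (1 - t)^-1 * t ^+ k.
have eS k : e k = C * t ^+ k + e k.+1.
  rewrite /e exprS.
  rewrite (_ : C * t ^+ k = C * t ^+ k * ((1 - t) * (1 - t)^-1)); last first.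
    by rewrite divff ?mulr1// gt_eqF.
  by ring.
have e0 k : 0 <= e k by rewrite !mulr_ge0 ?exprn_ge0 ?invr_ge0 ?(ltW u0) ?(ltW t0).
have lo k : a k - e k <= a k.+1 - e k.+1.
  by have := ha k; rewrite (eS k) ler_norml => /andP[]; lra.
have up k : a k.+1 + e k.+1 <= a k + e k.
  by have := ha k; rewrite (eS k) ler_norml => /andP[]; lra.
have loD k j : a k - e k <= a (k + j)%N - e (k + j)%N.
  elim: j => [|j ih]; first by rewrite addn0.
  by apply: le_trans ih _; rewrite addnS.
have upD k j : a (k + j)%N + e (k + j)%N <= a k + e k.
  elim: j => [|j ih]; first by rewrite addn0.
  by apply: le_trans ih; rewrite addnS.
have lu j k : a j - e j <= a k + e k.
  have h1 := loD j k; have h2 := upD k j; rewrite addnC in h2.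
  by have := e0 (j + k)%N; lra.
pose A := [set x : R | exists k, x = a k - e k].
have Aub k : ubound A (a k + e k) by move=> _ [j ->].
have A0 : A !=set0 by exists (a 0%N - e 0%N); exists 0%N.
exists (sup A) => k; rewrite -/(e k) ler_distlC; apply/andP; split.
  by apply: ub_le_sup; [exists (a 0%N + e 0%N)|exists k].
by apply: ge_sup.
Qed.

End geometric_limits.

Lemma split_count m k : (m <= k.+2)%N -> (1 + (m + k) <= 3 * k.+1)%N.
Proof. by lia. Qed.

Lemma half_split n : [/\ n = (n - n./2 + n./2)%N,
  (n./2 <= n - n./2 <= n./2.+2)%N & (n <= n./2.*2.+1)%N].
Proof. by split; lia. Qed.

Section convergence.
Context dX (X : measurableType dX) dY (Y : measurableType dY)
  dV (V : measurableType dV) (R : realType).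
Variables (P : R.-pker X ~> X) (Q : R.-pker X ~> Y) (F : Y -> V -> V).
Local Notation S := (signal P Q).
Variables (psi : Y -> R) (s L0 g : R) (sc : R -> V -> Prop) (vs : V).
Hypotheses (mF : measurable_fun setT (fun w : Y * V => F w.1 w.2))
  (psi_ge1 : forall y, 1 <= psi y) (mpsi : measurable_fun setT psi)
  (s_ge0 : 0 <= s) (L0_ge1 : 1 <= L0)
  (psiL0 : forall x, (\int[S x]_t (psi t.2 `^ s)%:E <= L0%:E)%E)
  (g_ge1 : 1 <= g) (sc_ex : forall v, exists2 M, 1 <= M & sc M v)
  (sc_F : forall M v ys, 1 <= M -> sc M v -> all (fun y => psi y <= M) ys ->
     sc (g * M) (foldl (fun v y => F y v) v ys))
  (sc_le : forall M M' v, 1 <= M <= M' -> sc M v -> sc M' v)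
  (sc_vs : sc 1 vs).
Variables (pi : probability X R) (K0 delta tau t rho : R).
Hypotheses (K0_ge1 : 1 <= K0) (delta01 : 0 < delta < 1)
  (Ppi : forall x n B, measurable B ->
    (`|kernel_pow P n x B - pi B| <= (K0 * delta ^+ n)%:E)%E)
  (tau_ge0 : 0 <= tau) (t01 : 0 < t < 1) (rho01 : 0 < rho < 1)
  (tau_t : tau <= t ^+ 2) (delta_t : delta <= t ^+ 2) (t_rho : t <= rho ^+ 2).

Local Notation Fs := (foldl (fun v y => F y v)).
Local Notation w y := (psi y `^ s).
Local Notation avg := (averaged S F).
Local Notation tame := (tame s sc).

Let L0_ge0 : 0 <= L0. Proof. exact: le_trans L0_ge1. Qed.
Let g_ge0 : 0 <= g. Proof. exact: le_trans g_ge1. Qed.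
Let gs_ge1 : 1 <= g `^ s. Proof. exact: weight_ge1. Qed.

Definition max_weight (M : R) (ys : seq Y) : R := \big[Num.max/M]_(y <- ys) psi y.

Lemma max_weight_ge M ys : M <= max_weight M ys.
Proof.
rewrite /max_weight; elim: ys => [|y ys ih]; first by rewrite big_nil.
by rewrite big_cons le_max ih orbT.
Qed.

Lemma all_max_weight M ys : all (fun y => psi y <= max_weight M ys) ys.
Proof. by apply/allP => y yys; exact: le_bigmax_seq. Qed.

Lemma max_weight_powR M ys : 1 <= M ->
  max_weight M ys `^ s <= M `^ s + \sum_(y <- ys) w y.
Proof.
move=> M1; rewrite /max_weight; elim: ys => [|y ys ih].
  by rewrite !big_nil addr0.
have h1 : 1 <= \big[Num.max/M]_(j <- ys) psi j.
  by apply: le_trans M1 _; exact: max_weight_ge.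
rewrite !big_cons maxC; apply: le_trans (powR_max psi s y h1) _.
by rewrite addrCA [leLHS]addrC lerD2l.
Qed.

(** Functions of the state and the statistic that forget the statistic's past
    along observations, at a rate uniform in the state. *)
Definition forgetting (C : R) (h : X * V -> R) :=
  [/\ measurable_fun setT h,
    forall x ys v M, 1 <= M -> sc M v -> all (fun y => psi y <= M) ys ->
      `|h (x, Fs v ys)| <= C * M `^ s &
    forall x ys v v' M, 1 <= M -> sc M v -> sc M v' ->
      all (fun y => psi y <= M) ys ->
      `|h (x, Fs v ys) - h (x, Fs v' ys)| <= C * tau ^+ size ys * M `^ s].

Section iterates.
Variables (C : R) (h : X * V -> R).
Hypotheses (C_ge0 : 0 <= C) (hC : forgetting C h).

Let tame_h : tame h.
Proof.
have [mh h1 _] := hC; split => //; exists C => // x v M M1 Mv.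
exact: (h1 x [::] v M).
Qed.

Let iter_diff m h h' v v' := @iter_averaged_diff _ _ _ _ _ _ _ _ _ _ _ _ _ _
  mF mpsi s_ge0 L0_ge0 psiL0 g_ge1 sc_ex sc_F sc_le m h h' v v'.
Let tame_it m : tame (iter m avg h).
Proof. exact: (tame_iter mF mpsi s_ge0 L0_ge0 psiL0 g_ge1 sc_F sc_le). Qed.

(** The iterate with the statistic reset to the reference value. *)
Definition reset_iter k : X -> R := fun x => iter k avg h (x, vs).

Lemma measurable_reset k : measurable_fun setT (reset_iter k).
Proof.
have [m _] := tame_it k; apply: (measurableT_comp m (g := fun x => (x, vs))).
by apply: measurable_fun_pair => //; exact: measurable_cst.
Qed.

Lemma reset_bound k x : `|reset_iter k x| <= C * (1 + k%:R * L0).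
Proof.
have t0 : tame (fun=> 0 : R).
  split; first exact: measurable_cst.
  by exists 0 => // *; rewrite normr0 mul0r.
have z0 m u : iter m avg (fun=> 0 : R) u = 0.
  elim: m u => //= m ih u; rewrite /averaged.
  by under eq_Rintegral do rewrite ih; rewrite /Rintegral integral0.
rewrite -[reset_iter k x]subr0 -(z0 k (x, vs)).
apply: iter_diff => // x' ys _; rewrite subr0.
have [_ h1 _] := hC.
apply: le_trans (h1 x' ys vs (max_weight 1 ys) _ _ _) _.
- exact: max_weight_ge.
- by apply: sc_le sc_vs; rewrite lexx max_weight_ge.
- exact: all_max_weight.
by rewrite ler_wpM2l//; have := max_weight_powR ys (lexx 1); rewrite powR1.
Qed.

(** After [m] steps the past is replaced by the reference value [vs], at a
    price that the remaining [k] steps make small. *)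
Lemma iter_near_reset m k x v M : 1 <= M -> sc M v ->
  `|iter (m + k) avg h (x, v) - iter m avg (reset_iter k \o fst) (x, v)| <=
  C * g `^ s * tau ^+ k * (M `^ s + (m + k)%:R * L0).
Proof.
move=> M1 Mv; rewrite iterD natrD mulrDl [_ * L0 + _]addrC addrA.
have c0 : 0 <= C * g `^ s * tau ^+ k by rewrite !mulr_ge0 ?powR_ge0 ?exprn_ge0.
apply: iter_diff => //.
- split; first exact: measurableT_comp (measurable_reset k) measurable_fst.
  exists (C * (1 + k%:R * L0)); first by rewrite mulr_ge0// addr_ge0// mulr_ge0.
  move=> x' v' M' M'1 _; apply: le_trans (reset_bound k x') _.
  by rewrite ler_peMr ?weight_ge1// mulr_ge0// addr_ge0// mulr_ge0.
- by rewrite addr_ge0 ?powR_ge0// mulr_ge0.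
move=> x' ys _; rewrite /= /reset_iter addrAC.
apply: iter_diff => //; first by rewrite addr_ge0 ?powR_ge0 ?sumr_ge0// => *; exact: powR_ge0.
move=> x'' zs zsk; set N := max_weight M (ys ++ zs).
have MN : M <= N := max_weight_ge _ _.
have N1 : 1 <= N by exact: le_trans MN.
have gN : N <= g * N by rewrite ler_peMl// (le_trans _ N1).
have : all (fun y => psi y <= N) (ys ++ zs) by exact: all_max_weight.
rewrite all_cat => /andP[ysN zsN].
have [_ _ h2] := hC.
apply: le_trans (h2 x'' zs (Fs v ys) vs (g * N) _ _ _ _) _.
- by rewrite mulr_ege1.
- by apply: sc_F => //; apply: sc_le Mv; rewrite M1.
- by apply: sc_le sc_vs; rewrite lexx mulr_ege1.
- by apply/allP => y /(allP zsN) /le_trans; apply.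
rewrite zsk powRM//; last by rewrite (le_trans _ N1).
rewrite (_ : C * tau ^+ k * (g `^ s * N `^ s) = C * g `^ s * tau ^+ k * N `^ s); last by ring.
rewrite ler_wpM2l//; apply: le_trans (max_weight_powR (ys ++ zs) M1) _.
by rewrite big_cat addrA.
Qed.

Definition stationary k : R := \int[pi]_x reset_iter k x.

Lemma iter_near_stationary m k x v M : 1 <= M -> sc M v ->
  `|iter (m + k) avg h (x, v) - stationary k| <=
  C * g `^ s * tau ^+ k * (M `^ s + (m + k)%:R * L0) +
  2 * (K0 * delta ^+ m * (C * (1 + k%:R * L0))).
Proof.
move=> M1 Mv; rewrite -(subrKA (iter m avg (reset_iter k \o fst) (x, v))).
apply: le_trans (ler_normD _ _) _; rewrite lerD// ?iter_near_reset//.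
rewrite (averaged_cst_iter P Q F m x v (measurable_reset k) (reset_bound k)).
have [n nE] : exists n : {finite_measure set X -> \bar R},
    (n : {measure set X -> \bar R}) = kernel_pow P m x.
  by apply: finite_measure_of; rewrite prob_kernel ltry.
rewrite -nE mulr_natl mulr2n; apply: (@Rintegral_setwise_close _ _ _ n pi) => //.
- move=> B mB; rewrite -[n B]/((n : {measure set X -> \bar R}) B) nE.
  exact: Ppi.
- exact: measurable_reset.
- exact: reset_bound.
Qed.

(** 5 is 3 + 2: for m <= k + 2 the factor 1 + m + k in the first term of
    [iter_near_stationary] is at most 3 (k + 1), and the second term has a factor 2. *)
Definition split_cst : R := 5 * (K0 * (C * g `^ s) * L0) * (1 - t)^-1.

Lemma iter_near_stationary_rate m k x v M : (k <= m <= k.+2)%N -> 1 <= M -> sc M v ->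
  `|iter (m + k) avg h (x, v) - stationary k| <= split_cst * t ^+ k * M `^ s.
Proof.
move=> /andP[km mk2] M1 Mv.
have [t0 t1] := andP t01; have [d0 d1] := andP delta01.
have t0' : 0 <= t by exact: ltW.
have d0' : 0 <= delta by exact: ltW.
have K0_ge0 : 0 <= K0 by exact: le_trans K0_ge1.
have gs0 : 0 <= g `^ s by exact: powR_ge0.
have Ms1 : 1 <= M `^ s by exact: weight_ge1.
have Ms0 : 0 <= M `^ s by exact: powR_ge0.
have Cg0 : 0 <= C * g `^ s by exact: mulr_ge0.
set T := t ^+ k.*2.
have T0 : 0 <= T by exact: exprn_ge0.
have k1 : 0 <= k.+1%:R :> R by [].
have tauT : tau ^+ k <= T.
  by rewrite /T -mul2n exprM lerXn2r// nnegrE// exprn_ge0.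
have delT : delta ^+ m <= T.
  apply: (@le_trans _ _ (delta ^+ k)); first by rewrite ler_wiXn2l// ltW.
  by rewrite /T -mul2n exprM lerXn2r// nnegrE// exprn_ge0.
have LM : L0 <= M `^ s * L0 by rewrite ler_peMl.
have ML : M `^ s <= M `^ s * L0 by rewrite ler_peMr.
have ML1 : 1 <= M `^ s * L0 by rewrite mulr_ege1.
set N := M `^ s * L0 in LM ML ML1.
have N0 : 0 <= N by exact: le_trans ML1.
have h1 : M `^ s + (m + k)%:R * L0 <= 3 * k.+1%:R * N.
  apply: (@le_trans _ _ (N + (m + k)%:R * N)); first by rewrite lerD// ler_wpM2l.
  rewrite -{1}[N]mul1r -mulrDl ler_wpM2r//.
  have := split_count mk2.
  by rewrite -(ler_nat R) natrD natrM.
have h2 : 1 + k%:R * L0 <= k.+1%:R * N.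
  rewrite -natr1 mulrDl mul1r addrC lerD// ler_wpM2l//.
set W := K0 * (C * g `^ s).
have W0 : 0 <= W by exact: mulr_ge0.
have T1 : C * g `^ s * tau ^+ k * (M `^ s + (m + k)%:R * L0) <=
    3 * (W * (T * (k.+1%:R * N))).
  rewrite (_ : 3 * _ = W * T * (3 * k.+1%:R * N)); last by ring.
  have le1 : C * g `^ s * tau ^+ k <= W * T.
    by rewrite (ler_pM Cg0 (exprn_ge0 k tau_ge0) _ tauT)// ler_peMl.
  apply: ler_pM le1 h1; first by rewrite mulr_ge0// exprn_ge0.
  by rewrite addr_ge0// mulr_ge0.
have T2 : 2 * (K0 * delta ^+ m * (C * (1 + k%:R * L0))) <=
    2 * (W * (T * (k.+1%:R * N))).
  rewrite ler_wpM2l//.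
  rewrite (_ : K0 * _ * _ = K0 * C * delta ^+ m * (1 + k%:R * L0)); last by ring.
  rewrite (_ : W * _ = W * T * (k.+1%:R * N)); last by ring.
  have KC : 0 <= K0 * C by exact: mulr_ge0.
  have le1 : K0 * C * delta ^+ m <= W * T.
    by rewrite (ler_pM KC (exprn_ge0 m d0') _ delT)// /W mulrA ler_peMr.
  apply: ler_pM le1 h2; first by rewrite mulr_ge0// exprn_ge0.
  by rewrite addr_ge0// mulr_ge0.
apply: le_trans (iter_near_stationary m k x M1 Mv) _.
apply: le_trans (lerD T1 T2) _.
rewrite -mulrDl -natrD (_ : 5%:R * _ = 5 * (W * N) * (k.+1%:R * T)); last by ring.
have t01' : 0 <= t < 1 by rewrite t0'.
apply: le_trans (ler_wpM2l _ (expr_sqr_bound k t01')) _.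
  by rewrite !mulr_ge0.
by rewrite le_eqVlt /split_cst -/W /N; apply/orP; left; apply/eqP; ring.
Qed.

Definition limit_cst : R := split_cst * (1 + 2 * (1 - t)^-1) * rho^-1.

Lemma averages_converge : exists l, forall n x v M, 1 <= M -> sc M v ->
  `|iter n avg h (x, v) - l| <= limit_cst * rho ^+ n * M `^ s.
Proof.
have [t0 t1] := andP t01; have [r0 r1] := andP rho01.
have E0 : 0 <= split_cst.
  rewrite !mulr_ge0 ?powR_ge0 ?invr_ge0 ?subr_ge0 ?(le_trans _ K0_ge1)//.
  exact: ltW.
have rate k m x v M := @iter_near_stationary_rate m k x v M.
have incr k : `|stationary k.+1 - stationary k| <= 2 * split_cst * t ^+ k.
  (* both numbers are compared with the same iterate, of order 2k + 2 *)
  have a1 := rate k k.+2 point vs 1; have a2 := rate k.+1 k.+1 point vs 1.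
  have {}a1 := a1 _ (lexx 1) sc_vs; have {}a2 := a2 _ (lexx 1) sc_vs.
  rewrite powR1 !mulr1 in a1 a2.
  rewrite -(subrKA (iter (k.+1 + k.+1) avg h (point, vs))) -mulrA mulr_natl mulr2n.
  apply: le_trans (ler_normD _ _) _; apply: lerD.
    rewrite distrC; apply: le_trans (a2 _) _; first by rewrite leqnn ltnW.
    by rewrite ler_wpM2l// exprS ler_piMl ?exprn_ge0// ltW.
  by rewrite addSnnS in a1; apply: a1; rewrite leqnn -addn2 leq_addr.
have E20 : 0 <= 2 * split_cst by exact: mulr_ge0.
have [l lP] := geometric_limit E20 t01 incr.
exists l => n x v M M1 Mv.
(* half of the time for the signal to mix, half for the statistic to forget *)
have [nE mk n2k] := half_split n; move: nE mk n2k.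
set k := n./2; set m := (n - k)%N => nE mk n2k.
have Ms1 : 1 <= M `^ s by exact: weight_ge1.
apply: (@le_trans _ _ (split_cst * t ^+ k * M `^ s + 2 * split_cst * (1 - t)^-1 * t ^+ k)).
  rewrite -(subrKA (stationary k)); apply: le_trans (ler_normD _ _) _.
  by rewrite lerD// {1}nE; exact: rate.
have u0 : 0 <= (1 - t)^-1 by rewrite invr_ge0 subr_ge0 ltW.
have Z0 : 0 <= split_cst * (1 + 2 * (1 - t)^-1).
  by rewrite mulr_ge0// addr_ge0// mulr_ge0.
apply: (@le_trans _ _ (split_cst * (1 + 2 * (1 - t)^-1) * t ^+ k * M `^ s)).
  have : 0 <= 2 * split_cst * (1 - t)^-1 * t ^+ k * (M `^ s - 1).
    by rewrite mulr_ge0 ?subr_ge0// mulr_ge0 ?exprn_ge0 ?(ltW t0)// mulr_ge0.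
  rewrite mulrBr mulr1 subr_ge0 => le; apply: le_trans (lerD (lexx _) le) _.
  by rewrite le_eqVlt; apply/orP; left; apply/eqP; ring.
rewrite ler_wpM2r ?powR_ge0// /limit_cst -[leRHS]mulrA ler_wpM2l// mulrC ler_pdivlMr//.
apply: (@le_trans _ _ (rho ^+ k.*2 * rho)).
  by rewrite ler_wpM2r ?(ltW r0)// -mul2n exprM lerXn2r// nnegrE ?exprn_ge0// ltW.
by rewrite -exprSr ler_wiXn2l// ltW.
Qed.

End iterates.
End convergence.

(** * The iterated kernels as iterated averages *)

Section iterated_kernel.
Context dX (X : measurableType dX) dY (Y : measurableType dY)
  dV (V : measurableType dV) dZ (Z : measurableType dZ) (R : realType).
Variables (P : R.-pker X ~> X) (Q : R.-pker X ~> Y) (F : Y -> V -> V).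
Local Notation S := (signal P Q).
Local Notation avg := (averaged S F).
Variables (psi : Y -> R) (s L0 g : R) (sc : R -> V -> Prop).
Hypotheses (mF : measurable_fun setT (fun w : Y * V => F w.1 w.2))
  (mpsi : measurable_fun setT psi)
  (s_ge0 : 0 <= s) (L0_ge0 : 0 <= L0)
  (psiL0 : forall x, (\int[S x]_t (psi t.2 `^ s)%:E <= L0%:E)%E)
  (g_ge1 : 1 <= g) (sc_ex : forall v, exists2 M, 1 <= M & sc M v)
  (sc_F : forall M v ys, 1 <= M -> sc M v -> all (fun y => psi y <= M) ys ->
     sc (g * M) (foldl (fun v y => F y v) v ys))
  (sc_le : forall M M' v, 1 <= M <= M' -> sc M v -> sc M' v).
(** The state and the statistic that matter for the future of [z].  The
    statistic is the vector measure itself for the chain that updates with the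
    new observation, and its update by the current observation for the other. *)
Variables (e : Z -> X) (st : Z -> V) (move : Z -> X -> Y -> Z).
Hypotheses (me : measurable_fun setT e) (mst : measurable_fun setT st)
  (mm : measurable_fun setT (fun w : (Z * X) * Y => move w.1.1 w.1.2 w.2))
  (e_move : forall z x y, e (move z x y) = x)
  (st_move : forall z x y, st (move z x y) = F y (st z)).

Local Notation K := (signal_image P Q me mm).
Local Notation k := (fun z => K z : set Z -> \bar R).
Local Notation tame := (tame s sc).

Definition observed (Psi : X * Y -> V -> R) : X * V -> R :=
  fun u => \int[S u.1]_t Psi t u.2.

Definition tame_observable (Psi : X * Y -> V -> R) :=
  measurable_fun setT (fun w : V * (X * Y) => Psi w.2 w.1) /\
  exists2 C, 0 <= C & forall x v M, 1 <= M -> sc M v ->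
    (\int[S x]_t `|(Psi t v)%:E| <= (C * M `^ s)%:E)%E.

Lemma measurable_observable Psi v : tame_observable Psi ->
  measurable_fun setT (Psi ^~ v).
Proof.
move=> [m _]; apply: (measurableT_comp m (g := fun t => (v, t))).
by apply: measurable_fun_pair => //; exact: measurable_cst.
Qed.

Lemma observable_integrable Psi x v : tame_observable Psi ->
  (S x).-integrable setT (EFin \o Psi ^~ v).
Proof.
move=> oP; have [M M1 Mv] := sc_ex v; have [_ [C C0 hC]] := oP.
by have [] := Rintegral_bound (measurable_observable v oP) (hC x v M M1 Mv).
Qed.

Lemma tame_observed Psi : tame_observable Psi -> tame (observed Psi).
Proof.
move=> oP; have [m [C C0 hC]] := oP; split.
  apply: (@measurable_Rintegral_param _ _ _ _ _ (fun u : X * V => S u.1) _ _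
    (fun u t => Psi t u.2)).
  - by move=> B mB; exact: measurableT_comp (measurable_kernel S B mB) measurable_fst.
  - by move=> u; rewrite prob_kernel ltry.
  apply: (measurableT_comp m (g := fun w : (X * V) * (X * Y) => (w.1.2, w.2))).
  apply: measurable_fun_pair => //.
  exact: measurableT_comp measurable_snd measurable_fst.
exists C => // x v M M1 Mv.
by have [] := Rintegral_bound (measurable_observable v oP) (hC x v M M1 Mv).
Qed.

Let tame_it Psi m : tame_observable Psi -> tame (iter m avg (observed Psi)).
Proof.
move=> oP; apply: (tame_iter mF mpsi s_ge0 L0_ge0 psiL0 g_ge1 sc_F sc_le).
exact: tame_observed.
Qed.

Let integ Psi m x v : tame_observable Psi ->
  (S x).-integrable setT
    (EFin \o fun t => iter m avg (observed Psi) (t.1, F t.2 v)).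
Proof.
move=> oP; apply: (tame_integrable mF mpsi psiL0 g_ge1 sc_ex sc_F sc_le).
exact: tame_it.
Qed.

Lemma ge0_integral_nstep_averaged (Phi : Z -> R) Psi n z :
  measurable_fun setT Phi -> (forall z, 0 <= Phi z) -> tame_observable Psi ->
  (forall t v, 0 <= Psi t v) ->
  (forall z x y, Phi (move z x y) = Psi (x, y) (st z)) ->
  (\int[nstep k n.+1 z]_z' (Phi z')%:E =
    (iter n avg (observed Psi) (e z, st z))%:E)%E.
Proof.
move=> mPhi Phi0 oP Psi0 PhiE.
have mE : measurable_fun setT (EFin \o Phi) by exact/measurable_EFinP.
have it0 m u : 0 <= iter m avg (observed Psi) u.
  by elim: m u => [|m ih] u; apply: Rintegral_ge0 => t _; [exact: Psi0|exact: ih].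
elim: n z => [|n ih] z.
  rewrite ge0_integral_nstepS//.
  under eq_integral do rewrite integral_nstep0//.
  rewrite ge0_integral_signal_image//.
  under eq_integral => t _ do rewrite PhiE -surjective_pairing.
  rewrite /= /observed /Rintegral fineK//.
  by apply: integrable_fin_num => //; exact: observable_integrable.
rewrite ge0_integral_nstepS//.
under eq_integral do rewrite ih.
rewrite (ge0_integral_signal_image _ _ _ _ z (f := fun z' =>
  (iter n avg (observed Psi) (e z', st z'))%:E)); last 2 first.
- by move=> z'; rewrite lee_fin.
- apply/measurable_EFinP; have [m _] := tame_it n oP.
  by apply: (measurableT_comp m (g := fun z => (e z, st z))); exact: measurable_fun_pair.
under eq_integral => t _ do rewrite e_move st_move.
rewrite [in RHS]/= {1}/averaged /Rintegral fineK//.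
by apply: integrable_fin_num => //; exact: integ.
Qed.

Lemma tame_observable_part (f : R -> R) Psi : measurable_fun setT f ->
  (forall r, `|f r| <= `|r|) -> tame_observable Psi ->
  tame_observable (fun t v => f (Psi t v)).
Proof.
move=> mf fr oP; have [m [C C0 hC]] := oP; split; first exact: measurableT_comp.
exists C => // x v M M1 Mv; apply: le_trans (hC x v M M1 Mv).
apply: ge0_le_integral => //.
- apply: measurableT_comp => //; apply/measurable_EFinP.
  exact: measurableT_comp (measurable_observable v oP).
- apply: measurableT_comp => //; apply/measurable_EFinP.
  exact: measurable_observable.
- by move=> t _; rewrite lee_fin.
Qed.

Definition pos_part (r : R) := Num.max r 0.
Definition neg_part (r : R) := Num.max (- r) 0.

(** The two parts of [Phi] are treated separately, since iterated integrals can
    only be composed freely for nonnegative functions. *)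
Lemma integral_nstep_averaged (Phi : Z -> R) Psi n z :
  measurable_fun setT Phi -> tame_observable Psi ->
  (forall z x y, Phi (move z x y) = Psi (x, y) (st z)) ->
  (\int[nstep k n.+1 z]_z' (Phi z')%:E =
    (iter n avg (observed Psi) (e z, st z))%:E)%E.
Proof.
move=> mPhi oP PhiE.
have mp : measurable_fun setT pos_part.
  by apply: measurable_maxr => //; exact: measurable_id.
have mn : measurable_fun setT neg_part.
  by apply: measurable_maxr => //; exact: measurableT_comp.
have lp r : `|pos_part r| <= `|r|.
  rewrite ger0_norm; first by rewrite ge_max ler_norm normr_ge0.
  by rewrite le_max lexx orbT.
have ln r : `|neg_part r| <= `|r|.
  rewrite ger0_norm; first by rewrite ge_max -normrN ler_norm normr_ge0.
  by rewrite le_max lexx orbT.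
have op := tame_observable_part mp lp oP.
have on := tame_observable_part mn ln oP.
have itB m u : iter m avg (observed Psi) u =
    iter m avg (observed (fun t v => pos_part (Psi t v))) u -
    iter m avg (observed (fun t v => neg_part (Psi t v))) u.
  elim: m u => [|m ih] u.
    rewrite /= /observed -RintegralB//; last 2 first.
    - exact: observable_integrable op.
    - exact: observable_integrable on.
    apply: eq_Rintegral => t _; rewrite /pos_part /neg_part.
    by case: (leP (Psi t u.2) 0) => h; case: (leP (- Psi t u.2) 0) => h'; lra.
  rewrite [LHS]/= {1}/averaged.
  under eq_Rintegral do rewrite ih.
  by rewrite RintegralB//; exact: integ.
rewrite kernel_powE integralE.
rewrite (_ : (\int[_]_x _^\+ x)%E = \int[kernel_pow K n.+1 z]_z' (pos_part (Phi z'))%:E)%E; last first.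
  by apply: eq_integral => z' _; rewrite funeposE /pos_part EFin_max.
rewrite (_ : (\int[_]_x _^\- x)%E = \int[kernel_pow K n.+1 z]_z' (neg_part (Phi z'))%:E)%E; last first.
  by apply: eq_integral => z' _; rewrite funenegE /neg_part EFin_max.
rewrite -kernel_powE.
rewrite (ge0_integral_nstep_averaged (Phi := pos_part \o Phi) n z _ _ op)//; last 4 first.
- exact: measurableT_comp.
- by move=> z'; rewrite /= le_max lexx orbT.
- by move=> t v; rewrite le_max lexx orbT.
- by move=> z' x y; rewrite /= PhiE.
rewrite (ge0_integral_nstep_averaged (Phi := neg_part \o Phi) n z _ _ on)//; last 4 first.
- exact: measurableT_comp.
- by move=> z'; rewrite /= le_max lexx orbT.
- by move=> t v; rewrite le_max lexx orbT.
- by move=> z' x y; rewrite /= PhiE.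
by rewrite itB EFinB.
Qed.

End iterated_kernel.

(** * The observables of the two chains *)

Section observables.
Context (R : realType) (d p : nat) dX (X : measurableType dX)
  dY (Y : measurableType dY) (mu : {finite_measure set X -> \bar R}) (eps : R)
  (psi : Y -> R) (phi : Y -> X -> R).
Variables (ptheta : 'rV[R]_d -> X -> X -> R) (qtheta : 'rV[R]_d -> Y -> X -> R)
  (th : 'rV[R]_d).
Local Notation rr := (fun (a : midx d p) y x x' => drtheta ptheta qtheta a th y x x').
Hypothesis fm : filter_model mu eps psi phi rr.
Local Notation V := (vmeas X R d p).
Local Notation F := (Fder mu ptheta qtheta th : Y -> V -> V).
Local Notation Fs := (foldl (fun v y => F y v)).
Variables (P : R.-pker X ~> X) (Q : R.-pker X ~> Y).
Local Notation S := (signal P Q).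
Variables (Phi : X * Y * V -> R) (varphi : X -> Y -> R) (q L0 Cf tf : R).
Hypotheses (mPhi : measurable_fun setT Phi)
  (mF : measurable_fun setT (fun w : Y * V => F w.1 w.2))
  (mpsi : measurable_fun setT psi)
  (q_ge0 : 0 <= q) (L0_ge0 : 0 <= L0)
  (varphi_ge1 : forall x y, 1 <= varphi x y)
  (mvarphi : forall x, measurable_fun setT (varphi x))
  (c5 : forall x y (La : V), `|Phi (x, y, La)| <= varphi x y * vnorm La `^ q)
  (c5' : forall x y (La La' : V), `|Phi (x, y, La) - Phi (x, y, La')| <=
     varphi x y * vdist La La' * (vnorm La + vnorm La') `^ q)
  (c6 : forall x, (\int[Q x]_y
     (varphi x y * psi y `^ (p%:R * (p%:R + q + 1)))%:E <= L0%:E)%E)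
  (Cf_ge1 : 1 <= Cf) (tf01 : 0 < tf < 1)
  (forgetf : forall n, forget p (eps ^+ 2) p n <= Cf * tf ^+ n).

Local Notation r := (p%:R * (p%:R + q + 1)).
Local Notation s := (p%:R * (q + 1)).
Local Notation g := (growth_cst p eps).
Local Notation w y := (psi y `^ s).

Let psi_ge1 := fm_psi fm.
Let g_ge1 : 1 <= g := growth_cst_ge1 fm.
Let g_ge0 : 0 <= g. Proof. exact: le_trans g_ge1. Qed.
Let s_ge0 : 0 <= s. Proof. by rewrite mulr_ge0// addr_ge0. Qed.
Let s_le_r : s <= r. Proof. by rewrite ler_wpM2l// lerD2r lerDr. Qed.
Let varphi_ge0 x y : 0 <= varphi x y. Proof. exact: le_trans (varphi_ge1 x y). Qed.

Lemma weight_le_r y : w y <= psi y `^ r.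
Proof. by rewrite ler_powR. Qed.

(** The weight need not be jointly measurable, so that it has to be integrated
    over the observation first. *)
Lemma signal_weight x (f : X * Y -> R) (c : R) : 0 <= c -> measurable_fun setT f ->
  (forall x y, `|f (x, y)| <= c * (varphi x y * psi y `^ r)) ->
  (\int[S x]_t `|(f t)%:E| <= (c * L0)%:E)%E.
Proof.
move=> c0 mf fc; rewrite ge0_integral_signal//; last first.
  by apply: measurableT_comp => //; exact/measurable_EFinP.
have mfy x' : measurable_fun setT (fun y => f (x', y)).
  apply: (measurableT_comp mf (g := fun y => (x', y))).
  by apply: measurable_fun_pair => //; exact: measurable_cst.
have mw x' : measurable_fun setT (fun y => (varphi x' y * psi y `^ r)%:E).
  apply/measurable_EFinP; apply: measurable_funM => //.
  exact: measurableT_comp (measurable_powR r) mpsi.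
have H x' : (\int[Q x']_y `|(f (x', y))%:E| <= (c * L0)%:E)%E.
  apply: (@le_trans _ _ (\int[Q x']_y (c%:E * (varphi x' y * psi y `^ r)%:E))%E).
    apply: ge0_le_integral => //.
    - by apply: measurableT_comp => //; exact/measurable_EFinP.
    - by apply: emeasurable_funM => //; exact: measurable_cst.
    - by move=> y _; rewrite -EFinM lee_fin.
  rewrite ge0_integralZl// => [|y _]; last by rewrite lee_fin mulr_ge0 ?powR_ge0.
  by rewrite EFinM lee_wpmul2l.
apply: (@le_trans _ _ (\int[P x]_x' (c * L0)%:E)%E); last first.
  by rewrite integral_cst// prob_kernel mule1.
apply: ge0_le_integral => //.
- by move=> x' _; apply: integral_ge0.
- apply: (@measurable_integral_param _ _ _ _ _ (fun x' => Q x') _ _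
    (fun t => `|(f t)%:E|%E)) => //.
  + by move=> U mU; exact: measurable_kernel.
  + by move=> x'; rewrite prob_kernel ltry.
  + by apply: measurableT_comp => //; exact/measurable_EFinP.
Qed.

Lemma signal_psi x : (\int[S x]_t (w t.2)%:E <= L0%:E)%E.
Proof.
have mw : measurable_fun setT (fun t : X * Y => w t.2).
  exact: (measurableT_comp (measurable_powR s) (measurableT_comp mpsi measurable_snd)).
have := @signal_weight x (fun t => w t.2) 1 ler01 mw.
rewrite mul1r => h; apply: le_trans (h _); last first.
  move=> x' y /=; rewrite ger0_norm ?powR_ge0// mul1r -[leLHS]mul1r.
  by rewrite ler_pM ?powR_ge0// weight_le_r.
rewrite le_eqVlt; apply/orP; left; apply/eqP; apply: eq_integral => t _.
by rewrite gee0_abs// lee_fin powR_ge0.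
Qed.

Lemma scaled_vnorm_le M (v : V) : 1 <= M -> scaled M v -> vnorm v <= M ^+ p.
Proof.
move=> M1 Mv; apply: bigmax_le => [|a _]; first by rewrite exprn_ge0// (le_trans _ M1).
by apply: le_trans (Mv a) _; rewrite ler_weXn2l// mabs_le_p.
Qed.

Let powR_pq (M : R) : 1 <= M -> (M ^+ p) `^ q = M `^ (p%:R * q).
Proof.
by move=> M1; rewrite -powR_mulrn ?(le_trans _ M1)// powRrM.
Qed.

Lemma Phi_bound x y (v : V) M : 1 <= M -> scaled M v ->
  `|Phi (x, y, v)| <= varphi x y * M `^ s.
Proof.
move=> M1 Mv; apply: le_trans (c5 x y v) _; rewrite ler_wpM2l//.
have v0 : 0 <= vnorm v by apply: le_trans (vnorm_ge1 v).
apply: (@le_trans _ _ ((M ^+ p) `^ q)).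
  rewrite ge0_ler_powR// ?nnegrE ?exprn_ge0 ?(le_trans _ M1)//.
  exact: scaled_vnorm_le.
by rewrite powR_pq// ler_powR// ler_wpM2l// lerDl.
Qed.

Lemma Phi_diff x y (v v' : V) M D : 1 <= M -> 0 <= D -> scaled M v -> scaled M v' ->
  (forall a, tvnorm (csub (v a) (v' a)) <= D * M ^+ mabs a) ->
  `|Phi (x, y, v) - Phi (x, y, v')| <= varphi x y * (2 `^ q * D * M `^ s).
Proof.
move=> M1 D0 Mv Mv' vv'; apply: le_trans (c5' x y v v') _.
have M0 : 0 <= M by exact: le_trans M1.
have MN0 : M != 0 by rewrite gt_eqF// (lt_le_trans ltr01).
have n0 (u : V) : 0 <= vnorm u by apply: le_trans (vnorm_ge1 u).
rewrite -mulrA ler_wpM2l//.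
have d1 : vdist v v' <= D * M ^+ p.
  apply: bigmax_le => [|a _]; first by rewrite mulr_ge0// exprn_ge0.
  by apply: le_trans (vv' a) _; rewrite ler_wpM2l// ler_weXn2l// mabs_le_p.
have d2 : (vnorm v + vnorm v') `^ q <= 2 `^ q * M `^ (p%:R * q).
  rewrite -powR_pq// -powRM ?exprn_ge0//.
  rewrite ge0_ler_powR// ?nnegrE ?addr_ge0 ?mulr_ge0 ?exprn_ge0//.
  by rewrite mulr_natl mulr2n lerD// scaled_vnorm_le.
apply: le_trans (ler_pM (vdist_ge0 _ _) (powR_ge0 _ _) d1 d2) _.
rewrite (_ : D * M ^+ p * _ = 2 `^ q * D * (M ^+ p * M `^ (p%:R * q))); last by ring.
rewrite -powR_mulrn// -powRD; last by rewrite MN0 implybT.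
by rewrite (_ : p%:R + p%:R * q = s)//; ring.
Qed.

(** The factor 2^q comes from the sum of two norms.  The first update maps into
    densities without contracting, whence [tf^-1]; the summand 2 covers the empty
    sequence of observations. *)
Definition observable_cst : R := 2 `^ q * (Cf * tf^-1 + 2) * g `^ s.

(** What the average of an observable inherits from the observable; the two
    chains lead to two instances. *)
Definition forgetting_observable (Psi : X * Y -> V -> R) :=
  [/\ measurable_fun setT (fun w : V * (X * Y) => Psi w.2 w.1),
    forall x y ys v M, 1 <= M -> scaled M v -> all (fun y => psi y <= M) ys ->
      `|Psi (x, y) (Fs v ys)| <=
        observable_cst * M `^ s * (varphi x y * psi y `^ r) &
    forall x y ys v v' M, 1 <= M -> scaled M v -> scaled M v' ->
      all (fun y => psi y <= M) ys ->
      `|Psi (x, y) (Fs v ys) - Psi (x, y) (Fs v' ys)| <=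
        observable_cst * tf ^+ size ys * M `^ s * (varphi x y * psi y `^ r)].

Lemma observable_cst_ge1 : 1 <= observable_cst.
Proof.
have [t0 t1] := andP tf01.
rewrite !mulr_ege1//.
- by apply: weight_ge1 => //; rewrite ler1n.
- have : 0 <= Cf * tf^-1 by rewrite mulr_ge0 ?invr_ge0 ?(le_trans _ Cf_ge1)// ltW.
  by lra.
exact: weight_ge1.
Qed.

Lemma forgetting_tame_observable Psi : forgetting_observable Psi ->
  tame_observable P Q s (fun M (v : V) => scaled M v) Psi.
Proof.
have o1 := observable_cst_ge1.
move=> [m h1 _]; split => //; exists (observable_cst * L0).
  by rewrite mulr_ge0// (le_trans _ o1).
move=> x v M M1 Mv.
rewrite mulrAC; apply: signal_weight.
- by rewrite mulr_ge0 ?powR_ge0// (le_trans _ o1).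
- apply: (measurableT_comp m (g := fun t => (v, t))).
  by apply: measurable_fun_pair => //; exact: measurable_cst.
- by move=> x' y; exact: (h1 x' y [::] v M).
Qed.

Lemma observed_forgetting Psi : forgetting_observable Psi ->
  forgetting F psi s (fun M (v : V) => scaled M v) tf (observable_cst * L0)
    (observed P Q Psi).
Proof.
move=> oP; have o1 := observable_cst_ge1.
have o0 : 0 <= observable_cst by exact: le_trans o1.
have [m h1 h2] := oP; have tO := forgetting_tame_observable oP.
have mP v : measurable_fun setT (Psi ^~ v) := measurable_observable v tO.
have tf0 : 0 <= tf by case/andP: tf01 => /ltW.
split.
- by have [] := @tame_observed _ _ _ _ _ _ _ P Q s (fun M (v : V) => scaled M v) Psi tO.
- move=> x ys v M M1 Mv ysM; rewrite mulrAC.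
  have [] // := @Rintegral_bound _ _ _ (S x) (Psi ^~ (Fs v ys))
    (observable_cst * M `^ s * L0) (mP _) _.
  apply: signal_weight => // [|x' y]; first by rewrite mulr_ge0 ?powR_ge0.
  exact: h1.
move=> x ys v v' M M1 Mv M'v ysM.
rewrite /observed -RintegralB//; last 2 first.
- apply: (@observable_integrable _ _ _ _ _ _ _ P Q s (fun M (v : V) => scaled M v)) => //.
  by move=> u; exists (vnorm u); [exact: vnorm_ge1|exact: scaled_vnorm].
- apply: (@observable_integrable _ _ _ _ _ _ _ P Q s (fun M (v : V) => scaled M v)) => //.
  by move=> u; exists (vnorm u); [exact: vnorm_ge1|exact: scaled_vnorm].
rewrite (_ : observable_cst * L0 * _ * _ =
  observable_cst * tf ^+ size ys * M `^ s * L0); last by ring.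
have [] // := @Rintegral_bound _ _ _ (S x) (fun t => Psi t (Fs v ys) - Psi t (Fs v' ys))
  (observable_cst * tf ^+ size ys * M `^ s * L0) _ _.
  exact: measurable_funB.
apply: signal_weight => [||x' y].
- by rewrite mulr_ge0 ?powR_ge0// mulr_ge0// exprn_ge0.
- exact: measurable_funB.
- exact: h2.
Qed.

Let first_le : first_cst p (eps ^+ 2) <= g.
Proof.
have eps2 := eps2_01 fm.
by rewrite /growth_cst ler_peMl ?growth_ge1// (le_trans ler01)// (first_cst_ge1 fm).
Qed.

Lemma Phi_Fs_bound x y ys (v : V) M : 1 <= M -> scaled M v ->
  all (fun y => psi y <= M) ys ->
  `|Phi (x, y, Fs v ys)| <= varphi x y * (observable_cst * M `^ s).
Proof.
move=> M1 Mv ysM; have M0 : 0 <= M by exact: le_trans M1.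
have gM1 : 1 <= g * M by rewrite mulr_ege1.
apply: le_trans (Phi_bound x y gM1 (scaled_Fders fm M1 Mv ysM)) _.
rewrite ler_wpM2l// powRM// ler_wpM2r ?powR_ge0// /observable_cst.
have [t0 t1] := andP tf01.
rewrite ler_peMl ?powR_ge0// mulr_ege1 ?weight_ge1 ?ler1n//.
have : 0 <= Cf * tf^-1 by rewrite mulr_ge0 ?invr_ge0 ?(le_trans _ Cf_ge1)// ltW.
by lra.
Qed.

Lemma Phi_Fs_diff x y ys (v v' : V) M : 1 <= M -> scaled M v -> scaled M v' ->
  all (fun y => psi y <= M) ys ->
  `|Phi (x, y, Fs v ys) - Phi (x, y, Fs v' ys)| <=
    varphi x y * (observable_cst * tf ^+ size ys * M `^ s).
Proof.
move=> M1 Mv Mv' ysM; have M0 : 0 <= M by exact: le_trans M1.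
have [t0 t1] := andP tf01.
have Cf0 : 0 <= Cf by exact: le_trans Cf_ge1.
have A0 : 0 <= Cf * tf^-1 by rewrite mulr_ge0 ?invr_ge0// ltW.
have q1 : 1 <= 2 `^ q by rewrite weight_ge1// ler1n.
have gs1 : 1 <= g `^ s by exact: weight_ge1.
have q0 : 0 <= 2 `^ q by exact: powR_ge0.
have gs0 : 0 <= g `^ s by exact: powR_ge0.
have Ms0 : 0 <= M `^ s by exact: powR_ge0.
case: ys ysM => [_|y0 zs ysM] /=.
  apply: le_trans (ler_normB _ _) _.
  apply: le_trans (lerD (Phi_bound x y M1 Mv) (Phi_bound x y M1 Mv')) _.
  rewrite -mulrDr ler_wpM2l// expr0 mulr1.
  rewrite (_ : M `^ s + M `^ s = 2 * M `^ s); last by ring.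
  rewrite ler_wpM2r//.
  rewrite /observable_cst -[leLHS]mulr1 ler_pM// -[leLHS]mul1r ler_pM//.
  by rewrite lerDr.
have gM1 : 1 <= g * M by rewrite mulr_ege1.
have D0 : 0 <= Cf * tf ^+ size zs by rewrite mulr_ge0// exprn_ge0// ltW.
have sv := scaled_Fders fm M1 Mv ysM; have sv' := scaled_Fders fm M1 Mv' ysM.
have fM0 : 0 <= first_cst p (eps ^+ 2) * M.
  by rewrite mulr_ge0// (le_trans ler01)// (first_cst_ge1 fm).
apply: le_trans (Phi_diff x y gM1 D0 sv sv' _) _ => [a|].
  apply: le_trans (Fders_forget fm a M1 Mv Mv' ysM) _.
  rewrite ler_pM//.
  - apply: forget_ge0; exact: eps2_01 fm.
  - by rewrite exprn_ge0.
  - have gM0 : 0 <= g * M by exact: le_trans gM1.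
    by rewrite lerXn2r ?nnegrE// ler_wpM2r.
rewrite ler_wpM2l// powRM// /observable_cst exprS.
rewrite (_ : _ * (tf * _) * _ =
  2 `^ q * (Cf * (tf^-1 * tf) + 2 * tf) * tf ^+ size zs * (g `^ s * M `^ s)); last by ring.
rewrite mulVf ?gt_eqF// mulr1 ler_wpM2r ?mulr_ge0// -!mulrA ler_wpM2l//.
by rewrite ler_wpM2r ?exprn_ge0 ?(ltW t0)// lerDl mulr_ge0// ltW.
Qed.

Lemma le_weighted x y c : 0 <= c -> varphi x y * c <= c * (varphi x y * psi y `^ r).
Proof.
move=> c0; rewrite mulrC ler_wpM2l// ler_peMr// weight_ge1//.
by rewrite (le_trans s_ge0).
Qed.

Let o0 : 0 <= observable_cst. Proof. exact: le_trans observable_cst_ge1. Qed.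
Let tf0 : 0 <= tf. Proof. by case/andP: tf01 => /ltW. Qed.

Lemma forgetting_current : forgetting_observable (fun t v => Phi (t.1, t.2, v)).
Proof.
split.
- apply: (measurableT_comp mPhi
    (g := fun w : V * (X * Y) => (w.2.1, w.2.2, w.1))).
  apply: measurable_fun_pair => //; apply: measurable_fun_pair.
    exact: measurableT_comp measurable_fst measurable_snd.
  exact: measurableT_comp measurable_snd measurable_snd.
- move=> x y ys v M M1 Mv ysM; apply: le_trans (Phi_Fs_bound x y M1 Mv ysM) _.
  by apply: le_weighted; rewrite mulr_ge0 ?powR_ge0.
move=> x y ys v v' M M1 Mv Mv' ysM.
apply: le_trans (Phi_Fs_diff x y M1 Mv Mv' ysM) _.
by apply: le_weighted; rewrite mulr_ge0 ?powR_ge0// mulr_ge0// exprn_ge0.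
Qed.

Let scaleM M y : 1 <= M -> [/\ 1 <= M * psi y, M <= M * psi y, psi y <= M * psi y &
  (M * psi y) `^ s <= M `^ s * psi y `^ r].
Proof.
move=> M1; have M0 : 0 <= M by exact: le_trans M1.
have y0 : 0 <= psi y by exact: psi_ge0 fm y.
split.
- by rewrite mulr_ege1.
- by rewrite ler_peMr.
- by rewrite ler_peMl.
by rewrite powRM// ler_wpM2l ?powR_ge0// weight_le_r.
Qed.

(** Here the observation of the current time enters the statistic, which costs
    a power of its weight. *)
Lemma forgetting_updated :
  forgetting_observable (fun t v => Phi (t.1, t.2, F t.2 v)).
Proof.
split.
- apply: (measurableT_comp mPhi
    (g := fun w : V * (X * Y) => (w.2.1, w.2.2, F w.2.2 w.1))).
  have m1 : measurable_fun setT (fun w : V * (X * Y) => w.2.2).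
    exact: measurableT_comp measurable_snd measurable_snd.
  apply: measurable_fun_pair.
    apply: measurable_fun_pair => //.
    exact: measurableT_comp measurable_fst measurable_snd.
  apply: (measurableT_comp mF (g := fun w : V * (X * Y) => (w.2.2, w.1))).
  exact: measurable_fun_pair.
- move=> x y ys v M M1 Mv ysM; have [N1 MN yN le] := scaleM y M1.
  have M0 : 0 <= M by exact: le_trans M1.
  have -> : F y (Fs v ys) = Fs v (rcons ys y) by rewrite foldl_rcons.
  apply: le_trans (Phi_Fs_bound (M := M * psi y) x y N1 _ _) _.
  - by apply: scaled_le Mv; rewrite M0.
  - rewrite all_rcons yN; apply/allP => z /(allP ysM) /le_trans; exact.
  rewrite (_ : observable_cst * _ * _ =
    varphi x y * (observable_cst * (M `^ s * psi y `^ r))); last by ring.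
  by rewrite !ler_wpM2l.
move=> x y ys v v' M M1 Mv Mv' ysM; have [N1 MN yN le] := scaleM y M1.
have M0 : 0 <= M by exact: le_trans M1.
have fr u : F y (Fs u ys) = Fs u (rcons ys y) by rewrite foldl_rcons.
rewrite !fr.
apply: le_trans (Phi_Fs_diff (M := M * psi y) x y N1 _ _ _) _.
- by apply: scaled_le Mv; rewrite M0.
- by apply: scaled_le Mv'; rewrite M0.
- rewrite all_rcons yN; apply/allP => z /(allP ysM) /le_trans; exact.
rewrite (_ : observable_cst * _ * _ * _ = varphi x y *
  (observable_cst * tf ^+ size ys * (M `^ s * psi y `^ r))); last by ring.
have le2 : observable_cst * tf ^+ size (rcons ys y) <=
    observable_cst * tf ^+ size ys.
  rewrite ler_wpM2l// size_rcons exprS ler_piMl ?exprn_ge0//.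
  by case/andP: tf01 => _ /ltW.
rewrite ler_wpM2l//; apply: ler_pM le2 le; last exact: powR_ge0.
by rewrite mulr_ge0// exprn_ge0.
Qed.

End observables.

(** * Limits of the two chains *)

Lemma geometric_cvge (R : realType) (u : nat -> \bar R) (l B rho : R) :
  0 < rho < 1 -> (forall n, (1 <= n)%N -> (`|u n - l%:E| <= (B * rho ^+ n)%:E)%E) ->
  u n @[n --> \oo] --> l%:E.
Proof.
move=> /andP[r0 r1] ub.
have uE n : u n.+1 = (fine (u n.+1))%:E.
  by have := ub n.+1 isT; case: (u n.+1) => [v| |].
rewrite -cvg_shiftS.
rewrite (_ : (fun n => u n.+1) = EFin \o (fun n => fine (u n.+1))); last first.
  by apply/funext => n; rewrite /= -uE.
apply: cvg_EFin; first exact: nearW.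
have c0 : geometric (B * rho) rho k @[k --> \oo] --> (0 : R).
  by apply: cvg_geometric; rewrite gtr0_norm.
apply/cvgrPdist_le => e e0; move/cvgrPdist_le : c0 => /(_ e e0).
apply: filterS => n /=; rewrite sub0r normrN => /(le_trans (ler_norm _)).
apply: le_trans; rewrite distrC -lee_fin -mulrA -exprS.
by have := ub n.+1 isT; rewrite uE.
Qed.

(** The factor [growth_cst p eps `^ s] accounts for the scale of the updated vector
    measure from which the second chain starts. *)
Definition rate_cst (R : realType) (p : nat) (eps q L0 K0 Cf tf t rho : R) : R :=
  let s := p%:R * (q + 1) in
  `|limit_cst s L0 (growth_cst p eps) K0 t rho (observable_cst p eps q Cf tf * L0)|
    * rho^-1 * growth_cst p eps `^ s + 1.

Section chain_limits.
Context (R : realType) (d p : nat) dX (X : measurableType dX)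
  dY (Y : measurableType dY) (mu : {finite_measure set X -> \bar R}) (eps : R)
  (psi : Y -> R) (phi : Y -> X -> R).
Variables (ptheta : 'rV[R]_d -> X -> X -> R) (qtheta : 'rV[R]_d -> Y -> X -> R)
  (th : 'rV[R]_d).
Local Notation rr := (fun (a : midx d p) y x x' => drtheta ptheta qtheta a th y x x').
Hypothesis fm : filter_model mu eps psi phi rr.
Local Notation V := (vmeas X R d p).
Local Notation Z := (Zspace R d p X Y).
Local Notation F := (Fder mu ptheta qtheta th : Y -> V -> V).
Local Notation Fs := (foldl (fun v y => F y v)).
Variables (P : R.-pker X ~> X) (Q : R.-pker X ~> Y).
Local Notation S := (signal P Q).
Variables (Phi : Z -> R) (varphi : X -> Y -> R) (q L0 Cf tf : R).
Hypotheses (mPhi : measurable_fun setT Phi)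
  (mF : measurable_fun setT (fun w : Y * V => F w.1 w.2))
  (mpsi : measurable_fun setT psi)
  (q_ge0 : 0 <= q) (L0_ge1 : 1 <= L0)
  (varphi_ge1 : forall x y, 1 <= varphi x y)
  (mvarphi : forall x, measurable_fun setT (varphi x))
  (c5 : forall x y (La : V), `|Phi (x, y, La)| <= varphi x y * vnorm La `^ q)
  (c5' : forall x y (La La' : V), `|Phi (x, y, La) - Phi (x, y, La')| <=
     varphi x y * vdist La La' * (vnorm La + vnorm La') `^ q)
  (c6 : forall x, (\int[Q x]_y
     (varphi x y * psi y `^ (p%:R * (p%:R + q + 1)))%:E <= L0%:E)%E)
  (Cf_ge1 : 1 <= Cf) (tf01 : 0 < tf < 1)
  (forgetf : forall n, forget p (eps ^+ 2) p n <= Cf * tf ^+ n).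
Variables (pi : probability X R) (K0 delta t rho : R).
Hypotheses (K0_ge1 : 1 <= K0) (delta01 : 0 < delta < 1)
  (c4 : forall x B n, measurable B ->
    (`| nstep (fun x => P x : set X -> \bar R) n x B - pi B |
      <= (K0 * delta ^+ n)%:E)%E)
  (t01 : 0 < t < 1) (rho01 : 0 < rho < 1)
  (tf_t : tf <= t ^+ 2) (delta_t : delta <= t ^+ 2) (t_rho : t <= rho ^+ 2).

Local Notation r := (p%:R * (p%:R + q + 1)).
Local Notation s := (p%:R * (q + 1)).
Local Notation g := (growth_cst p eps).
Local Notation L := (rate_cst p eps q L0 K0 Cf tf t rho).
Local Notation sc := (fun M (v : V) => scaled M v).

Let L0_ge0 : 0 <= L0. Proof. exact: le_trans L0_ge1. Qed.
Let s_ge0 : 0 <= s. Proof. by rewrite mulr_ge0// addr_ge0. Qed.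
Let g_ge1 : 1 <= g := growth_cst_ge1 fm.
Let sc_ex (v : V) : exists2 M, 1 <= M & sc M v.
Proof. by exists (vnorm v); [exact: vnorm_ge1|exact: scaled_vnorm]. Qed.
Let sc_F M v ys : 1 <= M -> sc M v -> all (fun y => psi y <= M) ys ->
  sc (g * M) (Fs v ys).
Proof. exact: (scaled_Fders fm). Qed.
Let sc_le M M' v : 1 <= M <= M' -> sc M v -> sc M' v.
Proof.
by move=> /andP[M1 MM']; apply: scaled_le; rewrite MM' (le_trans ler01).
Qed.
Let psiL0 x : (\int[S x]_t (psi t.2 `^ s)%:E <= L0%:E)%E.
Proof. exact: (signal_psi fm P mpsi varphi_ge1 mvarphi c6). Qed.

Let scaled_point : scaled 1 (point : V).
Proof.
move=> a; rewrite expr1n le_eqVlt; apply/orP; left; apply/eqP.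
by apply: tvnorm_prob => [B mB|]; [exact: measure_ge0|exact: diracT].
Qed.

Let c4' x n B : measurable B ->
  (`|kernel_pow P n x B - pi B| <= (K0 * delta ^+ n)%:E)%E.
Proof. by move=> mB; have := c4 x n mB; rewrite kernel_powE. Qed.

Let averages_limit Psi :
  forgetting_observable mu eps psi ptheta qtheta th varphi q Cf tf Psi ->
  exists l, forall n x v M, 1 <= M -> scaled M v ->
  `|iter n (averaged S F) (observed P Q Psi) (x, v) - l| <=
  limit_cst s L0 g K0 t rho (observable_cst p eps q Cf tf * L0) * rho ^+ n * M `^ s.
Proof.
move=> oP.
have o1 := observable_cst_ge1 fm q_ge0 Cf_ge1 tf01.
have H := observed_forgetting fm P mpsi q_ge0 L0_ge0 varphi_ge1 mvarphi c6
  Cf_ge1 tf01 oP.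
have tf0 : 0 <= tf by case/andP: tf01 => /ltW.
have C0 : 0 <= observable_cst p eps q Cf tf * L0.
  by rewrite mulr_ge0// (le_trans ler01).
exact: (averages_converge mF mpsi s_ge0 L0_ge1 psiL0 g_ge1 sc_ex sc_F sc_le
  scaled_point K0_ge1 delta01 c4' tf0 t01 rho01 tf_t delta_t t_rho C0 H).
Qed.

Let rate_le (n : nat) (A : R) (c : R) : (1 <= n)%N -> 0 <= A -> 0 <= c <= g `^ s ->
  limit_cst s L0 g K0 t rho (observable_cst p eps q Cf tf * L0) * rho ^+ n.-1
    * (c * A) <= L * rho ^+ n * A.
Proof.
case: n => // n _ A0 /andP[c0 cg]; have [r0 r1] := andP rho01.
rewrite /rate_cst; set l := limit_cst _ _ _ _ _ _ _.
rewrite mulrDl mul1r mulrDl -[leLHS]addr0 lerD//; last first.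
  by rewrite mulr_ge0// exprn_ge0// ltW.
rewrite exprS (_ : _ * _ * _ * _ * A =
  `|l| * rho ^+ n * (g `^ s * A) * (rho^-1 * rho)); last by ring.
rewrite mulVf ?gt_eqF// mulr1.
apply: (@le_trans _ _ (`|l| * rho ^+ n * (c * A))).
  by rewrite ler_wpM2r ?mulr_ge0// ler_wpM2r ?exprn_ge0 ?(ltW r0)// ler_norm.
rewrite ler_wpM2l//; first by rewrite mulr_ge0// exprn_ge0// ltW.
by rewrite ler_wpM2r.
Qed.

Let meas_state : measurable_fun setT (fun z : Z => z.1.1).
Proof. exact: measurableT_comp measurable_fst measurable_fst. Qed.

Lemma filter_chain_limit : exists l : R, forall (z : Z) n, (1 <= n)%N ->
  (`|kiter (Pker P Q F) n Phi z - l%:E| <= (L * rho ^+ n * vnorm z.2 `^ s)%:E)%E.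
Proof.
have oP := forgetting_updated fm mPhi mF q_ge0 varphi_ge1 c5 c5' Cf_ge1 tf01 forgetf.
have tO := forgetting_tame_observable fm P mpsi q_ge0 L0_ge0 varphi_ge1 mvarphi c6
  Cf_ge1 tf01 oP.
have [l lP] := averages_limit oP; exists l => -[[x y] La] [//|n] _.
have mm : measurable_fun setT (fun w : (Z * X) * Y =>
    (w.1.2, w.2, F w.2 w.1.1.2) : Z).
  apply: measurable_fun_pair.
    apply: measurable_fun_pair => //.
    exact: measurableT_comp measurable_snd measurable_fst.
  apply: (measurableT_comp mF (g := fun w : (Z * X) * Y => (w.2, w.1.1.2))).
  apply: measurable_fun_pair => //; apply: measurableT_comp measurable_snd _.
  exact: measurableT_comp measurable_fst measurable_fst.
have E := integral_nstep_averaged mF mpsi s_ge0 L0_ge0 psiL0 g_ge1 sc_ex sc_F sc_le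
  (st := fun z : Z => z.2) (move := fun (z : Z) x y => (x, y, F y z.2))
  meas_state measurable_snd mm (fun _ _ _ => erefl) (fun _ _ _ => erefl)
  n ((x, y, La) : Z) mPhi tO (fun _ _ _ => erefl).
have KE : Pker P Q F = fun z => signal_image P Q
    (g := fun (z : Z) x y => (x, y, F y z.2) : Z) meas_state mm z : set Z -> \bar R.
  by apply/funext => z; apply/funext => U.
rewrite /kiter KE E -EFinB /= lee_fin.
apply: le_trans (lP n x La (vnorm La) (vnorm_ge1 La) (@scaled_vnorm _ _ _ _ _ La)) _.
rewrite -[X in _ * X <= _]mul1r; apply: (@rate_le n.+1) => //.
  exact: powR_ge0.
by rewrite ler01 weight_ge1.
Qed.

Lemma tilde_chain_limit : exists l : R, forall (z : Z) n, (1 <= n)%N ->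
  (`|kiter (Pker_tilde P Q F) n Phi z - l%:E| <=
    (L * rho ^+ n * psi z.1.2 `^ r * vnorm z.2 `^ s)%:E)%E.
Proof.
have oP := forgetting_current fm mPhi q_ge0 varphi_ge1 c5 c5' Cf_ge1 tf01 forgetf.
have tO := forgetting_tame_observable fm P mpsi q_ge0 L0_ge0 varphi_ge1 mvarphi c6
  Cf_ge1 tf01 oP.
have [l lP] := averages_limit oP; exists l => -[[x y] La] [//|n] _.
have mst : measurable_fun setT (fun z : Z => F z.1.2 z.2).
  apply: (measurableT_comp mF (g := fun z : Z => (z.1.2, z.2))).
  apply: measurable_fun_pair => //.
  exact: measurableT_comp measurable_snd measurable_fst.
have mm : measurable_fun setT (fun w : (Z * X) * Y =>
    (w.1.2, w.2, F w.1.1.1.2 w.1.1.2) : Z).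
  apply: measurable_fun_pair.
    apply: measurable_fun_pair => //.
    exact: measurableT_comp measurable_snd measurable_fst.
  apply: (measurableT_comp mst (g := fun w : (Z * X) * Y => w.1.1)).
  exact: measurableT_comp measurable_fst measurable_fst.
have E := integral_nstep_averaged mF mpsi s_ge0 L0_ge0 psiL0 g_ge1 sc_ex sc_F sc_le
  (st := fun z : Z => F z.1.2 z.2)
  (move := fun (z : Z) x y => (x, y, F z.1.2 z.2))
  meas_state mst mm (fun _ _ _ => erefl) (fun _ _ _ => erefl)
  n ((x, y, La) : Z) mPhi tO (fun _ _ _ => erefl).
have KE : Pker_tilde P Q F = fun z => signal_image P Q
    (g := fun (z : Z) x y => (x, y, F z.1.2 z.2) : Z) meas_state mm z : set Z -> \bar R.
  by apply/funext => z; apply/funext => U.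
rewrite /kiter KE E -EFinB /= lee_fin.
have v1 := vnorm_ge1 La; have y1 := fm_psi fm y.
have v0 : 0 <= vnorm La by exact: le_trans v1.
have y0 : 0 <= psi y by exact: le_trans y1.
have g0 : 0 <= g by exact: le_trans g_ge1.
have vy1 : 1 <= vnorm La * psi y by rewrite mulr_ege1.
(* the update by [y] is of scale vnorm La * psi y, up to the growth constant *)
have scF : scaled (g * (vnorm La * psi y)) (F y La).
  apply: (@sc_F _ La [:: y] vy1); last by rewrite /= andbT ler_peMl.
  by apply: scaled_le (scaled_vnorm La); rewrite v0 ler_peMr.
apply: le_trans (lP n x _ _ _ scF) _; first by rewrite mulr_ege1.
have vy0 : 0 <= vnorm La * psi y by exact: mulr_ge0.
rewrite (powRM s g0 vy0) (powRM s v0 y0).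
apply: le_trans (@rate_le n.+1 (vnorm La `^ s * psi y `^ s) (g `^ s) isT _ _) _.
- by rewrite mulr_ge0 ?powR_ge0.
- by rewrite powR_ge0 lexx.
have [r0 r1] := andP rho01.
rewrite [X in _ * X <= _]mulrC mulrA ler_wpM2r ?powR_ge0// ler_wpM2l//.
  rewrite mulr_ge0 ?exprn_ge0 ?(ltW r0)// addr_ge0// mulr_ge0 ?powR_ge0//.
  by rewrite mulr_ge0// invr_ge0 ltW.
exact: (weight_le_r fm).
Qed.

End chain_limits.

Theorem theorem2p3 (R : realType) (p : nat) (eps delta q K0 L0 : R)
  (p_ge1 : (1 <= p)%N) (eps01 : 0 < eps < 1) (delta01 : 0 < delta < 1)
  (q_ge0 : 0 <= q) (K0_ge1 : 1 <= K0) (L0_ge1 : 1 <= L0) :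
  let r : R := p%:R * (p%:R + q + 1) in
  let s : R := p%:R * (q + 1) in
  exists rho L : R, 0 < rho < 1 /\ 1 <= L /\
  forall (d dx dy : nat) (d_ge1 : (1 <= d)%N) (dx_ge1 : (1 <= dx)%N)
    (dy_ge1 : (1 <= dy)%N)
    (Theta : set 'rV[R]_d) (openTheta : open Theta)
    (bndTheta : bounded_set Theta)
    (SX : set (borelRn R dx)) (mSX : measurable SX) (SX0 : SX !=set0)
    (SY : set (borelRn R dy)) (mSY : measurable SY) (SY0 : SY !=set0),
  let X := subRn SX0 in
  let Y := subRn SY0 in
  let V := vmeas X R d p in
  let Z := Zspace R d p X Y in
  forall (mu : {measure set X -> \bar R}) (nu : {measure set Y -> \bar R})
    (ptheta : 'rV[R]_d -> X -> X -> R) (qtheta : 'rV[R]_d -> Y -> X -> R)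
    (ptheta_ge0 : forall th x' x, Theta th -> 0 <= ptheta th x' x)
    (qtheta_ge0 : forall th y x, Theta th -> 0 <= qtheta th y x)
    (mptheta : forall th, Theta th ->
      measurable_fun [set: X * X] (fun w : X * X => ptheta th w.1 w.2))
    (mqtheta : forall th, Theta th ->
      measurable_fun [set: Y * X] (fun w : Y * X => qtheta th w.1 w.2))
    (ptheta1 : forall th x, Theta th ->
      (\int[mu]_x' (ptheta th x' x)%:E = 1)%E)
    (qtheta1 : forall th x, Theta th ->
      (\int[nu]_y (qtheta th y x)%:E = 1)%E)
    (dptheta : forall x' x,
      ntimes_differentiable p Theta (fun th => ptheta th x' x))
    (dqtheta : forall y x,
      ntimes_differentiable p Theta (fun th => qtheta th y x))
    (P : R.-pker X ~> X) (Q : R.-pker X ~> Y)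
    (Phi : 'rV[R]_d -> Z -> R)
    (mPhi : forall th, Theta th -> measurable_fun [set: Z] (Phi th)),
  let rth := rtheta ptheta qtheta in
  forall
    (* condition (1) *)
    (c1 : forall th y, Theta th -> exists muth : {measure set X -> \bar R},
      (0 < muth setT < +oo)%E /\
      forall x B, measurable B ->
        (eps%:E * muth B <= \int[mu]_(x' in B) (rth th y x' x)%:E
          <= muth B * (eps^-1)%:E)%E)
    (* condition (2) *)
    (psi : Y -> R) (psi_ge1 : forall y, 1 <= psi y)
    (mpsi : measurable_fun [set: Y] psi)
    (c2 : forall th x x' y (a : midx d p), Theta th -> a != midx0 d p ->
      `|drtheta ptheta qtheta a th y x' x| <= psi y ^+ mabs a * rth th y x' x)
    (* condition (3) *)
    (phi : Y -> X -> R) (phi_ge1 : forall y x, 1 <= phi y x)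
    (mphi : forall y, measurable_fun [set: X] (phi y))
    (c3 : forall th x x' y, Theta th -> rth th y x' x <= phi y x')
    (c3' : forall y, (\int[mu]_x'' (phi y x'')%:E < +oo)%E)
    (* condition (4) *)
    (c4 : exists pi : probability X R, forall x B n, measurable B ->
      (`| nstep (fun x => P x : set X -> \bar R) n x B - pi B |
        <= (K0 * delta ^+ n)%:E)%E)
    (* condition (5) *)
    (varphi : X -> Y -> R) (varphi_ge1 : forall x y, 1 <= varphi x y)
    (mvarphi : forall x, measurable_fun [set: Y] (varphi x))
    (c5 : forall th x y (La : V), Theta th ->
      `|Phi th (x, y, La)| <= varphi x y * vnorm La `^ q)
    (c5' : forall th x y (La La' : V), Theta th ->
      `|Phi th (x, y, La) - Phi th (x, y, La')| <=
        varphi x y * vdist La La' * (vnorm La + vnorm La') `^ q)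
    (* condition (6) *)
    (c6 : forall x, (\int[Q x]_y (varphi x y * psi y `^ r)%:E <= L0%:E)%E),
  let Pi th := Pker P Q (Fder mu ptheta qtheta th) in
  let Pit th := Pker_tilde P Q (Fder mu ptheta qtheta th) in
  exists phi_ phit_ : 'rV[R]_d -> R,
    (forall th (z : Z), Theta th ->
      kiter (Pi th) n (Phi th) z @[n --> \oo] --> (phi_ th)%:E /\
      kiter (Pit th) n (Phi th) z @[n --> \oo] --> (phit_ th)%:E) /\
    (forall th x y (La : V) n, Theta th -> (1 <= n)%N ->
      (`| kiter (Pi th) n (Phi th) (x, y, La) - (phi_ th)%:E |
        <= (L * rho ^+ n * vnorm La `^ s)%:E)%E /\
      (`| kiter (Pit th) n (Phi th) (x, y, La) - (phit_ th)%:E |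
        <= (L * rho ^+ n * psi y `^ r * vnorm La `^ s)%:E)%E).
Proof.
have [e0 e1] := andP eps01.
have eps2_01 : 0 < eps ^+ 2 < 1 by rewrite exprn_gt0// expr_lt1// ltW.
have [Cf [tf [Cf1 tf01 forgetf]]] := forget_decay p p eps2_01.
have max01 : 0 < Num.max tf delta < 1.
  have [t0 t1] := andP tf01; have [d0 d1] := andP delta01.
  by rewrite lt_max t0 gt_max t1.
(* the first square root absorbs the factor linear in the number of steps, the
   second one the use of only half of the steps for each effect *)
have [t t01 maxt] := sqrt_ratio max01; have [rho rho01 trho] := sqrt_ratio t01.
have tft : tf <= t ^+ 2 by apply: le_trans maxt; rewrite le_max lexx.
have deltat : delta <= t ^+ 2 by apply: le_trans maxt; rewrite le_max lexx orbT.
move=> r s; exists rho, (rate_cst p eps q L0 K0 Cf tf t rho).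
split => //; split.
  have [r0 r1] := andP rho01.
  by rewrite /rate_cst lerDr mulr_ge0 ?powR_ge0// mulr_ge0// invr_ge0 ltW.
move=> d dx dy _ _ _ Theta oT _ SX _ SX0 SY _ SY0 X Y V Z mu nu ptheta qtheta.
move=> p0 q0 mp mq _ _ dp dq P Q Phi mPhi rth c1 psi psi1 mpsi c2.
move=> phi phi1 mphi c3 c3' [pi c4] varphi varphi1 mvarphi c5 c5' c6 Pi Pit.
(* phi is at least 1 and integrable *)
have mufin : (mu setT < +oo)%E.
  apply: le_lt_trans (c3' point); rewrite -[mu setT]mul1e -integral_cst//.
  apply: ge0_le_integral => //; first exact/measurable_EFinP.
  by move=> x _; rewrite lee_fin.
have [mu' muE] := finite_measure_of mufin.
have [G XG] := subRn_generated SX0.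
have chains th : Theta th -> exists l lt : R, forall (z : Z) n, (1 <= n)%N ->
    (`|kiter (Pi th) n (Phi th) z - l%:E| <=
      (rate_cst p eps q L0 K0 Cf tf t rho * rho ^+ n * vnorm z.2 `^ s)%:E)%E /\
    (`|kiter (Pit th) n (Phi th) z - lt%:E| <=
      (rate_cst p eps q L0 K0 Cf tf t rho * rho ^+ n * psi z.1.2 `^ r *
        vnorm z.2 `^ s)%:E)%E.
  move=> Tth.
  have fm : filter_model mu' eps psi phi
      (fun (a : midx d p) y x x' => drtheta ptheta qtheta a th y x x').
    apply: (filter_model_of_conditions oT p0 q0 mp mq dp dq) => //.
    - by move=> y; have := c1 th y Tth; rewrite -muE; exact.
    - by move=> x x' y a; exact: c2.
    - by move=> x x' y; exact: c3.
  have mF := measurable_Fder fm XG.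
  have [l lP] := filter_chain_limit fm (mPhi th Tth) mF mpsi q_ge0 L0_ge1 varphi1 mvarphi
    (fun x y La => c5 th x y La Tth) (fun x y La La' => c5' th x y La La' Tth)
    c6 Cf1 tf01 forgetf K0_ge1 delta01 c4 t01 rho01 tft deltat trho.
  have [lt ltP] := tilde_chain_limit fm (mPhi th Tth) mF mpsi q_ge0 L0_ge1 varphi1 mvarphi
    (fun x y La => c5 th x y La Tth) (fun x y La La' => c5' th x y La La' Tth)
    c6 Cf1 tf01 forgetf K0_ge1 delta01 c4 t01 rho01 tft deltat trho.
  exists l, lt => z n n1; rewrite /Pi /Pit -muE; split; [exact: lP|exact: ltP].
pose phi_ th := if pselect (Theta th) is left h then sval (cid (chains th h)) else 0.
pose phit_ th := if pselect (Theta th) is left h then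
  sval (cid (svalP (cid (chains th h)))) else 0.
have limits th (z : Z) n : Theta th -> (1 <= n)%N ->
    (`|kiter (Pi th) n (Phi th) z - (phi_ th)%:E| <=
      (rate_cst p eps q L0 K0 Cf tf t rho * rho ^+ n * vnorm z.2 `^ s)%:E)%E /\
    (`|kiter (Pit th) n (Phi th) z - (phit_ th)%:E| <=
      (rate_cst p eps q L0 K0 Cf tf t rho * rho ^+ n * psi z.1.2 `^ r *
        vnorm z.2 `^ s)%:E)%E.
  move=> Tth n1; rewrite /phi_ /phit_; case: pselect => // h.
  exact: (svalP (cid (svalP (cid (chains th h)))) z n n1).
exists phi_, phit_; split=> [th z Tth|th x y La n Tth n1].
  split.
    apply: (@geometric_cvge _ _ _
      (rate_cst p eps q L0 K0 Cf tf t rho * vnorm z.2 `^ s) rho) => // n n1.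
    by rewrite mulrAC; have [] := limits th z n Tth n1.
  apply: (@geometric_cvge _ _ _ (rate_cst p eps q L0 K0 Cf tf t rho *
    psi z.1.2 `^ r * vnorm z.2 `^ s) rho) => // n n1.
  have [_] := limits th z n Tth n1; rewrite [in X in _ -> X](_ : _ * rho ^+ n =
    rate_cst p eps q L0 K0 Cf tf t rho * rho ^+ n * psi z.1.2 `^ r * vnorm z.2 `^ s) //.
  by ring.
exact: (limits th (x, y, La) n Tth n1).
Qed.
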